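(* Let $X$ be a Banach space, let $A: D(A)\subset X\to X$ be a positive operator, and let $\Lambda_1: D(A)\times D(A)\times D(A)\subset X\times X\times X\to X\times X\times X$ be the operator $$\Lambda_1=\begin{pmatrix} A&0&0\\ 0&A&0\\ I&0&A\end{pmatrix}.$$ Then for all $\alpha\in(0,1)$, $$\Lambda_1^{-\alpha}=\begin{pmatrix} A^{-\alpha}&0&0\\ 0&A^{-\alpha}&0\\ -\alpha A^{-\alpha-1}&0&A^{-\alpha}\end{pmatrix},\qquad \Lambda_1^{-\alpha}\in\mathcal L(X\times X\times X),$$ and $$\Lambda_1^{\alpha}=\begin{pmatrix} A^{\alpha}&0&0\\ 0&A^{\alpha}&0\\ \alpha A^{\alpha-1}&0&A^{\alpha}\end{pmatrix},\qquad D(\Lambda_1^{\alpha})=X^{\alpha}\times X^{\alpha}\times X^{\alpha}.$$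
   Context: A closed densely defined operator $A:D(A)\subset X\to X$ on a Banach space $X$ is called positive if there is $M\ge 1$ such that $[0,\infty)\subset\rho(-A)$ and $(1+s)\|(s+A)^{-1}\|_{\mathcal L(X)}\le M$ for all real $s>0$. Fractional powers of a positive operator $A$: for $\alpha>0$, $A^{-\alpha}:=\frac{1}{2\pi i}\int_\Gamma(-\lambda)^{-\alpha}(\lambda+A)^{-1}\,d\lambda\in\mathcal L(X)$ (principal branch), where $\Gamma$ is a contour from $\infty e^{-i\psi}$ to $\infty e^{i\psi}$ lying in $(\{|\arg z|\le\psi\}\cup B(0,r_0))\setminus[0,\infty)$, with $0<\psi<\arcsin(\frac1{2M})$ and $0<r_0<\frac1{2M}$. For $\alpha\in(0,1)$ this equals $\frac{\sin(\pi\alpha)}{\pi}\int_0^\infty s^{-\alpha}(s+A)^{-1}ds$. The operator $A^{-\alpha}$ is injective, and $A^{\alpha}:=(A^{-\alpha})^{-1}$ with domain $D(A^\alpha)=R(A^{-\alpha})$ (the range). $X^{\alpha}$ denotes $D(A^\alpha)$ equipped with the graph norm. The operator $\Lambda_1$ is a positive operator on the Banach space $X\times X\times X$, and its fractional powers are those of a positive operator on that space. *)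

(* Defs.v *)
From Stdlib Require Import Reals Lra List.
From Stdlib Require Import ClassicalEpsilon FunctionalExtensionality ProofIrrelevance.
From Coquelicot Require Import Coquelicot.
Open Scope R_scope.

Section BoundedOperators.

Variable V : NormedModule C_AbsRing.

Record BL := mkBL { bl_fun :> V -> V ; bl_linear : is_linear bl_fun }.

Lemma bl_ext (f g : BL) : (forall x, f x = g x) -> f = g.
Proof.
destruct f as [f Hf], g as [g Hg]; simpl; intros H.
assert (E : f = g) by (apply functional_extensionality; exact H).
subst g; f_equal; apply proof_irrelevance.
Qed.

Lemma bl_plus_linear (f g : BL) : is_linear (fun x : V => plus (f x) (g x)).
Proof.
destruct f as [f [Fp Fs [Mf [Mf0 HMf]]]], g as [g [Gp Gs [Mg [Mg0 HMg]]]]; simpl.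
split.
- intros x y; rewrite Fp, Gp, <- !plus_assoc; f_equal.
  rewrite !plus_assoc; f_equal; apply plus_comm.
- intros k x; rewrite Fs, Gs; symmetry.
  exact (scal_distr_l k (f x) (g x)).
- exists (Mf + Mg); split; [lra|]; intros x.
  apply Rle_trans with (1 := norm_triangle (f x) (g x)).
  rewrite Rmult_plus_distr_r; apply Rplus_le_compat; [apply HMf | apply HMg].
Qed.

Lemma bl_scal_linear (a : C) (f : BL) :
  is_linear (fun x : V => scal (a : C_AbsRing) (f x)).
Proof.
destruct f as [f [Fp Fs [Mf [Mf0 HMf]]]]; simpl; split.
- intros x y; rewrite Fp; exact (scal_distr_l (K := C_Ring) a (f x) (f y)).
- intros k x; rewrite Fs.
  change (scal (a : C_Ring) (scal (k : C_Ring) (f x))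
          = scal (k : C_Ring) (scal (a : C_Ring) (f x))).
  rewrite !scal_assoc; f_equal; apply Cmult_comm.
- assert (Ha := Cmod_ge_0 a).
  exists (Cmod a * Mf + 1); split.
  + assert (0 <= Cmod a * Mf) by (apply Rmult_le_pos; lra); lra.
  + intros x; apply Rle_trans with (1 := norm_scal (K := C_AbsRing) a (f x)).
    change (abs (a : C_AbsRing)) with (Cmod a).
    assert (H1 := Rmult_le_compat_l _ _ _ Ha (HMf x)).
    assert (H2 := norm_ge_0 x); lra.
Qed.

Lemma bl_zero_linear : is_linear (fun _ : V => zero : V).
Proof.
split.
- intros x y; symmetry; apply plus_zero_r.
- intros k x; symmetry; exact (scal_zero_r (K := C_Ring) k).
- exists 1; split; [lra|]; intros x.
  rewrite norm_zero; assert (H := norm_ge_0 x); lra.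
Qed.

Definition bl_plus (f g : BL) : BL := mkBL _ (bl_plus_linear f g).
Definition bl_scal (a : C) (f : BL) : BL := mkBL _ (bl_scal_linear a f).
Definition bl_zero : BL := mkBL _ bl_zero_linear.
Definition bl_opp (f : BL) : BL := bl_scal (Copp (RtoC 1)) f.

Lemma bl_plus_comm f g : bl_plus f g = bl_plus g f.
Proof. apply bl_ext; intros x; apply plus_comm. Qed.

Lemma bl_plus_assoc f g h : bl_plus f (bl_plus g h) = bl_plus (bl_plus f g) h.
Proof. apply bl_ext; intros x; apply plus_assoc. Qed.

Lemma bl_plus_zero f : bl_plus f bl_zero = f.
Proof. apply bl_ext; intros x; apply plus_zero_r. Qed.

Lemma bl_opp_fun f (x : V) : bl_opp f x = opp (f x).
Proof. exact (scal_opp_one (K := C_Ring) (f x)). Qed.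

Lemma bl_plus_opp f : bl_plus f (bl_opp f) = bl_zero.
Proof.
apply bl_ext; intros x; simpl bl_fun.
change (plus (f x) (bl_opp f x) = zero); rewrite bl_opp_fun.
exact (plus_opp_r (G := NormedModule.AbelianGroup C_AbsRing V) (f x)).
Qed.

Definition BL_AbelianMonoid_mixin :=
  AbelianMonoid.Mixin BL bl_plus bl_zero bl_plus_comm bl_plus_assoc bl_plus_zero.
Canonical BL_AbelianMonoid := AbelianMonoid.Pack BL BL_AbelianMonoid_mixin BL.

Definition BL_AbelianGroup_mixin :=
  AbelianGroup.Mixin BL_AbelianMonoid bl_opp bl_plus_opp.
Canonical BL_AbelianGroup :=
  AbelianGroup.Pack BL
    (AbelianGroup.Class BL BL_AbelianMonoid_mixin BL_AbelianGroup_mixin) BL.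

Lemma bl_scal_assoc (a b : C_Ring) (f : BL) :
  bl_scal a (bl_scal b f) = bl_scal (mult a b) f.
Proof. apply bl_ext; intros x; exact (scal_assoc (K := C_Ring) a b (f x)). Qed.

Lemma bl_scal_one (f : BL) : bl_scal (one : C_Ring) f = f.
Proof. apply bl_ext; intros x; exact (scal_one (K := C_Ring) (f x)). Qed.

Lemma bl_scal_distr_l (a : C_Ring) (f g : BL) :
  bl_scal a (bl_plus f g) = bl_plus (bl_scal a f) (bl_scal a g).
Proof. apply bl_ext; intros x; exact (scal_distr_l (K := C_Ring) a (f x) (g x)). Qed.

Lemma bl_scal_distr_r (a b : C_Ring) (f : BL) :
  bl_scal (plus a b) f = bl_plus (bl_scal a f) (bl_scal b f).
Proof. apply bl_ext; intros x; exact (scal_distr_r (K := C_Ring) a b (f x)). Qed.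

Definition BL_ModuleSpace_mixin :=
  ModuleSpace.Mixin C_Ring BL_AbelianGroup bl_scal
    bl_scal_assoc bl_scal_one bl_scal_distr_l bl_scal_distr_r.
Canonical BL_ModuleSpace :=
  ModuleSpace.Pack C_Ring BL
    (ModuleSpace.Class C_Ring BL (AbelianGroup.class BL_AbelianGroup)
       BL_ModuleSpace_mixin) BL.

Definition op_norm (f : BL) : R :=
  real (Glb_Rbar (fun M => 0 <= M /\ forall x : V, norm (f x) <= M * norm x)).

Lemma op_norm_spec (f : BL) :
  0 <= op_norm f /\
  (forall x : V, norm (f x) <= op_norm f * norm x) /\
  (forall M, 0 <= M -> (forall x : V, norm (f x) <= M * norm x) -> op_norm f <= M).
Proof.
unfold op_norm.
set (E := fun M => 0 <= M /\ forall x : V, norm (f x) <= M * norm x).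
destruct (Glb_Rbar_correct E) as [Hlb Hglb].
destruct (linear_norm f (bl_linear f)) as [M0 [M0pos HM0]].
assert (E0 : E M0) by (split; [lra | exact HM0]).
assert (H0 : Rbar_le 0 (Glb_Rbar E)) by (apply Hglb; intros M [HM _]; exact HM).
assert (H1 := Hlb _ E0).
destruct (Glb_Rbar E) as [m| |]; simpl in H0, H1 |- *; try contradiction.
split; [exact H0|split].
- intros x.
  destruct (Req_dec (norm x) 0) as [Hx|Hx].
  + assert (H := HM0 x); rewrite Hx in H |- *; lra.
  + assert (Hx0 := norm_ge_0 x).
    assert (Hle : Rbar_le (norm (f x) / norm x) m).
    { apply Hglb; intros M [_ HM]; simpl.
      apply Rle_div_l; [lra | apply HM]. }
    simpl in Hle; apply Rle_div_l in Hle; lra.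
- intros M HM HMx; exact (Hlb M (conj HM HMx)).
Qed.

Lemma op_norm_triangle (f g : BL) :
  op_norm (bl_plus f g) <= op_norm f + op_norm g.
Proof.
destruct (op_norm_spec f) as [f0 [fb _]], (op_norm_spec g) as [g0 [gb _]].
apply op_norm_spec; [lra|]; intros x; simpl.
apply Rle_trans with (1 := norm_triangle (f x) (g x)).
rewrite Rmult_plus_distr_r; apply Rplus_le_compat; auto.
Qed.

Lemma op_norm_scal (a : C_AbsRing) (f : BL) :
  op_norm (bl_scal a f) <= abs a * op_norm f.
Proof.
destruct (op_norm_spec f) as [f0 [fb _]].
apply op_norm_spec; [apply Rmult_le_pos; [apply abs_ge_0 | exact f0]|].
intros x; simpl.
apply Rle_trans with (1 := norm_scal (K := C_AbsRing) a (f x)).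
rewrite Rmult_assoc; apply Rmult_le_compat_l; [apply abs_ge_0 | apply fb].
Qed.

Lemma op_norm_eq_zero (f : BL) : op_norm f = 0 -> f = bl_zero.
Proof.
intros H; apply bl_ext; intros x; simpl.
apply norm_eq_zero.
destruct (op_norm_spec f) as [_ [fb _]].
assert (H1 := fb x); rewrite H in H1.
assert (H2 := norm_ge_0 (f x)); lra.
Qed.

Definition bl_ball (f : BL) (eps : R) (g : BL) : Prop := op_norm (minus g f) < eps.

Lemma op_norm_zero : op_norm bl_zero = 0.
Proof.
destruct (op_norm_spec bl_zero) as [H [_ Hm]]; apply Rle_antisym; [|exact H].
apply Hm; [lra|]; intros x; simpl; rewrite norm_zero; lra.
Qed.

Lemma bl_ball_center (f : BL) (eps : posreal) : bl_ball f eps f.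
Proof.
unfold bl_ball; rewrite minus_eq_zero.
change (op_norm bl_zero < eps); rewrite op_norm_zero; apply cond_pos.
Qed.

Lemma bl_ball_sym (f g : BL) (eps : R) : bl_ball f eps g -> bl_ball g eps f.
Proof.
unfold bl_ball; intros H; apply Rle_lt_trans with (2 := H).
replace (minus f g) with (bl_scal (Copp (RtoC 1)) (minus g f)).
- apply Rle_trans with (1 := op_norm_scal _ _).
  change (Cmod (Copp (RtoC 1)) * op_norm (minus g f) <= op_norm (minus g f)).
  rewrite Cmod_opp, Cmod_1; lra.
- change (opp (minus g f) = minus f g); apply opp_minus.
Qed.

Lemma bl_ball_triangle (f g h : BL) (e1 e2 : R) :
  bl_ball f e1 g -> bl_ball g e2 h -> bl_ball f (e1 + e2) h.
Proof.
unfold bl_ball; intros H1 H2.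
rewrite (minus_trans g h f).
apply Rle_lt_trans with (1 := op_norm_triangle _ _); lra.
Qed.

Definition BL_UniformSpace_mixin :=
  UniformSpace.Mixin BL bl_zero bl_ball bl_ball_center bl_ball_sym bl_ball_triangle.
Canonical BL_UniformSpace := UniformSpace.Pack BL BL_UniformSpace_mixin BL.

Canonical BL_NormedModuleAux :=
  NormedModuleAux.Pack C_AbsRing BL
    (NormedModuleAux.Class C_AbsRing BL
       (ModuleSpace.class C_Ring BL_ModuleSpace) BL_UniformSpace_mixin) BL.

Lemma bl_norm_ball1 (f g : BL) (eps : R) :
  op_norm (minus g f) < eps -> ball f eps g.
Proof. intros H; exact H. Qed.

Lemma bl_norm_ball2 (f g : BL) (eps : posreal) :
  ball f eps g -> op_norm (minus g f) < 1 * eps.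
Proof. intros H; rewrite Rmult_1_l; exact H. Qed.

Definition BL_NormedModule_mixin :=
  NormedModule.Mixin C_AbsRing BL_NormedModuleAux op_norm 1
    op_norm_triangle op_norm_scal bl_norm_ball1 bl_norm_ball2 op_norm_eq_zero.
Canonical BL_NormedModule :=
  NormedModule.Pack C_AbsRing BL
    (NormedModule.Class C_AbsRing BL
       (NormedModuleAux.class C_AbsRing BL_NormedModuleAux)
       BL_NormedModule_mixin) BL.

End BoundedOperators.

Arguments bl_fun {V} _ _.
Arguments bl_zero {V}.
Arguments op_norm {V} _.

(** [is_RInt] needs real scalars, so complex normed modules have to be
    restricted to R before integrating. *)

Section RestrictScalars.

Variable W : NormedModule C_AbsRing.

Definition rscal (r : R) (x : W) : W := scal (RtoC r : C_AbsRing) x.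

Lemma rscal_assoc (a b : R_Ring) (x : W) : rscal a (rscal b x) = rscal (mult a b) x.
Proof.
unfold rscal; change (mult a b) with (Rmult a b); rewrite RtoC_mult.
exact (scal_assoc (K := C_Ring) (RtoC a) (RtoC b) x).
Qed.

Lemma rscal_one (x : W) : rscal (one : R_Ring) x = x.
Proof. exact (scal_one (K := C_Ring) x). Qed.

Lemma rscal_distr_l (a : R_Ring) (x y : W) :
  rscal a (plus x y) = plus (rscal a x) (rscal a y).
Proof. exact (scal_distr_l (K := C_Ring) (RtoC a) x y). Qed.

Lemma rscal_distr_r (a b : R_Ring) (x : W) :
  rscal (plus a b) x = plus (rscal a x) (rscal b x).
Proof.
unfold rscal; change (plus a b) with (Rplus a b); rewrite RtoC_plus.
exact (scal_distr_r (K := C_Ring) (RtoC a) (RtoC b) x).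
Qed.

Definition real_ModuleSpace_class : ModuleSpace.class_of R_Ring W :=
  ModuleSpace.Class R_Ring W
    (AbelianGroup.class (NormedModule.AbelianGroup C_AbsRing W))
    (ModuleSpace.Mixin R_Ring (NormedModule.AbelianGroup C_AbsRing W) rscal
       rscal_assoc rscal_one rscal_distr_l rscal_distr_r).

Definition real_NormedModuleAux : NormedModuleAux R_AbsRing :=
  NormedModuleAux.Pack R_AbsRing W
    (NormedModuleAux.Class R_AbsRing W real_ModuleSpace_class
       (UniformSpace.class (NormedModule.UniformSpace C_AbsRing W))) W.

Lemma real_norm_scal (r : R_AbsRing) (x : W) :
  norm (rscal r x) <= abs r * norm x.
Proof.
change (abs r) with (Rabs r); rewrite <- Cmod_R.
exact (norm_scal (K := C_AbsRing) (RtoC r) x).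
Qed.

Definition real_NormedModule : NormedModule R_AbsRing :=
  NormedModule.Pack R_AbsRing W
    (NormedModule.Class R_AbsRing W
       (NormedModuleAux.class R_AbsRing real_NormedModuleAux)
       (NormedModule.Mixin R_AbsRing real_NormedModuleAux
          (@norm C_AbsRing W) (@norm_factor C_AbsRing W)
          norm_triangle real_norm_scal
          (@norm_compat1 C_AbsRing W) (@norm_compat2 C_AbsRing W)
          norm_eq_zero)) W.

End RestrictScalars.

(** The value [app A x] is irrelevant when [x] is not in the domain; operators
    are compared with [op_eq]. *)
Record operator (V : NormedModule C_AbsRing) :=
  mkOp { dom : V -> Prop ; app :> V -> V }.

Arguments mkOp {V} _ _.
Arguments dom {V} _ _.
Arguments app {V} _ _.

Section Operators.

Variable V : NormedModule C_AbsRing.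
Implicit Types (A B : operator V) (T : BL V) (x y : V).

Definition op_eq A B : Prop :=
  (forall x, dom A x <-> dom B x) /\ (forall x, dom A x -> A x = B x).

Definition op_of_bl T : operator V := mkOp (fun _ => True) T.
Definition op_zero : operator V := mkOp (fun _ => True) (fun _ => zero).
Definition op_id : operator V := mkOp (fun _ => True) (fun x => x).
Definition op_scal (a : C) A : operator V :=
  mkOp (dom A) (fun x => scal (a : C_AbsRing) (A x)).
Definition op_opp A : operator V := mkOp (dom A) (fun x => opp (A x)).

Definition op_inv T : operator V :=
  mkOp (fun x => exists y, T y = x)
       (fun x => epsilon (inhabits zero) (fun y => T y = x)).

Definition linear_operator A : Prop :=
  dom A zero /\
  (forall x y, dom A x -> dom A y -> dom A (plus x y) /\ A (plus x y) = plus (A x) (A y)) /\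
  (forall (a : C_AbsRing) x, dom A x -> dom A (scal a x) /\ A (scal a x) = scal a (A x)).

Definition closed_operator A : Prop :=
  closed (fun p : V * V => dom A (fst p) /\ A (fst p) = snd p).

Definition densely_defined A : Prop :=
  forall x (eps : posreal), exists y, dom A y /\ ball x eps y.

(** [T] is the bounded inverse of [z - B : D(B) -> V]. *)
Definition is_resolvent B (z : C) T : Prop :=
  (forall x, dom B (T x) /\ minus (scal (z : C_AbsRing) (T x)) (B (T x)) = x) /\
  (forall x, dom B x -> T (minus (scal (z : C_AbsRing) x) (B x)) = x).

Definition resolvent_set B (z : C) : Prop := exists T, is_resolvent B z T.

Definition resolvent B (z : C) : BL V :=
  epsilon (inhabits bl_zero) (is_resolvent B z).

Definition positivity_constant A (M : R) : Prop :=
  1 <= M /\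
  (forall s, 0 <= s -> resolvent_set (op_opp A) (RtoC s)) /\
  (forall s, 0 < s -> (1 + s) * op_norm (resolvent (op_opp A) (RtoC s)) <= M).

Definition positive_operator A : Prop :=
  linear_operator A /\ closed_operator A /\ densely_defined A /\
  exists M, positivity_constant A M.

End Operators.

Arguments op_eq {V} _ _.
Arguments op_of_bl {V} _.
Arguments op_zero {V}.
Arguments op_id {V}.
Arguments op_scal {V} _ _.
Arguments op_opp {V} _.
Arguments op_inv {V} _.
Arguments is_resolvent {V} _ _ _.
Arguments resolvent_set {V} _ _.
Arguments resolvent {V} _ _.
Arguments linear_operator {V} _.
Arguments closed_operator {V} _.
Arguments densely_defined {V} _.
Arguments positivity_constant {V} _ _.
Arguments positive_operator {V} _.

(** Principal argument in (-PI, PI]; meaningful for [z <> 0]. *)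
Definition Carg (z : C) : R :=
  if Rle_dec 0 (Im z) then acos (Re z / Cmod z) else - acos (Re z / Cmod z).

(** Principal branch of [z ^ a] for real [a] and [z <> 0]. *)
Definition Crpower (z : C) (a : R) : C :=
  Cmult (RtoC (Rpower (Cmod z) a)) (cos (a * Carg z), sin (a * Carg z)).

Definition contour_region (psi r0 : R) (z : C) : Prop :=
  (Rabs (Carg z) <= psi \/ Cmod z < r0) /\ ~ (Im z = 0 /\ 0 <= Re z).

(** The value of [dg] at the finitely many corners is irrelevant. *)
Definition piecewise_C1 (g dg : R -> C) : Prop :=
  (forall t, continuous g t) /\
  (exists l : list R, forall t, ~ In t l ->
     is_derive (K := R_AbsRing) (V := C_R_NormedModule) g t (dg t) /\
     continuous dg t) /\
  (forall t, (exists a : C, filterlim dg (at_left t) (locally a)) /\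
             (exists b : C, filterlim dg (at_right t) (locally b))).

(** [g] goes to infinity along the filter [F] in the direction of [exp (i theta)]. *)
Definition goes_to_infinity (g : R -> C) (F : (R -> Prop) -> Prop) (theta : R) : Prop :=
  filterlim (fun t => Cmod (g t)) F (Rbar_locally p_infty) /\
  filterlim (fun t => Cdiv (g t) (RtoC (Cmod (g t)))) F
            (locally ((cos theta, sin theta) : C)).

Definition is_contour (psi r0 : R) (g dg : R -> C) : Prop :=
  piecewise_C1 g dg /\
  (forall t, contour_region psi r0 (g t)) /\
  goes_to_infinity g (Rbar_locally m_infty) (- psi) /\
  goes_to_infinity g (Rbar_locally p_infty) psi.

Section FractionalPowers.

Variable V : NormedModule C_AbsRing.

(** The integral is an improper Riemann integral in [BL V], for the operator
    norm; [(lambda + A)^-1] is the resolvent of [-A] at [lambda]. *)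
Definition is_contour_integral (A : operator V) (alpha : R) (g dg : R -> C)
    (T : BL V) : Prop :=
  exists I : BL V,
    is_RInt_gen (V := real_NormedModule (BL_NormedModule V))
      (fun t => scal (Cmult (dg t) (Crpower (Copp (g t)) (- alpha)) : C_AbsRing)
                     (resolvent (op_opp A) (g t)))
      (Rbar_locally m_infty) (Rbar_locally p_infty) I /\
    T = scal (Cinv (Cmult (RtoC (2 * PI)) Ci) : C_AbsRing) I.

(** [T] is the value, for all admissible data [M], [psi], [r0] and contour, of
    the integral defining [A ^ (- alpha)]. *)
Definition is_neg_power (A : operator V) (alpha : R) (T : BL V) : Prop :=
  forall (M psi r0 : R) (g dg : R -> C),
    positivity_constant A M ->
    0 < psi < asin (1 / (2 * M)) ->
    0 < r0 < 1 / (2 * M) ->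
    is_contour psi r0 g dg ->
    is_contour_integral A alpha g dg T.

Definition neg_power (A : operator V) (alpha : R) : BL V :=
  epsilon (inhabits bl_zero) (is_neg_power A alpha).

Definition pos_power (A : operator V) (alpha : R) : operator V :=
  op_inv (neg_power A alpha).

End FractionalPowers.

Arguments is_neg_power {V} _ _ _.
Arguments neg_power {V} _ _.
Arguments pos_power {V} _ _.

Definition cube (V : NormedModule C_AbsRing) : NormedModule C_AbsRing :=
  prod_NormedModule C_AbsRing (prod_NormedModule C_AbsRing V V) V.

(** The domain is the natural one: every entry can be applied. *)
Definition op_matrix {V : NormedModule C_AbsRing}
    (a11 a12 a13 a21 a22 a23 a31 a32 a33 : operator V) : operator (cube V) :=
  mkOp (V := cube V)
    (fun x : V * V * V => let '(x1, x2, x3) := x in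
       (dom a11 x1 /\ dom a12 x2 /\ dom a13 x3) /\
       (dom a21 x1 /\ dom a22 x2 /\ dom a23 x3) /\
       (dom a31 x1 /\ dom a32 x2 /\ dom a33 x3))
    (fun x : V * V * V => let '(x1, x2, x3) := x in
       (plus (plus (a11 x1) (a12 x2)) (a13 x3),
        plus (plus (a21 x1) (a22 x2)) (a23 x3),
        plus (plus (a31 x1) (a32 x2)) (a33 x3))).

Definition Lambda1 {V : NormedModule C_AbsRing} (A : operator V) : operator (cube V) :=
  op_matrix A       op_zero op_zero
            op_zero A       op_zero
            op_id   op_zero A.

(* Main.v *)
(** Write [R(z) = (z + A)^-1].  Off the half-line [[0, oo)] the integrand
    [(-z)^(-beta) R(z)] is holomorphic on a star-shaped region containing all admissible contours,
    hence has a primitive there; as the integrand is [O(|z|^(-beta-1))], the primitive has limits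
    at infinity on either side of the half-line, and the contour integral is their difference,
    for every contour.  For [Lambda_1] the resolvent is block triangular with off-diagonal entry
    [- R(z)^2 = R'(z)], and integrating by parts gives [- alpha A^(-alpha-1)].  The statements on
    positive powers follow from [A^(-alpha-1) = A^(-alpha) A^-1] and
    [A^(-alpha) A^(-(1-alpha)) = A^-1].  For the latter put [Phi_beta(s) = (s + A)^(-beta)], which
    satisfies [Phi_beta' = - beta Phi_beta R(s)].  Therefore
    [Phi_alpha(s) (1 + s A^-1) Phi_(1-alpha)(s)] does not depend on [s]; its limit at infinity is
    found from [A^-1 Phi_beta(s) = s^(-beta) A^-1 + O(1/s)], where the constant in front of
    [s^(-beta)] is the residue of [(-z)^(-beta) / (s + z)] at [- s]. *)

Require Import Defs.
From Stdlib Require Import Reals Lra Lia List.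
From Stdlib Require Import Classical ClassicalEpsilon FunctionalExtensionality PropExtensionality.
From Coquelicot Require Import Coquelicot.
Open Scope R_scope.

(** * Linear identities and bounded operators *)

(** Cauchy's theorem and Fubini's theorem are both avoided. Independence of the contour comes from
    primitives, built by integration along segments from [center M]. At a corner the contour has no
    derivative, so a primitive is followed through corners by continuity.

    The definition of a negative power quantifies over all admissible contours and all positivity
    constants, so it pins down an operator only once some contour is known to exist. This is the
    purpose of the smooth hyperbolic curve, which also serves for all norm estimates. Positivity
    constants of [A] and [Lambda1 A] may differ, but every constant of [Lambda1 A] is one of [A], so
    a contour admissible for the block operator may be used for its entries.

    The product of A^(-alpha) and A^(-(1-alpha)) is never written as a double integral. Since (s +
    A) A^-1 = 1 + s A^-1 is bounded, the differential equations in s are used without any unbounded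
    operator. The behaviour at infinity is controlled only after multiplication by A^-1; injectivity
    of A^-1 removes that factor at the end. *)

Section ModuleIdentities.

Variable V : NormedModule C_AbsRing.

(** Syntax for a reflection procedure: both sides of a vector identity become linear combinations
    over one list of atoms, and only their complex coefficients remain to be compared. *)
Inductive mexp :=
| MVar (n : nat) | MZero | MPlus (a b : mexp) | MOpp (a : mexp) | MScal (c : C) (a : mexp).

Fixpoint mden (env : list V) (e : mexp) : V :=
  match e with
  | MVar n => nth n env zero
  | MZero => zero
  | MPlus a b => plus (mden env a) (mden env b)
  | MOpp a => opp (mden env a)
  | MScal c a => scal (c : C_AbsRing) (mden env a)
  end.

Fixpoint mcoef (n : nat) (e : mexp) : C :=
  match e with
  | MVar m => if Nat.eqb n m then RtoC 1 else RtoC 0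
  | MZero => RtoC 0
  | MPlus a b => Cplus (mcoef n a) (mcoef n b)
  | MOpp a => Copp (mcoef n a)
  | MScal c a => Cmult c (mcoef n a)
  end.

Fixpoint lincomb (env : list V) (f : nat -> C) : V :=
  match env with
  | nil => zero
  | v :: l => plus (scal (f O : C_AbsRing) v) (lincomb l (fun n => f (S n)))
  end.

Lemma lincomb_zero env : lincomb env (fun _ => RtoC 0) = zero.
Proof.
induction env as [|v l IH]; simpl; [reflexivity|].
rewrite IH, plus_zero_r. exact (scal_zero_l (K := C_Ring) v).
Qed.

Lemma lincomb_plus env f g :
  lincomb env (fun n => Cplus (f n) (g n)) = plus (lincomb env f) (lincomb env g).
Proof.
revert f g; induction env as [|v l IH]; intros f g; simpl; [symmetry; apply plus_zero_r|].
rewrite (IH (fun n => f (S n)) (fun n => g (S n))).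
rewrite (scal_distr_r (K := C_Ring) (f O) (g O) v : scal (Cplus (f O) (g O) : C_AbsRing) v = _).
rewrite <- !plus_assoc; f_equal; rewrite !plus_assoc; f_equal; apply plus_comm.
Qed.

Lemma lincomb_scal env c f :
  lincomb env (fun n => Cmult c (f n)) = scal (c : C_AbsRing) (lincomb env f).
Proof.
revert f; induction env as [|v l IH]; intros f; simpl.
- symmetry; exact (scal_zero_r (K := C_Ring) c).
- rewrite (IH (fun n => f (S n))).
  rewrite (scal_distr_l (K := C_Ring) c : forall x y : V, scal (c : C_AbsRing) (plus x y) = _).
  f_equal. symmetry; exact (scal_assoc (K := C_Ring) c (f O) v).
Qed.

Lemma lincomb_ext env f g : (forall n, f n = g n) -> lincomb env f = lincomb env g.
Proof.
revert f g; induction env as [|v l IH]; intros f g H; simpl; [reflexivity|].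
rewrite H; f_equal; apply IH; intros n; apply H.
Qed.

Lemma lincomb_var env m :
  nth m env zero = lincomb env (fun n => if Nat.eqb n m then RtoC 1 else RtoC 0).
Proof.
revert m; induction env as [|v l IH]; intros m; simpl; [destruct m; reflexivity|].
destruct m as [|m]; simpl.
- rewrite lincomb_zero, plus_zero_r. symmetry; exact (scal_one (K := C_Ring) v).
- rewrite (scal_zero_l (K := C_Ring) v : scal (RtoC 0 : C_AbsRing) v = zero), plus_zero_l.
  apply IH.
Qed.

Lemma mden_lincomb env e : mden env e = lincomb env (fun n => mcoef n e).
Proof.
induction e as [m| |a IHa b IHb|a IHa|c a IHa]; simpl.
- apply lincomb_var.
- symmetry; apply lincomb_zero.
- rewrite lincomb_plus, IHa, IHb; reflexivity.
- rewrite IHa.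
  etransitivity; [symmetry; exact (scal_opp_one (K := C_Ring) (lincomb env (fun n => mcoef n a)))|].
  etransitivity; [symmetry; exact (lincomb_scal env (Copp (RtoC 1)) _)|].
  apply lincomb_ext; intros n; ring.
- rewrite lincomb_scal, IHa; reflexivity.
Qed.

(** Recursive, so that over a concrete list of atoms it computes to a finite conjunction of
    coefficient equations. *)
Fixpoint all_below (n : nat) (P : nat -> Prop) : Prop :=
  match n with O => True | S m => P m /\ all_below m P end.

Lemma lincomb_eq env f g :
  all_below (length env) (fun n => f n = g n) -> lincomb env f = lincomb env g.
Proof.
assert (H : forall n P, all_below n P -> forall m, (m < n)%nat -> P m).
{ induction n as [|n IH]; simpl; intros P HP m Hm; [lia|].
  destruct HP as [H1 H2]; destruct (Nat.eq_dec m n) as [->|Hn]; [exact H1|].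
  apply IH; [exact H2|lia]. }
intros Hf; assert (Hf' := H _ _ Hf); clear Hf H; revert f g Hf'.
induction env as [|v l IH]; simpl; intros f g Hf; [reflexivity|].
rewrite Hf by lia; f_equal; apply IH; intros m Hm; apply Hf; lia.
Qed.

Lemma mden_eq env a b :
  all_below (length env) (fun n => mcoef n a = mcoef n b) -> mden env a = mden env b.
Proof. intros H; rewrite !mden_lincomb; apply lincomb_eq, H. Qed.

End ModuleIdentities.

Ltac lookup x l :=
  lazymatch l with
  | x :: _ => constr:(O)
  | _ :: ?l' => let n := lookup x l' in constr:(S n)
  end.

Ltac add_atom x l :=
  lazymatch l with
  | context [x :: _] => l
  | _ => constr:(x :: l)
  end.

Ltac atoms e l :=
  lazymatch e with
  | plus ?a ?b => let l1 := atoms a l in atoms b l1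
  | minus ?a ?b => let l1 := atoms a l in atoms b l1
  | opp ?a => atoms a l
  | scal ?c ?a => atoms a l
  | zero => l
  | _ => add_atom e l
  end.

(** The dummy match provides two attempts: a scalar that does not typecheck as a complex number is
    taken to be real and embedded. *)
Ltac as_complex c :=
  match constr:(Set) with
  | _ => constr:(c : C)
  | _ => constr:(RtoC c)
  end.

Ltac reify_module l e :=
  lazymatch e with
  | plus ?a ?b => let a' := reify_module l a in let b' := reify_module l b in
                  constr:(MPlus a' b')
  | minus ?a ?b => let a' := reify_module l a in let b' := reify_module l b in
                  constr:(MPlus a' (MOpp b'))
  | opp ?a => let a' := reify_module l a in constr:(MOpp a')
  | scal ?c ?a => let a' := reify_module l a in let c' := as_complex c in constr:(MScal c' a')
  | zero => constr:(MZero)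
  | _ => let n := lookup e l in constr:(MVar n)
  end.

(** Reduces an identity between linear combinations in the complex vector space [V]
    to identities between the coefficients. *)
Ltac module_coefs V :=
  lazymatch goal with
  | |- @eq _ ?a ?b =>
    let l0 := constr:(@nil V) in
    let l1 := atoms a l0 in let l := atoms b l1 in
    let ra := reify_module l a in let rb := reify_module l b in
    change (mden V l ra = mden V l rb);
    apply mden_eq; cbn [all_below length mcoef Nat.eqb];
    repeat match goal with |- _ /\ _ => split end; try exact I
  end.

Ltac module_ring V := module_coefs V; rewrite ?RtoC_plus, ?RtoC_opp, ?RtoC_mult; try ring.

(** * Norm identities, and convergence expressed by norms *)

Section Norms.

Context {V : NormedModule C_AbsRing}.

(** The axiom of normed modules is the inequality; applied to the inverse scalar it yields the
    converse. *)
Lemma norm_scal_eq (a : C) (x : V) : norm (scal (a : C_AbsRing) x) = Cmod a * norm x.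
Proof.
apply Rle_antisym; [exact (norm_scal (K := C_AbsRing) a x)|].
destruct (Ceq_dec a (RtoC 0)) as [->|Ha].
- rewrite Cmod_0, Rmult_0_l; apply norm_ge_0.
- assert (Hm : 0 < Cmod a) by (apply Cmod_gt_0; exact Ha).
  apply Rmult_le_reg_l with (/ Cmod a); [apply Rinv_0_lt_compat, Hm|].
  rewrite <- Rmult_assoc, Rinv_l, Rmult_1_l by lra.
  rewrite <- Cmod_inv by exact Ha.
  apply Rle_trans with (2 := norm_scal (K := C_AbsRing) (Cinv a) _).
  right; f_equal. 
  transitivity (scal (RtoC 1 : C_AbsRing) x).
  + module_ring V.
  + rewrite <- (Cinv_l a Ha). module_ring V.
Qed.

Lemma norm_minus_sym (x y : V) : norm (minus x y) = norm (minus y x).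
Proof.
replace (minus x y) with (scal (Copp (RtoC 1) : C_AbsRing) (minus y x)) by module_ring V.
rewrite norm_scal_eq, Cmod_opp, Cmod_1; ring.
Qed.

Lemma norm_opp_eq (x : V) : norm (opp x) = norm x.
Proof.
replace (opp x) with (scal (Copp (RtoC 1) : C_AbsRing) x) by module_ring V.
rewrite norm_scal_eq, Cmod_opp, Cmod_1; ring.
Qed.

Lemma norm_minus_le (x y : V) : norm (minus x y) <= norm x + norm y.
Proof. rewrite <- (norm_opp_eq y); apply norm_triangle. Qed.

Lemma norm_le_eq (y x : V) r : x = y -> norm y <= r -> norm x <= r.
Proof. intros ->; auto. Qed.

Lemma norm_plus_compat (x y : V) a b : norm x <= a -> norm y <= b -> norm (plus x y) <= a + b.
Proof. intros; apply Rle_trans with (1 := norm_triangle _ _); lra. Qed.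

Lemma norm_minus_compat (x y : V) a b : norm x <= a -> norm y <= b -> norm (minus x y) <= a + b.
Proof. intros; apply Rle_trans with (1 := norm_minus_le _ _); lra. Qed.

Lemma norm_scal_compat (c : C) (x : V) a b :
  Cmod c <= a -> norm x <= b -> norm (scal (c : C_AbsRing) x) <= a * b.
Proof.
intros; rewrite norm_scal_eq; apply Rmult_le_compat; auto using Cmod_ge_0, norm_ge_0.
Qed.

Lemma norm_le_minus (x y : V) : norm x <= norm (minus x y) + norm y.
Proof.
apply Rle_trans with (2 := norm_triangle _ _).
right; f_equal; module_ring V.
Qed.

Lemma minus_eq_zero_eq (x y : V) : minus x y = zero -> x = y.
Proof.
intros H; replace x with (plus (minus x y) y) by module_ring V.
rewrite H; module_ring V.
Qed.

Lemma norm_minus_arbitrarily_small (x y : V) :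
  (forall eps, 0 < eps -> norm (minus x y) <= eps) -> x = y.
Proof.
intros H; apply minus_eq_zero_eq, norm_eq_zero.
assert (H0 := norm_ge_0 (minus x y)).
destruct (Rle_lt_or_eq_dec _ _ H0) as [H1|H1]; [|auto].
assert (H2 := H (norm (minus x y) / 2)); lra.
Qed.

(** Balls of the uniform structure agree with norm balls only up to [norm_factor], which accounts
    for the division. *)
Lemma locally_of_norm (x : V) (P : V -> Prop) :
  (exists eps, 0 < eps /\ forall y, norm (minus y x) < eps -> P y) <-> locally x P.
Proof.
split.
- intros [e [He H]].
  assert (Hf := norm_factor_gt_0 (V := V)).
  assert (Hd : 0 < e / @norm_factor _ V) by (apply Rdiv_lt_0_compat; lra).
  exists (mkposreal _ Hd); intros y Hy; apply H.
  assert (H1 := norm_compat2 _ _ _ Hy); simpl in H1.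
  replace e with (@norm_factor _ V * (e / @norm_factor _ V)) by (field; lra); exact H1.
- intros [e He]; exists e; split; [apply cond_pos|].
  intros y Hy; apply He, norm_compat1, Hy.
Qed.

Lemma filterlim_norm_lt {T : Type} (F : (T -> Prop) -> Prop) {FF : Filter F} (f : T -> V) (l : V) :
  filterlim f F (locally l) <->
  (forall eps, 0 < eps -> F (fun t => norm (minus (f t) l) < eps)).
Proof.
split.
- intros H eps He; apply (H (fun y => norm (minus y l) < eps)), locally_of_norm.
  exists eps; auto.
- intros H P HP; apply locally_of_norm in HP; destruct HP as [e [He HP]].
  apply filter_imp with (2 := H e He); intros t; apply HP.
Qed.

End Norms.

(** Completeness concerns only the uniform structure, which restriction of scalars leaves unchanged.
    It is passed as a separate argument because the operator spaces are built over bare normed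
    modules. *)
Definition real_CompleteNormedModule (W : NormedModule C_AbsRing)
    (cW : CompleteSpace.mixin_of W) : CompleteNormedModule R_AbsRing :=
  CompleteNormedModule.Pack R_AbsRing W
    (CompleteNormedModule.Class R_AbsRing W
       (NormedModule.class R_AbsRing (real_NormedModule W)) cW) W.

(** * Bounded linear maps commute with limits and integrals *)

Section ContinuousLinearMaps.

Context {V W : NormedModule C_AbsRing}.
Variable L : V -> W.
Hypothesis HL : is_linear L.

Lemma is_linear_minus_map x y : L (minus x y) = minus (L x) (L y).
Proof.
unfold minus; rewrite (linear_plus _ HL); f_equal.
replace (opp y) with (scal (Copp (RtoC 1) : C_AbsRing) y) by module_ring V.
rewrite (linear_scal _ HL); module_ring W.
Qed.

Lemma is_linear_zero_map : L zero = zero.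
Proof.
replace (zero : V) with (minus zero zero : V) by module_ring V.
rewrite is_linear_minus_map; module_ring W.
Qed.

Lemma linear_filterlim {T : Type} (F : (T -> Prop) -> Prop) {FF : Filter F} (f : T -> V) (l : V) :
  filterlim f F (locally l) -> filterlim (fun t => L (f t)) F (locally (L l)).
Proof.
intros H; apply filterlim_norm_lt; [exact FF|]; intros eps He.
destruct (linear_norm _ HL) as [M [HM HLM]].
assert (Hd : 0 < eps / M) by (apply Rdiv_lt_0_compat; lra).
assert (H1 := H); rewrite filterlim_norm_lt in H1 by exact FF.
apply filter_imp with (2 := H1 _ Hd).
intros t Ht; rewrite <- is_linear_minus_map.
apply Rle_lt_trans with (1 := HLM _).
replace eps with (M * (eps / M)) by (field; lra).
apply Rmult_lt_compat_l; assumption.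
Qed.

Lemma linear_Riemann_sum (f : R -> V) ptd :
  L (Riemann_sum (V := real_NormedModule V) f ptd) =
  Riemann_sum (V := real_NormedModule W) (fun t => L (f t)) ptd.
Proof.
pattern ptd; apply SF_cons_ind.
- intros x0; unfold Riemann_sum; simpl; apply is_linear_zero_map.
- intros h s IH; rewrite !Riemann_sum_cons.
  etransitivity; [apply (linear_plus _ HL)|].
  rewrite IH; f_equal. apply (linear_scal _ HL).
Qed.

Lemma is_RInt_linear (f : R -> V) a b l :
  is_RInt (V := real_NormedModule V) f a b l ->
  is_RInt (V := real_NormedModule W) (fun t => L (f t)) a b (L l).
Proof.
unfold is_RInt; intros H.
apply filterlim_ext with
  (fun ptd => L (scal (sign (b - a)) (Riemann_sum (V := real_NormedModule V) f ptd))).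
- intros ptd; rewrite <- linear_Riemann_sum; apply (linear_scal _ HL).
- apply (linear_filterlim (Riemann_fine a b)), H.
Qed.

Lemma is_RInt_gen_linear (f : R -> V) Fa Fb {FFa : Filter Fa} {FFb : Filter Fb} l :
  is_RInt_gen (V := real_NormedModule V) f Fa Fb l ->
  is_RInt_gen (V := real_NormedModule W) (fun t => L (f t)) Fa Fb (L l).
Proof.
intros H P HP.
assert (HQ : locally l (fun x => P (L x))).
{ apply (linear_filterlim (locally l) (fun x => x) l); [apply filterlim_id|exact HP]. }
unfold is_RInt_gen, filterlimi, filter_le, filtermapi in *.
refine (filter_imp _ _ _ (H _ HQ)).
intros [a b] [y [Hy HPy]]; exists (L y); split; [apply is_RInt_linear, Hy|exact HPy].
Qed.

End ContinuousLinearMaps.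

(** * Completeness of the space of bounded operators *)

Section Completeness.

Lemma bl_linear_scal {V : NormedModule C_AbsRing} (T : BL V) (c : C) x :
  T (scal (c : C_AbsRing) x) = scal (c : C_AbsRing) (T x).
Proof. exact (linear_scal _ (bl_linear _ T) c x). Qed.

Lemma bl_linear_plus {V : NormedModule C_AbsRing} (T : BL V) x y :
  T (plus x y) = plus (T x) (T y).
Proof. exact (linear_plus _ (bl_linear _ T) x y). Qed.

Lemma bl_linear_opp {V : NormedModule C_AbsRing} (T : BL V) x :
  T (opp x) = opp (T x).
Proof.
replace (opp x) with (scal (Copp (RtoC 1) : C_AbsRing) x) by module_ring V.
rewrite bl_linear_scal; module_ring V.
Qed.

Lemma op_norm_ge_0 {V : NormedModule C_AbsRing} (T : BL V) : 0 <= op_norm T.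
Proof. apply op_norm_spec. Qed.

Lemma op_norm_apply {V : NormedModule C_AbsRing} (T : BL V) x : norm (T x) <= op_norm T * norm x.
Proof. apply op_norm_spec. Qed.

Lemma op_norm_le {V : NormedModule C_AbsRing} (T : BL V) M :
  0 <= M -> (forall x, norm (T x) <= M * norm x) -> op_norm T <= M.
Proof. apply op_norm_spec. Qed.

Lemma bl_plus_app {V : NormedModule C_AbsRing} (S T : BL V) x : plus S T x = plus (S x) (T x).
Proof. reflexivity. Qed.

Lemma bl_scal_app {V : NormedModule C_AbsRing} c (T : BL V) x :
  scal (c : C_AbsRing) T x = scal (c : C_AbsRing) (T x).
Proof. reflexivity. Qed.

Lemma bl_opp_app {V : NormedModule C_AbsRing} (T : BL V) x : opp T x = opp (T x).
Proof. apply bl_opp_fun. Qed.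

Lemma bl_minus_app {V : NormedModule C_AbsRing} (S T : BL V) x : minus S T x = minus (S x) (T x).
Proof. transitivity (plus (S x) (opp T x)); [reflexivity|rewrite bl_opp_app; reflexivity]. Qed.

Lemma bl_zero_app {V : NormedModule C_AbsRing} (x : V) : (zero : BL V) x = zero.
Proof. reflexivity. Qed.

Variable V : NormedModule C_AbsRing.
Variable cV : CompleteSpace.mixin_of V.

Definition bl_lim (F : (BL V -> Prop) -> Prop) : BL V :=
  epsilon (inhabits bl_zero) (fun T => forall eps : posreal, F (ball T eps)).

(** Evaluation at [x] turns a Cauchy filter of operators into a Cauchy filter of [V]. The pointwise
    limits form a linear map, which is bounded because it lies at finite distance from a single
    operator; convergence is in norm because the distance estimate is uniform in [x]. *)
Lemma bl_complete (F : (BL V -> Prop) -> Prop) :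
  ProperFilter F -> cauchy F -> exists T : BL V, forall eps : posreal, F (ball T eps).
Proof.
intros HF HC.
assert (HFf : Filter F) by apply HF.
assert (HCn : forall eps, 0 < eps -> exists T : BL V, F (fun S => op_norm (minus S T) < eps)).
{ intros eps He; destruct (HC (mkposreal _ He)) as [T HT]; exists T; exact HT. }
set (G := fun (x : V) (P : V -> Prop) => F (fun T => P (T x))).
assert (GP : forall x, ProperFilter (G x)).
{ intros x; split.
  - intros P HP; destruct (filter_ex _ HP) as [T HT]; eauto.
  - split; unfold G.
    + apply filter_true.
    + intros P Q; apply filter_and.
    + intros P Q HPQ; apply filter_imp; auto. }
assert (GC : forall x, cauchy (G x)).
{ intros x eps.
  assert (Hx := norm_ge_0 x).
  assert (He : 0 < eps / (norm x + 1)) by (apply Rdiv_lt_0_compat; [apply cond_pos|lra]).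
  destruct (HCn _ He) as [T HT]; exists (T x); unfold G.
  apply filter_imp with (2 := HT); intros S HS; apply (norm_compat1 (V := V)).
  rewrite <- bl_minus_app; apply Rle_lt_trans with (1 := op_norm_apply _ _).
  apply Rle_lt_trans with (eps / (norm x + 1) * norm x); [apply Rmult_le_compat_r; lra|].
  assert (Hp := cond_pos eps).
  apply Rmult_lt_reg_r with (norm x + 1); [lra|].
  replace (eps / (norm x + 1) * norm x * (norm x + 1)) with (eps * norm x) by (field; lra).
  apply Rmult_lt_compat_l; lra. }
set (l := fun x => CompleteSpace.lim _ cV (G x)).
assert (Hl : forall x eps, 0 < eps -> F (fun T => norm (minus (T x) (l x)) < eps)).
{ intros x eps He.
  assert (H := CompleteSpace.ax1 _ cV (G x) (GP x) (GC x)).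
  assert (Hf := norm_factor_gt_0 (V := V)).
  assert (Hd : 0 < eps / @norm_factor _ V) by (apply Rdiv_lt_0_compat; lra).
  refine (filter_imp _ _ _ (H (mkposreal _ Hd) : F (fun T => ball (l x) _ (T x)))).
  intros T HT.
  assert (H1 := norm_compat2 (V := V) _ _ _ HT); simpl in H1.
  replace eps with (@norm_factor _ V * (eps / @norm_factor _ V)) by (field; lra); exact H1. }
(* The norm estimate survives the pointwise limit: some [S] is at once norm-close to [T] and close
   to [l] at the point [x]. *)
assert (Hb : forall T eps, F (fun S => op_norm (minus S T) < eps) ->
               forall x, norm (minus (l x) (T x)) <= eps * norm x).
{ intros T eps HT x; apply le_epsilon; intros eta Heta.
  destruct (filter_ex _ (filter_and _ _ HT (Hl x eta Heta))) as [S [H1 H2]].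
  replace (minus (l x) (T x)) with (minus (minus S T x) (minus (S x) (l x)))
    by (rewrite bl_minus_app; module_ring V).
  apply Rle_trans with (1 := norm_minus_le _ _).
  apply Rplus_le_compat; [|lra].
  apply Rle_trans with (1 := op_norm_apply _ _).
  apply Rmult_le_compat_r; [apply norm_ge_0|lra]. }
assert (Hlin : is_linear (U := V) (V := V) l).
{ split.
  - intros x y; apply norm_minus_arbitrarily_small; intros eps He.
    assert (H3 : 0 < eps / 3) by lra.
    destruct (filter_ex _ (filter_and _ _ (Hl (plus x y) _ H3)
      (filter_and _ _ (Hl x _ H3) (Hl y _ H3)))) as [S [H1 [H2 H4]]].
    replace (minus (l (plus x y)) (plus (l x) (l y))) with
      (minus (plus (minus (S x) (l x)) (minus (S y) (l y)))
         (minus (S (plus x y)) (l (plus x y))))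
      by (rewrite bl_linear_plus; module_ring V).
    apply Rle_trans with (eps / 3 + eps / 3 + eps / 3); [|lra].
    apply norm_minus_compat; [apply norm_plus_compat|]; apply Rlt_le; assumption.
  - intros k x; apply norm_minus_arbitrarily_small; intros eps He.
    assert (Hk := Cmod_ge_0 k).
    assert (H3 : 0 < eps / 2) by lra.
    assert (H3' : 0 < eps / 2 / (Cmod k + 1)) by (apply Rdiv_lt_0_compat; lra).
    destruct (filter_ex _ (filter_and _ _ (Hl (scal k x) _ H3) (Hl x _ H3'))) as [S [H1 H2]].
    replace (minus (l (scal k x)) (scal k (l x))) with
      (minus (scal k (minus (S x) (l x))) (minus (S (scal k x)) (l (scal k x))))
      by (rewrite (bl_linear_scal S k x); module_ring V).
    apply Rle_trans with (eps / 2 + eps / 2); [|lra].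
    apply norm_minus_compat; [|apply Rlt_le; assumption].
    rewrite (norm_scal_eq k).
    assert (H5 : Cmod k * norm (minus (S x) (l x)) <= Cmod k * (eps / 2 / (Cmod k + 1)))
      by (apply Rmult_le_compat_l; lra).
    assert (H6 : Cmod k * (eps / 2 / (Cmod k + 1)) <= eps / 2).
    { apply Rmult_le_reg_r with (Cmod k + 1); [lra|].
      replace (Cmod k * (eps / 2 / (Cmod k + 1)) * (Cmod k + 1)) with (Cmod k * (eps / 2))
        by (field; lra).
      nra. }
    apply Rle_trans with (1 := H5); exact H6.
  - destruct (HCn 1 Rlt_0_1) as [T HT].
    exists (1 + op_norm T); assert (HT0 := op_norm_ge_0 T); split; [lra|].
    intros x; apply Rle_trans with (1 := norm_le_minus (l x) (T x)).
    rewrite Rmult_plus_distr_r; apply Rplus_le_compat; [apply Hb, HT|apply op_norm_apply]. }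
exists (mkBL V l Hlin); intros eps.
assert (He2 : 0 < eps / 2) by (assert (H := cond_pos eps); lra).
destruct (HCn _ (is_pos_div_2 (mkposreal _ He2))) as [T HT]; simpl in HT.
apply filter_imp with (2 := HT); intros S HS.
change (op_norm (minus S (mkBL V l Hlin)) < eps).
apply Rle_lt_trans with (eps / 2); [|assert (H := cond_pos eps); lra].
apply op_norm_le; [lra|]; intros x.
replace (minus S (mkBL V l Hlin) x) with (minus (minus S T x) (minus (l x) (T x)))
  by (rewrite !bl_minus_app; simpl bl_fun; module_ring V).
apply Rle_trans with (1 := norm_minus_le _ _).
assert (H1 := Hb _ _ HT x); assert (H2 := op_norm_apply (minus S T) x).
assert (H3 := norm_ge_0 x).
assert (H4 : op_norm (minus S T) * norm x <= eps / 2 / 2 * norm x)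
  by (apply Rmult_le_compat_r; lra).
lra.
Qed.

Lemma bl_lim_correct (F : (BL V -> Prop) -> Prop) :
  ProperFilter F -> cauchy F -> forall eps : posreal, F (ball (bl_lim F) eps).
Proof. intros HF HC; exact (epsilon_spec _ _ (bl_complete F HF HC)). Qed.

Lemma bl_lim_close (F1 F2 : (BL V -> Prop) -> Prop) :
  filter_le F1 F2 -> filter_le F2 F1 -> close (bl_lim F1) (bl_lim F2).
Proof.
intros H12 H21; replace F2 with F1; [apply close_refl|].
apply functional_extensionality; intros P; apply propositional_extensionality.
split; [apply H21|apply H12].
Qed.

Definition bl_complete_mixin : CompleteSpace.mixin_of (BL_NormedModule V) :=
  CompleteSpace.Mixin (BL_UniformSpace V) bl_lim bl_lim_correct bl_lim_close.

End Completeness.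

(** * Composition of bounded operators *)

Section Composition.

Context {V : NormedModule C_AbsRing}.

Lemma bl_comp_linear (S T : BL V) : is_linear (fun x => S (T x)).
Proof.
split.
- intros x y; rewrite !bl_linear_plus; reflexivity.
- intros k x; rewrite (bl_linear_scal T k), (bl_linear_scal S k); reflexivity.
- exists (op_norm S * op_norm T + 1).
  assert (HS := op_norm_ge_0 S); assert (HT := op_norm_ge_0 T).
  split; [nra|]; intros x.
  assert (H1 := op_norm_apply S (T x)); assert (H2 := op_norm_apply T x).
  assert (H3 := norm_ge_0 x).
  assert (H4 := Rmult_le_compat_l _ _ _ HS H2); lra.
Qed.

Definition bl_comp (S T : BL V) : BL V := mkBL V _ (bl_comp_linear S T).

Lemma bl_comp_app S T x : bl_comp S T x = S (T x).
Proof. reflexivity. Qed.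

Lemma bl_id_linear : is_linear (fun x : V => x).
Proof.
split; [reflexivity|reflexivity|].
exists 1; split; [lra|]; intros x; lra.
Qed.

Definition bl_id : BL V := mkBL V _ bl_id_linear.

Lemma op_norm_comp S T : op_norm (bl_comp S T) <= op_norm S * op_norm T.
Proof.
assert (HS := op_norm_ge_0 S); assert (HT := op_norm_ge_0 T).
apply op_norm_le; [nra|]; intros x; rewrite bl_comp_app.
apply Rle_trans with (1 := op_norm_apply _ _).
rewrite Rmult_assoc; apply Rmult_le_compat_l; [exact HS|apply op_norm_apply].
Qed.

(** As a bounded map on the operator space, composition with a fixed operator can be carried through
    operator-valued integrals. *)
Lemma bl_comp_linear_l S : is_linear (U := BL_NormedModule V) (V := BL_NormedModule V) (bl_comp S).
Proof.
split.
- intros T U; apply bl_ext; intros x; exact (bl_linear_plus S (T x) (U x)).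
- intros k T; apply bl_ext; intros x; exact (bl_linear_scal S k (T x)).
- exists (op_norm S + 1); assert (HS := op_norm_ge_0 S); split; [lra|].
  intros T; assert (H := op_norm_comp S T); assert (HT := op_norm_ge_0 T).
  change (op_norm (bl_comp S T) <= (op_norm S + 1) * op_norm T); lra.
Qed.

Lemma bl_comp_linear_r S :
  is_linear (U := BL_NormedModule V) (V := BL_NormedModule V) (fun T => bl_comp T S).
Proof.
split.
- intros T U; apply bl_ext; intros x; reflexivity.
- intros k T; apply bl_ext; intros x; reflexivity.
- exists (op_norm S + 1); assert (HS := op_norm_ge_0 S); split; [lra|].
  intros T; assert (H := op_norm_comp T S); assert (HT := op_norm_ge_0 T).
  change (op_norm (bl_comp T S) <= (op_norm S + 1) * op_norm T); lra.
Qed.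

End Composition.

(** Syntactically different but convertible algebraic structures occur in these terms, so
    [rewrite] alone does not find the redexes. *)
Ltac bl_push :=
  repeat match goal with
  | |- context [bl_fun (@plus ?G ?S ?T) ?x] =>
      rewrite (bl_plus_app S T x : bl_fun (@plus G S T) x = _)
  | |- context [bl_fun (@minus ?G ?S ?T) ?x] =>
      rewrite (bl_minus_app S T x : bl_fun (@minus G S T) x = _)
  | |- context [bl_fun (@opp ?G ?T) ?x] =>
      rewrite (bl_opp_app T x : bl_fun (@opp G T) x = _)
  | |- context [bl_fun (@scal ?K ?G ?c ?T) ?x] =>
      first [rewrite (bl_scal_app c T x : bl_fun (@scal K G c T) x = _)
            |rewrite (bl_scal_app (RtoC c) T x : bl_fun (@scal K G c T) x = _)]
  | |- context [bl_fun (@zero ?G) ?x] =>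
      rewrite (bl_zero_app x : bl_fun (@zero G) x = _)
  | |- context [bl_fun (bl_comp ?S ?T) ?x] => rewrite (bl_comp_app S T x)
  | |- context [bl_fun bl_id ?x] => change (bl_fun bl_id x) with x
  | |- context [bl_fun ?S (@plus ?G ?x ?y)] =>
      rewrite (bl_linear_plus S x y : bl_fun S (@plus G x y) = _)
  | |- context [bl_fun ?S (@minus ?G ?x ?y)] =>
      rewrite (is_linear_minus_map S (bl_linear _ S) x y : bl_fun S (@minus G x y) = _)
  | |- context [bl_fun ?S (@opp ?G ?x)] =>
      rewrite (bl_linear_opp S x : bl_fun S (@opp G x) = _)
  | |- context [bl_fun ?S (@scal ?K ?G ?c ?x)] =>
      first [rewrite (bl_linear_scal S c x : bl_fun S (@scal K G c x) = _)
            |rewrite (bl_linear_scal S (RtoC c) x : bl_fun S (@scal K G c x) = _)]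
  | |- context [bl_fun ?S (@zero ?G)] =>
      rewrite (is_linear_zero_map S (bl_linear _ S) : bl_fun S (@zero G) = _)
  end.

(** * Complex derivatives and primitives on star-shaped sets *)

Lemma small_factor eps K : 0 < eps -> 0 <= K -> exists e, 0 < e /\ e * K <= eps.
Proof.
intros He HK; exists (eps / (K + 1)); split; [apply Rdiv_lt_0_compat; lra|].
apply Rmult_le_reg_r with (K + 1); [lra|].
replace (eps / (K + 1) * K * (K + 1)) with (eps * K) by (field; lra); nra.
Qed.

Section ComplexDerivative.

Context {W : NormedModule C_AbsRing}.

Definition Ccont (f : C -> W) (z : C) : Prop :=
  forall eps, 0 < eps -> exists delta, 0 < delta /\
    forall z', Cmod (Cminus z' z) < delta -> norm (minus (f z') (f z)) < eps.

(** Written directly with [Cmod]: the complex numbers carry one uniform structure as a normed ring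
    and another as a product, and this form refers to neither. *)
Definition Cder (f : C -> W) (z : C) (l : W) : Prop :=
  forall eps, 0 < eps -> exists delta, 0 < delta /\
    forall h : C, Cmod h < delta ->
      norm (minus (minus (f (Cplus z h)) (f z)) (scal (h : C_AbsRing) l)) <= eps * Cmod h.

Lemma Cder_lipschitz f z l : Cder f z l ->
  exists delta K, 0 < delta /\ 0 <= K /\
    forall h : C, Cmod h < delta -> norm (minus (f (Cplus z h)) (f z)) <= K * Cmod h.
Proof.
intros H; destruct (H 1 Rlt_0_1) as [d [Hd Hf]].
assert (Hl := norm_ge_0 l).
exists d, (1 + norm l); repeat split; [exact Hd|lra|].
intros h Hh.
apply (norm_le_eq (plus (minus (minus (f (Cplus z h)) (f z)) (scal (h : C_AbsRing) l)) (scal (h : C_AbsRing) l))); [module_ring W|].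
rewrite Rmult_plus_distr_r, (Rmult_comm (norm l)).
apply norm_plus_compat; [apply Hf, Hh|rewrite norm_scal_eq; apply Rle_refl].
Qed.

Lemma Cder_Ccont f z l : Cder f z l -> Ccont f z.
Proof.
intros H eps He; destruct (Cder_lipschitz _ _ _ H) as [d [K [Hd [HK Hf]]]].
assert (Hd' : 0 < Rmin d (eps / (K + 1))).
{ apply Rmin_pos; [exact Hd|apply Rdiv_lt_0_compat; lra]. }
exists (Rmin d (eps / (K + 1))); split; [exact Hd'|].
intros z' Hz'.
replace z' with (Cplus z (Cminus z' z)) by ring.
apply Rle_lt_trans with (K * Cmod (Cminus z' z)).
- apply Hf; apply Rlt_le_trans with (1 := Hz'), Rmin_l.
- assert (Hc := Cmod_ge_0 (Cminus z' z)).
  apply Rle_lt_trans with ((K + 1) * Cmod (Cminus z' z)); [nra|].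
  replace eps with ((K + 1) * (eps / (K + 1))) at 1 by (field; lra).
  apply Rmult_lt_compat_l; [lra|].
  apply Rlt_le_trans with (1 := Hz'), Rmin_r.
Qed.

Lemma Cder_ext f g z l : (forall z, f z = g z) -> Cder f z l -> Cder g z l.
Proof.
intros E H eps He; destruct (H eps He) as [d [Hd Hf]]; exists d; split; [exact Hd|].
intros h Hh; rewrite <- !E; apply Hf, Hh.
Qed.

Lemma Cder_eq f z l l' : l = l' -> Cder f z l -> Cder f z l'.
Proof. intros ->; auto. Qed.

Lemma Cder_const (c : W) z : Cder (fun _ => c) z zero.
Proof.
intros eps He; exists 1; split; [lra|]; intros h _.
apply (norm_le_eq zero); [module_ring W|].
apply Rle_trans with 0; [right; exact (norm_zero (V := W))|].
apply Rmult_le_pos; [lra|apply Cmod_ge_0].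
Qed.

Lemma Cder_plus f g z lf lg :
  Cder f z lf -> Cder g z lg -> Cder (fun z => plus (f z) (g z)) z (plus lf lg).
Proof.
intros Hf Hg eps He.
assert (He2 : 0 < eps / 2) by lra.
destruct (Hf _ He2) as [d1 [Hd1 H1]], (Hg _ He2) as [d2 [Hd2 H2]].
exists (Rmin d1 d2); split; [apply Rmin_pos; assumption|]; intros h Hh.
apply (norm_le_eq (plus (minus (minus (f (Cplus z h)) (f z)) (scal (h : C_AbsRing) lf))
             (minus (minus (g (Cplus z h)) (g z)) (scal (h : C_AbsRing) lg)))); [module_ring W|].
replace (eps * Cmod h) with (eps / 2 * Cmod h + eps / 2 * Cmod h) by field.
apply norm_plus_compat; [apply H1|apply H2]; apply Rlt_le_trans with (1 := Hh);
  [apply Rmin_l|apply Rmin_r].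
Qed.

End ComplexDerivative.

Lemma Cder_affine (f : C -> C) (z k : C) :
  (forall h, f (Cplus z h) = Cplus (f z) (Cmult h k)) -> Cder (W := C_NormedModule) f z k.
Proof.
intros H eps He; exists 1; split; [lra|]; intros h _.
apply Rle_trans with (Cmod (RtoC 0)).
- right; apply f_equal; rewrite H.
  change (Cminus (Cminus (Cplus (f z) (Cmult h k)) (f z)) (Cmult h k) = RtoC 0); ring.
- rewrite Cmod_0; apply Rmult_le_pos; [lra|apply Cmod_ge_0].
Qed.

(** With increments Da and Df, the remainder is (Da - h la) f(z) + a(z) (Df - h lf) + Da Df. The
    last term is quadratic in [h] because both increments are O(h). *)
Lemma Cder_scal {W : NormedModule C_AbsRing} (a : C -> C) (f : C -> W) z (la : C) lf :
  Cder (W := C_NormedModule) a z la -> Cder f z lf ->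
  Cder (fun z => scal (a z : C_AbsRing) (f z)) z
       (plus (scal (la : C_AbsRing) (f z)) (scal (a z : C_AbsRing) lf)).
Proof.
intros Ha Hf eps He.
destruct (Cder_lipschitz _ _ _ Hf) as [d0 [Kf [Hd0 [HKf H0]]]].
assert (Hla := Cmod_ge_0 la); assert (Haz := Cmod_ge_0 (a z)); assert (Hfz := norm_ge_0 (f z)).
destruct (small_factor eps (norm (f z) + Cmod (a z) + (Cmod la + 1) * Kf) He)
  as [e [He1 He2]]; [nra|].
destruct (Ha (Rmin e 1)) as [d1 [Hd1 H1]]; [apply Rmin_pos; lra|].
destruct (Hf _ He1) as [d2 [Hd2 H2]].
exists (Rmin (Rmin d0 e) (Rmin d1 d2)); split; [repeat apply Rmin_pos; assumption|].
intros h Hh.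
assert (Hh0 : Cmod h < d0 /\ Cmod h < e /\ Cmod h < d1 /\ Cmod h < d2).
{ assert (A1 := Rmin_l (Rmin d0 e) (Rmin d1 d2)); assert (A2 := Rmin_r (Rmin d0 e) (Rmin d1 d2)).
  assert (A3 := Rmin_l d0 e); assert (A4 := Rmin_r d0 e).
  assert (A5 := Rmin_l d1 d2); assert (A6 := Rmin_r d1 d2); lra. }
destruct Hh0 as [Hh0 [Hhe [Hh1 Hh2]]].
set (Da := Cminus (a (Cplus z h)) (a z)).
assert (B1 : Cmod (Cminus Da (Cmult h la)) <= e * Cmod h).
{ apply Rle_trans with (1 := H1 h Hh1), Rmult_le_compat_r, Rmin_l; apply Cmod_ge_0. }
assert (B2 : Cmod Da <= (Cmod la + 1) * Cmod h).
{ replace Da with (Cplus (Cminus Da (Cmult h la)) (Cmult h la)) by ring.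
  apply Rle_trans with (1 := Cmod_triangle _ _); rewrite Cmod_mult.
  assert (B3 := H1 h Hh1 : Cmod (Cminus Da (Cmult h la)) <= Rmin e 1 * Cmod h).
  assert (B4 := Rmin_r e 1); assert (B5 := Cmod_ge_0 h).
  assert (B6 := Rmult_le_compat_r _ _ _ B5 B4); lra. }
apply (norm_le_eq (plus (plus (scal (Cminus Da (Cmult h la) : C_AbsRing) (f z))
    (scal (a z : C_AbsRing) (minus (minus (f (Cplus z h)) (f z)) (scal (h : C_AbsRing) lf))))
    (scal (Da : C_AbsRing) (minus (f (Cplus z h)) (f z))))); [(unfold Da; module_ring W)|].
assert (Hh3 := Cmod_ge_0 h).
apply Rle_trans with (e * Cmod h * norm (f z) + Cmod (a z) * (e * Cmod h)
                      + (Cmod la + 1) * Cmod h * (Kf * e)).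
- apply norm_plus_compat; [apply norm_plus_compat|].
  + apply norm_scal_compat; [exact B1|apply Rle_refl].
  + apply norm_scal_compat; [apply Rle_refl|apply H2, Hh2].
  + apply norm_scal_compat; [exact B2|].
    apply Rle_trans with (1 := H0 h Hh0), Rmult_le_compat_l; lra.
- apply Rle_trans with (e * (norm (f z) + Cmod (a z) + (Cmod la + 1) * Kf) * Cmod h).
  + right; ring.
  + apply Rmult_le_compat_r; lra.
Qed.

Lemma Cder_linear {V W : NormedModule C_AbsRing} (L : V -> W) (HL : is_linear L) f z l :
  Cder f z l -> Cder (fun z => L (f z)) z (L l).
Proof.
intros Hf eps He; destruct (linear_norm _ HL) as [M [HM HLM]].
destruct (small_factor eps M He) as [e [He1 He2]]; [lra|].
destruct (Hf e He1) as [d [Hd H]]; exists d; split; [exact Hd|]; intros h Hh.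
rewrite <- (linear_scal _ HL (h : C_AbsRing)), <- !(is_linear_minus_map L HL).
apply Rle_trans with (1 := HLM _).
assert (Hh0 := Cmod_ge_0 h).
apply Rle_trans with (M * (e * Cmod h)); [apply Rmult_le_compat_l; [lra|apply H, Hh]|].
rewrite <- Rmult_assoc, (Rmult_comm M); apply Rmult_le_compat_r; lra.
Qed.

Lemma Cder_comp {W : NormedModule C_AbsRing} (f : C -> W) (a : C -> C) z (la : C) l :
  Cder (W := C_NormedModule) a z la -> Cder f (a z) l ->
  Cder (fun z => f (a z)) z (scal (la : C_AbsRing) l).
Proof.
intros Ha Hf eps He.
destruct (Cder_lipschitz _ _ _ Ha) as [d0 [K [Hd0 [HK H0]]]].
assert (Hl := norm_ge_0 l).
destruct (small_factor eps (K + norm l) He) as [e [He1 He2]]; [lra|].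
destruct (Ha _ He1) as [d1 [Hd1 H1]], (Hf _ He1) as [d2 [Hd2 H2]].
assert (Hd3 : 0 < d2 / (K + 1)) by (apply Rdiv_lt_0_compat; lra).
exists (Rmin (d2 / (K + 1)) (Rmin d0 d1)); split; [repeat apply Rmin_pos; assumption|].
intros h Hh; assert (Hh3 := Cmod_ge_0 h).
assert (Hh0 : Cmod h < d2 / (K + 1) /\ Cmod h < d0 /\ Cmod h < d1).
{ assert (A1 := Rmin_l (d2 / (K + 1)) (Rmin d0 d1)).
  assert (A2 := Rmin_r (d2 / (K + 1)) (Rmin d0 d1)).
  assert (A3 := Rmin_l d0 d1); assert (A4 := Rmin_r d0 d1); lra. }
destruct Hh0 as [Hh2 [Hh0 Hh1]].
set (Da := Cminus (a (Cplus z h)) (a z)).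
assert (B1 : Cmod Da <= K * Cmod h) by exact (H0 h Hh0).
assert (B2 : Cmod Da < d2).
{ apply Rle_lt_trans with ((K + 1) * Cmod h); [lra|].
  replace d2 with ((K + 1) * (d2 / (K + 1))) by (field; lra).
  apply Rmult_lt_compat_l; lra. }
apply (norm_le_eq (plus (minus (minus (f (Cplus (a z) Da)) (f (a z))) (scal (Da : C_AbsRing) l))
             (scal (Cminus Da (Cmult h la) : C_AbsRing) l))).
{  replace (Cplus (a z) Da) with (a (Cplus z h)) by (unfold Da; ring); module_ring W. }
apply Rle_trans with (e * (K * Cmod h) + e * Cmod h * norm l).
- apply norm_plus_compat.
  + apply Rle_trans with (1 := H2 Da B2), Rmult_le_compat_l; lra.
  + apply norm_scal_compat; [exact (H1 h Hh1)|apply Rle_refl].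
- apply Rle_trans with (e * (K + norm l) * Cmod h); [right; ring|].
  apply Rmult_le_compat_r; lra.
Qed.

Lemma Cnorm_Cmod (z : C) : @norm R_AbsRing C_R_NormedModule z = Cmod z.
Proof.
unfold norm, Cmod; simpl; unfold prod_norm; simpl.
unfold norm; simpl; unfold abs; simpl.
f_equal; rewrite !Rmult_1_r. f_equal; rewrite <- Rabs_mult; apply Rabs_pos_eq; nra.
Qed.

Lemma is_derive_eps {V : NormedModule R_AbsRing} (f : R -> V) (t : R) (l : V) :
  is_derive f t l <->
  forall eps, 0 < eps -> exists delta, 0 < delta /\
    forall h, Rabs h < delta ->
      norm (minus (minus (f (t + h)) (f t)) (scal h l)) <= eps * Rabs h.
Proof.
split.
- intros [_ H] eps He.
  assert (Ht : is_filter_lim (locally t) t) by (intros P HP; exact HP).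
  destruct (H t Ht (mkposreal _ He)) as [d Hd].
  exists d; split; [apply cond_pos|]; intros h Hh.
  assert (Hd' : forall y, Rabs (y - t) < d ->
    norm (minus (minus (f y) (f t)) (scal (y - t) l)) <= eps * Rabs (y - t)) by exact Hd.
  assert (H1 := Hd' (t + h)); replace (t + h - t) with h in H1 by ring.
  apply H1, Hh.
- intros H; split; [apply is_linear_scal_l|].
  intros x Hx eps.
  rewrite <- (is_filter_lim_locally_unique _ _ Hx).
  destruct (H eps (cond_pos eps)) as [d [Hd Hf]].
  assert (Hf' : forall y, Rabs (y - t) < d ->
    norm (minus (minus (f y) (f t)) (scal (y - t) l)) <= eps * Rabs (y - t)).
  { intros y Hy; assert (H1 := Hf (y - t) Hy).
    replace (t + (y - t)) with y in H1 by ring; exact H1. }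
  exists (mkposreal d Hd); exact Hf'.
Qed.

Section Curves.

Context {W : NormedModule C_AbsRing}.

Lemma Cder_curve (f : C -> W) (g : R -> C) (t : R) (d : C) (l : W) :
  is_derive (K := R_AbsRing) (V := C_R_NormedModule) g t d ->
  Cder f (g t) l ->
  is_derive (K := R_AbsRing) (V := real_NormedModule W) (fun t => f (g t)) t
    (scal (d : C_AbsRing) l).
Proof.
intros Hg Hf; apply is_derive_eps; intros eps He.
rewrite is_derive_eps in Hg.
assert (Hl := norm_ge_0 l); assert (Hd := Cmod_ge_0 d).
destruct (small_factor eps (Cmod d + 1 + norm l) He) as [e [He1 He2]]; [lra|].
destruct (Hf _ He1) as [d2 [Hd2 H2]].
destruct (Hg (Rmin e 1)) as [d1 [Hd1 H1]]; [apply Rmin_pos; lra|].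
assert (Hd3 : 0 < d2 / (Cmod d + 1)) by (apply Rdiv_lt_0_compat; lra).
exists (Rmin d1 (d2 / (Cmod d + 1))); split; [apply Rmin_pos; assumption|].
intros h Hh; assert (Hh3 := Rabs_pos h).
assert (Hh1 := Rlt_le_trans _ _ _ Hh (Rmin_l _ _)).
assert (Hh2 := Rlt_le_trans _ _ _ Hh (Rmin_r _ _)).
set (Da := Cminus (g (t + h)) (g t)).
assert (B0 : Cmod (Cminus Da (Cmult (RtoC h) d)) <= Rmin e 1 * Rabs h).
{ assert (B := H1 h Hh1); rewrite Cnorm_Cmod in B.
  replace (Cminus Da (Cmult (RtoC h) d)) with
    (minus (minus (g (t + h)) (g t)) (scal h d) : C); [exact B|].
  unfold Da; rewrite <- scal_R_Cmult; reflexivity. }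
assert (B1 : Cmod Da <= (Cmod d + 1) * Rabs h).
{ replace Da with (Cplus (Cminus Da (Cmult (RtoC h) d)) (Cmult (RtoC h) d)) by ring.
  apply Rle_trans with (1 := Cmod_triangle _ _); rewrite Cmod_mult, Cmod_R.
  assert (B4 := Rmin_r e 1); assert (B6 := Rmult_le_compat_r _ _ _ Hh3 B4); lra. }
assert (B2 : Cmod Da < d2).
{ apply Rle_lt_trans with (1 := B1).
  replace d2 with ((Cmod d + 1) * (d2 / (Cmod d + 1))) by (field; lra).
  apply Rmult_lt_compat_l; lra. }
change (norm (minus (minus (f (g (t + h))) (f (g t)))
           (scal (RtoC h : C_AbsRing) (scal (d : C_AbsRing) l))) <= eps * Rabs h).
apply (norm_le_eq (plus (minus (minus (f (Cplus (g t) Da)) (f (g t))) (scal (Da : C_AbsRing) l))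
             (scal (Cminus Da (Cmult (RtoC h) d) : C_AbsRing) l))).
{  replace (Cplus (g t) Da) with (g (t + h)) by (unfold Da; ring); module_ring W. }
apply Rle_trans with (e * ((Cmod d + 1) * Rabs h) + e * Rabs h * norm l).
- apply norm_plus_compat.
  + apply Rle_trans with (1 := H2 Da B2), Rmult_le_compat_l; lra.
  + apply norm_scal_compat; [|apply Rle_refl].
    apply Rle_trans with (1 := B0), Rmult_le_compat_r, Rmin_l; exact Hh3.
- apply Rle_trans with (e * (Cmod d + 1 + norm l) * Rabs h); [right; ring|].
  apply Rmult_le_compat_r; lra.
Qed.

Lemma Ccont_curve (f : C -> W) (g : R -> C) (t : R) :
  continuous g t -> Ccont f (g t) -> continuous (U := real_NormedModule W) (fun t => f (g t)) t.
Proof.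
intros Hg Hf.
refine (proj2 (filterlim_norm_lt (V := W) (locally t) (fun t => f (g t)) (f (g t))) _).
intros eps He; destruct (Hf eps He) as [d [Hd H]].
assert (Hg' := proj1 (filterlim_norm_lt (V := C_NormedModule) (locally t) g (g t)) Hg d Hd).
apply filter_imp with (2 := Hg'); intros u Hu; apply H, Hu.
Qed.

End Curves.

(** The scalar converges in the product structure of [C], whereas continuity of [scal] is stated for
    the normed-ring structure; [locally_C] passes from one to the other. *)
Lemma filterlim_Cscal {W : NormedModule C_AbsRing} {T : Type} (F : (T -> Prop) -> Prop)
    {FF : Filter F} (a : T -> C) (f : T -> W) (la : C) (lf : W) :
  filterlim a F (locally la) -> filterlim f F (locally lf) ->
  filterlim (fun t => scal (a t : C_AbsRing) (f t)) F (locally (scal (la : C_AbsRing) lf)).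
Proof.
intros Ha Hf.
apply (filterlim_comp_2 (G := @locally (AbsRing_UniformSpace C_AbsRing) la) (H := locally lf)
  a f (fun (c : C_AbsRing) (x : W) => scal c x)).
- intros P HP; apply Ha, locally_C, HP.
- exact Hf.
- exact (filterlim_scal (K := C_AbsRing) (V := W) la lf).
Qed.

Section Integration.

Variable W : NormedModule C_AbsRing.
Variable cW : CompleteSpace.mixin_of W.

Local Notation rW := (real_NormedModule W).
Local Notation cRW := (real_CompleteNormedModule W cW).

Lemma is_RInt_curve_derivative (F f : C -> W) (g dg : R -> C) a b :
  (forall t, Rmin a b <= t <= Rmax a b ->
     is_derive (K := R_AbsRing) (V := C_R_NormedModule) g t (dg t) /\ continuous dg t /\
     Cder F (g t) (f (g t)) /\ Ccont f (g t)) ->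
  is_RInt (V := rW) (fun t => scal (dg t : C_AbsRing) (f (g t))) a b
    (minus (F (g b)) (F (g a))).
Proof.
intros H.
apply (is_RInt_derive (V := cRW) (fun t => F (g t)) (fun t => scal (dg t : C_AbsRing) (f (g t)))).
- intros t Ht; destruct (H t Ht) as [H1 [H2 [H3 H4]]].
  exact (Cder_curve F g t (dg t) (f (g t)) H1 H3).
- intros t Ht; destruct (H t Ht) as [H1 [H2 [H3 H4]]].
  assert (Hg : continuous g t)
    by (apply (ex_derive_continuous (V := C_R_NormedModule)); eexists; exact H1).
  assert (C1 := Ccont_curve f g t Hg H4).
  exact (filterlim_Cscal (locally t) dg (fun t => f (g t)) (dg t) (f (g t)) H2 C1).
Qed.

Lemma curve_increment_le (F f : C -> W) (g dg : R -> C) (m : R -> R) a b I :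
  a <= b ->
  (forall t, a <= t <= b ->
     is_derive (K := R_AbsRing) (V := C_R_NormedModule) g t (dg t) /\ continuous dg t /\
     Cder F (g t) (f (g t)) /\ Ccont f (g t)) ->
  (forall t, a <= t <= b -> Cmod (dg t) * norm (f (g t)) <= m t) ->
  is_RInt m a b I ->
  norm (minus (F (g b)) (F (g a))) <= I.
Proof.
intros Hab H Hm HI.
apply (norm_RInt_le (V := rW) (fun t => scal (dg t : C_AbsRing) (f (g t))) m a b); auto.
- intros t Ht; refine (Rle_trans _ _ _ _ (Hm t Ht)).
  right; exact (norm_scal_eq (dg t) (f (g t))).
- apply is_RInt_curve_derivative; intros t Ht; apply H.
  rewrite Rmin_left, Rmax_right in Ht; auto.
Qed.

Lemma is_RInt_const_unit (K : R) : is_RInt (fun _ => K) 0 1 K.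
Proof.
assert (H := is_RInt_const (V := R_NormedModule) 0 1 K).
change (is_RInt (fun _ : R => K) 0 1 ((1 - 0) * K)) in H.
replace ((1 - 0) * K) with K in H by ring; exact H.
Qed.

Definition segment (p z : C) (t : R) : C := Cplus p (Cmult (RtoC t) (Cminus z p)).

Lemma segment_is_derive p z t :
  is_derive (K := R_AbsRing) (V := C_R_NormedModule) (segment p z) t (Cminus z p).
Proof.
apply is_derive_eps; intros eps He; exists 1; split; [lra|]; intros h _.
rewrite Cnorm_Cmod.
apply Rle_trans with (Cmod (RtoC 0)).
- right; f_equal; rewrite scal_R_Cmult; unfold segment; rewrite RtoC_plus.
  change (Cminus (Cminus (p + (t + h) * (z - p)) (p + t * (z - p))) (h * (z - p)) = RtoC 0)%C.
  ring.
- rewrite Cmod_0; apply Rmult_le_pos; [lra|apply Rabs_pos].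
Qed.

Lemma segment_increment_le (F f : C -> W) p z K :
  (forall t, 0 <= t <= 1 -> Cder F (segment p z t) (f (segment p z t)) /\
     Ccont f (segment p z t) /\ norm (f (segment p z t)) <= K) ->
  norm (minus (F z) (F p)) <= Cmod (Cminus z p) * K.
Proof.
intros H.
replace (F z) with (F (segment p z 1)) by (f_equal; unfold segment; ring).
replace (F p) with (F (segment p z 0)) at 1 by (f_equal; unfold segment; ring).
apply (curve_increment_le F f (segment p z) (fun _ => Cminus z p)
         (fun _ => Cmod (Cminus z p) * K) 0 1); [lra| | |].
- intros t Ht; destruct (H t Ht) as [H1 [H2 _]].
  split; [apply segment_is_derive|split; [apply continuous_const|split; assumption]].
- intros t Ht; apply Rmult_le_compat_l; [apply Cmod_ge_0|apply H, Ht].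
- apply is_RInt_const_unit.
Qed.

(** Mean value inequality for w |-> F w - w f(z), whose derivative is f w - f z. *)
Lemma Cder_taylor_le (F f : C -> W) z z' e :
  (forall t, 0 <= t <= 1 -> Cder F (segment z z' t) (f (segment z z' t)) /\
     Ccont f (segment z z' t) /\ norm (minus (f (segment z z' t)) (f z)) <= e) ->
  norm (minus (minus (F z') (F z)) (scal (Cminus z' z : C_AbsRing) (f z))) <= e * Cmod (Cminus z' z).
Proof.
intros H; rewrite Rmult_comm.
set (G := fun w : C => plus (F w) (scal (Copp w : C_AbsRing) (f z))).
apply (norm_le_eq (minus (G z') (G z))); [unfold G; module_ring W|].
apply (segment_increment_le G (fun w => minus (f w) (f z))).
intros t Ht; destruct (H t Ht) as [H1 [H2 H3]]; repeat split; [| |exact H3].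
- unfold G.
  apply Cder_eq with (plus (f (segment z z' t)) (opp (f z))); [reflexivity|].
  apply Cder_plus; [exact H1|].
  intros eps He; exists 1; split; [lra|]; intros h _.
  apply (norm_le_eq zero); [module_ring W|].
  apply Rle_trans with 0; [right; exact (norm_zero (V := W))|].
  apply Rmult_le_pos; [lra|apply Cmod_ge_0].
- intros eps He; destruct (H2 eps He) as [d [Hd H4]]; exists d; split; [exact Hd|].
  intros w Hw; apply Rle_lt_trans with (2 := H4 w Hw).
  apply (norm_le_eq (minus (f w) (f (segment z z' t)))); [module_ring W|apply Rle_refl].
Qed.

(** * Primitives obtained by integration along segments *)

Section StarShapedPrimitive.

Variable U : C -> Prop.
Hypothesis U_open : forall z, U z ->
  exists d, 0 < d /\ forall z', Cmod (Cminus z' z) < d -> U z'.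
Variable p : C.
Hypothesis U_star : forall z t, U z -> 0 <= t <= 1 -> U (segment p z t).

(** Differentiating under the integral replaces [f] by its derivative and multiplies the weight by
    [t]; with a weight, the family is closed under differentiation. *)
Definition wint (phi : R -> R) (f : C -> W) (z : C) : W :=
  RInt (V := cRW) (fun t => scal (RtoC (phi t) : C_AbsRing) (f (segment p z t))) 0 1.

Lemma continuous_RtoC (phi : R -> R) t : continuous phi t -> continuous (fun t => RtoC (phi t)) t.
Proof.
intros H.
refine (proj2 (filterlim_norm_lt (V := C_NormedModule) (locally t) (fun t => RtoC (phi t)) (RtoC (phi t))) _).
intros eps He.
assert (H1 : locally (phi t) (fun y => Rabs (y - phi t) < eps))
  by (exists (mkposreal _ He); intros y Hy; exact Hy).
refine (filter_imp (fun u => Rabs (phi u - phi t) < eps) _ _ (H _ H1)); intros u Hu.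
change (Cmod (Cminus (RtoC (phi u)) (RtoC (phi t))) < eps).
rewrite <- RtoC_minus, Cmod_R; exact Hu.
Qed.

Lemma wint_correct phi (f : C -> W) z :
  (forall t, continuous phi t) -> (forall z, U z -> Ccont f z) -> U z ->
  is_RInt (V := rW) (fun t => scal (RtoC (phi t) : C_AbsRing) (f (segment p z t))) 0 1 (wint phi f z).
Proof.
intros Hphi Hf Hz.
apply (RInt_correct (V := cRW)), (ex_RInt_continuous (V := cRW)).
intros t Ht; rewrite Rmin_left, Rmax_right in Ht by lra.
assert (Hs : continuous (segment p z) t).
{ apply (ex_derive_continuous (V := C_R_NormedModule)); eexists; apply segment_is_derive. }
exact (filterlim_Cscal (locally t) _ _ _ _ (continuous_RtoC phi t (Hphi t))
  (Ccont_curve f (segment p z) t Hs (Hf _ (U_star z t Hz Ht)))).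
Qed.

(** Compactness of the segment from [p] to [z] makes [delta] independent of [t], which is what
    differentiation under the integral requires. *)
Lemma segment_taylor_uniform (f f1 : C -> W) z eps :
  (forall z, U z -> Cder f z (f1 z)) -> (forall z, U z -> Ccont f1 z) -> U z -> 0 < eps ->
  exists delta, 0 < delta /\ forall z' t, Cmod (Cminus z' z) < delta -> 0 <= t <= 1 ->
    U z' /\
    norm (minus (minus (f (segment p z' t)) (f (segment p z t)))
      (scal (Cmult (RtoC t) (Cminus z' z) : C_AbsRing) (f1 (segment p z t))))
    <= eps * Cmod (Cminus z' z).
Proof.
intros Hf Hf1 Hz He.
(* [K] dominates both 1 and the speed of the segment. A radius 2 r K therefore leaves r K for a
   change of the parameter by r and r K for a displacement of the point. *)
set (K := Cmod (Cminus z p) + 1).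
assert (HK : 1 <= K) by (assert (H := Cmod_ge_0 (Cminus z p)); unfold K; lra).
assert (He2 : 0 < eps / 2) by lra.
assert (Hloc : forall t, exists r : posreal, 0 <= t <= 1 ->
  forall w, Cmod (Cminus w (segment p z t)) < 2 * (r * K) ->
    U w /\ norm (minus (f1 w) (f1 (segment p z t))) < eps / 2).
{ intros t; destruct (excluded_middle_informative (0 <= t <= 1)) as [Ht|Ht].
  - assert (Hs := U_star z t Hz Ht).
    destruct (U_open _ Hs) as [d1 [Hd1 H1]].
    destruct (Hf1 _ Hs _ He2) as [d2 [Hd2 H2]].
    assert (Hr : 0 < Rmin d1 d2 / (2 * K))
      by (apply Rdiv_lt_0_compat; [apply Rmin_pos; assumption|lra]).
    exists (mkposreal _ Hr); intros _ w Hw; simpl in Hw.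
    replace (2 * (Rmin d1 d2 / (2 * K) * K)) with (Rmin d1 d2) in Hw by (field; lra).
    split; [apply H1|apply H2]; apply Rlt_le_trans with (1 := Hw); [apply Rmin_l|apply Rmin_r].
  - exists (mkposreal 1 Rlt_0_1); intros Ht'; contradiction. }
set (r := fun t => proj1_sig (constructive_indefinite_description _ (Hloc t))).
assert (Hr : forall t, 0 <= t <= 1 ->
  forall w, Cmod (Cminus w (segment p z t)) < 2 * (r t * K) ->
    U w /\ norm (minus (f1 w) (f1 (segment p z t))) < eps / 2).
{ intros t; exact (proj2_sig (constructive_indefinite_description _ (Hloc t))). }
(* Lebesgue number: each [t] lies within [r u] of some [u] whose radius [r u] is at least [d]. The
   conclusion is doubly negated, hence the [NNPP] below. *)
destruct (compactness_value_1d 0 1 r) as [d Hd].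
destruct (U_open z Hz) as [d0 [Hd0 Hd0']].
exists (Rmin d d0); split; [apply Rmin_pos; [apply cond_pos|exact Hd0]|].
intros z' t Hz0 Ht.
assert (Hz' := Rlt_le_trans _ _ _ Hz0 (Rmin_l d d0)).
destruct (NNPP _ (Hd t Ht)) as [u [Hu [Htu Hdu]]].
assert (Hnear : forall w, Cmod (Cminus w (segment p z t)) < d -> 
  Cmod (Cminus w (segment p z u)) < 2 * (r u * K)).
{ intros w Hw.
  replace (Cminus w (segment p z u)) with
    (Cplus (Cminus w (segment p z t)) (Cmult (RtoC (t - u)) (Cminus z p)))
    by (unfold segment; rewrite RtoC_minus; ring).
  apply Rle_lt_trans with (1 := Cmod_triangle _ _); rewrite Cmod_mult, Cmod_R.
  assert (H1 : Rabs (t - u) * Cmod (Cminus z p) <= r u * K).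
  { apply Rmult_le_compat; [apply Rabs_pos|apply Cmod_ge_0|lra|unfold K; lra]. }
  assert (H2 : d * 1 <= r u * K)
    by (apply Rmult_le_compat; [apply Rlt_le, cond_pos|lra|exact Hdu|exact HK]).
  lra. }
assert (Hzz : Cmod (Cminus (segment p z' t) (segment p z t)) <= Cmod (Cminus z' z)).
{ replace (Cminus (segment p z' t) (segment p z t)) with (Cmult (RtoC t) (Cminus z' z))
    by (unfold segment; ring).
  rewrite Cmod_mult, Cmod_R, Rabs_pos_eq by lra.
  assert (H := Cmod_ge_0 (Cminus z' z)); nra. }
assert (Hin : forall s, 0 <= s <= 1 ->
   Cmod (Cminus (segment (segment p z t) (segment p z' t) s) (segment p z t)) < d).
{ intros s Hs.
  replace (Cminus (segment (segment p z t) (segment p z' t) s) (segment p z t))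
    with (Cmult (RtoC s) (Cminus (segment p z' t) (segment p z t)))
    by (unfold segment; ring).
  rewrite Cmod_mult, Cmod_R, Rabs_pos_eq by lra.
  assert (H := Cmod_ge_0 (Cminus (segment p z' t) (segment p z t))); nra. }
split.
- apply Hd0', (Rlt_le_trans _ _ _ Hz0), Rmin_r.
- replace (Cmult (RtoC t) (Cminus z' z)) with (Cminus (segment p z' t) (segment p z t))
    by (unfold segment; ring).
  apply Rle_trans with (eps * Cmod (Cminus (segment p z' t) (segment p z t)));
    [|apply Rmult_le_compat_l; lra].
  apply Cder_taylor_le; intros s Hs.
  destruct (Hr u Hu _ (Hnear _ (Hin s Hs))) as [H1 H2].
  destruct (Hr u Hu (segment p z t)) as [_ H3].
  { apply Hnear; replace (Cminus (segment p z t) (segment p z t)) with (RtoC 0) by ring.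
    rewrite Cmod_0; apply cond_pos. }
  split; [apply Hf, H1|split].
  + apply Hf1, H1.
  + replace eps with (eps / 2 + eps / 2) by field.
    apply (norm_le_eq (minus
      (minus (f1 (segment (segment p z t) (segment p z' t) s)) (f1 (segment p z u)))
      (minus (f1 (segment p z t)) (f1 (segment p z u))))); [module_ring W|].
    apply norm_minus_compat; apply Rlt_le; assumption.
Qed.

(** The Taylor remainder of the integrand is bounded uniformly in [t], and the weight is at most 1,
    so the same bound holds for the integral. *)
Lemma wint_Cder phi (f f1 : C -> W) z :
  (forall t, continuous phi t) -> (forall t, 0 <= t <= 1 -> Rabs (phi t) <= 1) ->
  (forall z, U z -> Cder f z (f1 z)) -> (forall z, U z -> Ccont f1 z) -> U z ->
  Cder (wint phi f) z (wint (fun t => t * phi t) f1 z).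
Proof.
intros Hphi Hphi1 Hf Hf1 Hz eps He.
destruct (segment_taylor_uniform f f1 z eps Hf Hf1 Hz He) as [d [Hd H]].
exists d; split; [exact Hd|]; intros h Hh.
assert (Hzh : Cminus (Cplus z h) z = h) by ring.
assert (H' := H (Cplus z h)); rewrite Hzh in H'.
assert (HUh : U (Cplus z h)) by (apply (H' 0 Hh); lra).
assert (Hfc : forall z, U z -> Ccont f z) by (intros w Hw; apply Cder_Ccont with (1 := Hf w Hw)).
assert (I1 := wint_correct phi f _ Hphi Hfc HUh).
assert (I2 := wint_correct phi f _ Hphi Hfc Hz).
assert (Hphi' : forall t, continuous (fun t => t * phi t) t).
{ intros t; apply (continuous_mult (K := R_AbsRing)); [apply continuous_id|apply Hphi]. }
assert (I3 := wint_correct (fun t => t * phi t) f1 _ Hphi' Hf1 Hz).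
assert (L : is_linear (U := W) (V := W) (fun x => scal (h : C_AbsRing) x)).
{ exact (is_linear_scal_r (K := C_AbsRing) (V := W) h Cmult_comm). }
assert (I4 := is_RInt_linear _ L _ _ _ _ I3).
assert (I5 := is_RInt_minus (V := rW) _ _ _ _ _ _ (is_RInt_minus (V := rW) _ _ _ _ _ _ I1 I2) I4).
refine (norm_RInt_le (V := rW) _ (fun _ => eps * Cmod h) 0 1 _ _ _ _ I5 (is_RInt_const_unit _)); [lra|].
intros t Ht.
destruct (H' t Hh Ht) as [_ H1].
replace (eps * Cmod h) with (1 * (eps * Cmod h)) by ring.
apply (norm_le_eq (V := W) (scal (RtoC (phi t) : C_AbsRing)
  (minus (minus (f (segment p (Cplus z h) t)) (f (segment p z t)))
      (scal (Cmult (RtoC t) h : C_AbsRing) (f1 (segment p z t)))))); [module_ring W|].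
apply norm_scal_compat; [rewrite Cmod_R; apply Hphi1, Ht|exact H1].
Qed.

Definition star_primitive (f : C -> W) (z : C) : W :=
  scal (Cminus z p : C_AbsRing) (wint (fun _ => 1) f z).

(* The derivative of [(z - p) * int_0^1 f(p + t (z - p)) dt] is the integral of
   [d/dt (t f(p + t (z - p)))]. *)
Lemma star_primitive_Cder (f f1 : C -> W) z :
  (forall z, U z -> Cder f z (f1 z)) -> (forall z, U z -> Ccont f1 z) -> U z ->
  Cder (star_primitive f) z (f z).
Proof.
intros Hf Hf1 Hz.
assert (H1 : forall t, continuous (fun _ : R => 1) t) by (intros t; apply continuous_const).
assert (Ht1 : forall t, continuous (fun t : R => t * 1) t).
{ intros t; apply continuous_ext with (fun t : R => t); [intros u; exact (eq_sym (Rmult_1_r u))|apply continuous_id]. }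
assert (Hfc : forall z, U z -> Ccont f z) by (intros w Hw; apply Cder_Ccont with (1 := Hf w Hw)).
assert (D : Cder (wint (fun _ => 1) f) z (wint (fun t => t * 1) f1 z)).
{ exact (wint_Cder (fun _ => 1) f f1 z H1
    (fun t _ => Req_le _ _ (Rabs_pos_eq 1 Rle_0_1)) Hf Hf1 Hz). }
assert (Da : Cder (W := C_NormedModule) (fun z => Cminus z p) z (RtoC 1)) by (apply Cder_affine; intros h; ring).
refine (Cder_eq _ _ _ _ _ (Cder_scal _ _ _ _ _ Da D)).
assert (I1 := wint_correct (fun _ => 1) f _ H1 Hfc Hz).
assert (I3 := wint_correct (fun t => t * 1) f1 _ Ht1 Hf1 Hz).
assert (L : is_linear (U := W) (V := W) (fun x => scal (Cminus z p : C_AbsRing) x)).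
{ exact (is_linear_scal_r (K := C_AbsRing) (V := W) (Cminus z p) Cmult_comm). }
assert (I4 := is_RInt_plus (V := rW) _ _ _ _ _ _ I1 (is_RInt_linear _ L _ _ _ _ I3)).
set (F := fun w : C => scal (w : C_AbsRing) (f (Cplus p (Cmult w (Cminus z p))))).
set (dF := fun t : R => plus (scal (RtoC 1 : C_AbsRing) (f (segment p z t)))
     (scal (Cminus z p : C_AbsRing) (scal (RtoC (t * 1) : C_AbsRing) (f1 (segment p z t))))).
assert (Hder : forall t, 0 <= t <= 1 -> is_derive (K := R_AbsRing) (V := rW)
   (fun t => F (RtoC t)) t (dF t)).
{ intros t Ht.
  assert (Hs := U_star z t Hz Ht).
  assert (D1 : Cder (W := C_NormedModule) (fun w => w) (RtoC t) (RtoC 1)) by (apply Cder_affine; intros h; ring).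
  assert (D2 : Cder (W := C_NormedModule) (fun w => Cplus p (Cmult w (Cminus z p))) (RtoC t)
                 (Cminus z p)) by (apply Cder_affine; intros h; ring).
  assert (D3 := Cder_scal _ _ _ _ _ D1 (Cder_comp f _ _ _ _ D2 (Hf _ Hs))).
  assert (D4 : is_derive (K := R_AbsRing) (V := C_R_NormedModule) RtoC t (RtoC 1)).
  { apply is_derive_eps; intros eps He; exists 1; split; [lra|]; intros h _.
    rewrite Cnorm_Cmod.
    apply Rle_trans with (Cmod (RtoC 0)).
    - right; f_equal; rewrite scal_R_Cmult, RtoC_plus.
      change (Cminus (Cminus (t + h) t) (h * 1) = RtoC 0)%C; ring.
    - rewrite Cmod_0; apply Rmult_le_pos; [lra|apply Rabs_pos]. }
  refine (eq_rect _ (fun l => is_derive (K := R_AbsRing) (V := rW) _ t l)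
            (Cder_curve _ _ _ _ _ D4 D3) _ _).
  unfold dF, segment; module_ring W. }
assert (Hcont : forall t, 0 <= t <= 1 -> continuous (U := rW) dF t).
{ intros t Ht.
  assert (Hs : continuous (segment p z) t).
  { apply (ex_derive_continuous (V := C_R_NormedModule)); eexists; apply segment_is_derive. }
  apply (continuous_plus (V := W)).
  - exact (filterlim_Cscal (locally t) _ _ _ _ (continuous_RtoC _ t (H1 t))
      (Ccont_curve f (segment p z) t Hs (Hfc _ (U_star z t Hz Ht)))).
  - apply (linear_filterlim _ L (locally t)).
    exact (filterlim_Cscal (locally t) _ _ _ _ (continuous_RtoC _ t (Ht1 t))
      (Ccont_curve f1 (segment p z) t Hs (Hf1 _ (U_star z t Hz Ht)))). }
assert (I5 : is_RInt (V := rW) dF 0 1 (minus (F (RtoC 1)) (F (RtoC 0)))).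
{ apply (is_RInt_derive (V := cRW) (fun t => F (RtoC t)) dF); intros t Ht;
    rewrite Rmin_left, Rmax_right in Ht by lra; [apply Hder, Ht|apply Hcont, Ht]. }
assert (E := filterlim_locally_unique (V := rW) _ _ _ I4 I5).
transitivity (plus (wint (fun _ => 1) f z)
  (scal (Cminus z p : C_AbsRing) (wint (fun t => t * 1) f1 z))); [module_ring W|].
etransitivity; [exact E|].
unfold F; replace (Cplus p (Cmult (RtoC 1) (Cminus z p))) with z by ring.
module_ring W.
Qed.

End StarShapedPrimitive.

End Integration.

(** * Integrals along piecewise C1 contours *)

Section ContourIntegrals.

Variable W : NormedModule C_AbsRing.
Variable cW : CompleteSpace.mixin_of W.

Local Notation rW := (real_NormedModule W).
Local Notation cRW := (real_CompleteNormedModule W cW).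

(** The value of [dg] at a corner is arbitrary. Between two corners it is replaced by a continuous
    function on the whole line that takes the one-sided limits as its values at and beyond the
    ends. *)
Definition clamp_fun (a b : R) (La Lb : C) (dg : R -> C) (t : R) : C :=
  if Rle_dec t a then La else if Rle_dec b t then Lb else dg t.

Lemma clamp_fun_continuous a b La Lb dg :
  a < b -> (forall t, a < t < b -> continuous dg t) ->
  filterlim dg (at_right a) (locally La) -> filterlim dg (at_left b) (locally Lb) ->
  forall t, continuous (clamp_fun a b La Lb dg) t.
Proof.
intros Hab Hdg Ha Hb t P HP.
assert (Hloc : forall (Q : R -> Prop) u e, 0 < e -> (forall v, Rabs (v - u) < e -> Q v) -> locally u Q).
{ intros Q u e He HQ; exists (mkposreal _ He); exact HQ. }
unfold filtermap.
destruct (Rtotal_order t a) as [H1|[H1|H1]].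
- apply Hloc with (a - t); [lra|]; intros v Hv.
  assert (Hv' := Rabs_def2 _ _ Hv).
  unfold clamp_fun in HP |- *; destruct (Rle_dec t a); [|lra]; destruct (Rle_dec v a); [|lra].
  apply locally_singleton, HP.
- subst t.
  assert (HP' : locally La P)
    by (unfold clamp_fun in HP; destruct (Rle_dec a a); [exact HP|lra]).
  destruct (Ha P HP') as [d Hd].
  apply Hloc with (Rmin d (b - a)); [apply Rmin_pos; [apply cond_pos|lra]|]; intros v Hv.
  assert (Hv1 := Rlt_le_trans _ _ _ Hv (Rmin_l _ _)).
  assert (Hv2 := Rabs_def2 _ _ (Rlt_le_trans _ _ _ Hv (Rmin_r _ _))).
  unfold clamp_fun; destruct (Rle_dec v a); [apply locally_singleton, HP'|].
  destruct (Rle_dec b v); [lra|]; apply Hd; [exact Hv1|lra].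
- destruct (Rtotal_order t b) as [H2|[H2|H2]].
  + assert (HP' : locally (dg t) P).
    { unfold clamp_fun in HP; destruct (Rle_dec t a); [lra|]; destruct (Rle_dec b t); [lra|exact HP]. }
    destruct (Hdg t (conj H1 H2) P HP') as [d Hd].
    apply Hloc with (Rmin d (Rmin (t - a) (b - t)));
      [repeat apply Rmin_pos; [apply cond_pos|lra|lra]|]; intros v Hv.
    assert (Hv1 := Rlt_le_trans _ _ _ Hv (Rmin_l _ _)).
    assert (Hv2 := Rlt_le_trans _ _ _ Hv (Rmin_r _ _)).
    assert (Hv3 := Rabs_def2 _ _ (Rlt_le_trans _ _ _ Hv2 (Rmin_l _ _))).
    assert (Hv4 := Rabs_def2 _ _ (Rlt_le_trans _ _ _ Hv2 (Rmin_r _ _))).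
    unfold clamp_fun; destruct (Rle_dec v a); [lra|]; destruct (Rle_dec b v); [lra|].
    apply Hd; exact Hv1.
  + subst t.
    assert (HP' : locally Lb P).
    { unfold clamp_fun in HP; destruct (Rle_dec b a); [lra|]; destruct (Rle_dec b b); [exact HP|lra]. }
    destruct (Hb P HP') as [d Hd].
    apply Hloc with (Rmin d (b - a)); [apply Rmin_pos; [apply cond_pos|lra]|]; intros v Hv.
    assert (Hv1 := Rlt_le_trans _ _ _ Hv (Rmin_l _ _)).
    assert (Hv2 := Rabs_def2 _ _ (Rlt_le_trans _ _ _ Hv (Rmin_r _ _))).
    unfold clamp_fun; destruct (Rle_dec v a); [lra|].
    destruct (Rle_dec b v); [apply locally_singleton, HP'|apply Hd; [exact Hv1|lra]].
  + apply Hloc with (t - b); [lra|]; intros v Hv.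
    assert (Hv' := Rabs_def2 _ _ Hv).
    unfold clamp_fun in HP |- *; destruct (Rle_dec t a); [lra|]; destruct (Rle_dec b t); [|lra].
    destruct (Rle_dec v a); [lra|]; destruct (Rle_dec b v); [|lra].
    apply locally_singleton, HP.
Qed.

Lemma constant_on_closure (D : R -> W) a b :
  a < b -> (forall t, continuous (U := rW) D t) ->
  (forall x y, a < x < b -> a < y < b -> D x = D y) -> D a = D b.
Proof.
intros Hab HD Hc.
apply (norm_minus_arbitrarily_small (V := W)); intros eps He.
assert (He2 : 0 < eps / 2) by lra.
assert (Hd : forall t, exists d, 0 < d /\ forall u, Rabs (u - t) < d -> norm (minus (D u) (D t)) < eps / 2).
{ intros t; destruct (proj1 (filterlim_norm_lt (V := W) (locally t) D (D t)) (HD t) _ He2) as [d Hd].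
  exists d; split; [apply cond_pos|exact Hd]. }
destruct (Hd a) as [d1 [Hd1 H1]], (Hd b) as [d2 [Hd2 H2]].
set (m := Rmin (Rmin d1 d2) (b - a) / 2).
assert (Hm1 := Rmin_l d1 d2); assert (Hm2 := Rmin_r d1 d2).
assert (Hm3 := Rmin_l (Rmin d1 d2) (b - a)); assert (Hm4 := Rmin_r (Rmin d1 d2) (b - a)).
assert (Hm : 0 < Rmin (Rmin d1 d2) (b - a)) by (repeat apply Rmin_pos; lra).
assert (E : D (a + m) = D (b - m)) by (apply Hc; unfold m; lra).
assert (A1 : norm (minus (D (a + m)) (D a)) < eps / 2).
{ apply H1; replace (a + m - a) with m by ring; rewrite Rabs_pos_eq; unfold m; lra. }
assert (A2 : norm (minus (D (b - m)) (D b)) < eps / 2).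
{ apply H2; replace (b - m - b) with (- m) by ring; rewrite Rabs_Ropp, Rabs_pos_eq; unfold m; lra. }
apply (norm_le_eq (minus (minus (D (b - m)) (D b)) (minus (D (a + m)) (D a)))).
- rewrite E; module_ring W.
- replace eps with (eps / 2 + eps / 2) by field.
  apply norm_minus_compat; apply Rlt_le; assumption.
Qed.

Variables (F f : C -> W) (g dg : R -> C).
Hypothesis HF : forall t, Cder F (g t) (f (g t)).
Hypothesis Hf : forall t, Ccont f (g t).
Hypothesis Hg : piecewise_C1 g dg.

(** [F] along [g] need not be differentiable at the ends of the piece. The difference between the
    running integral of the clamped integrand and [F] along [g] is constant on the open interval,
    and continuity extends this to the ends. *)
Lemma is_RInt_smooth_piece a b :
  a < b ->
  (forall t, a < t < b ->
     is_derive (K := R_AbsRing) (V := C_R_NormedModule) g t (dg t) /\ continuous dg t) ->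
  is_RInt (V := rW) (fun t => scal (dg t : C_AbsRing) (f (g t))) a b
    (minus (F (g b)) (F (g a))).
Proof.
intros Hab Hin; destruct Hg as [Hgc [_ Hlim]].
destruct (Hlim a) as [_ [La HLa]], (Hlim b) as [[Lb HLb] _].
set (dg' := clamp_fun a b La Lb dg).
assert (Hdg' : forall t, continuous dg' t).
{ apply clamp_fun_continuous; auto; intros t Ht; apply Hin, Ht. }
set (phi := fun t => scal (dg' t : C_AbsRing) (f (g t))).
assert (Hphi : forall t, continuous (U := rW) phi t).
{ intros t; exact (filterlim_Cscal (locally t) dg' (fun t => f (g t)) _ _ (Hdg' t)
    (Ccont_curve f g t (Hgc t) (Hf t))). }
assert (HI : forall x y, is_RInt (V := rW) phi x y (RInt (V := cRW) phi x y)).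
{ intros x y; apply (RInt_correct (V := cRW)), (ex_RInt_continuous (V := cRW)).
  intros t _; apply Hphi. }
set (D := fun x => minus (RInt (V := cRW) phi a x) (F (g x)) : W).
assert (HD : D a = D b).
{ apply constant_on_closure; [exact Hab| |].
  - intros t; apply (continuous_minus (V := rW)).
    + apply (ex_derive_continuous (V := rW)); exists (phi t).
      apply (is_derive_RInt (V := rW) phi _ a); [|apply Hphi].
      apply filter_forall; intros x; apply HI.
    + apply (Ccont_curve F g t (Hgc t)), (Cder_Ccont _ _ _ (HF t)).
  - assert (Hxy : forall x y, a < x -> x <= y -> y < b -> D x = D y).
    { intros x y Hx Hle Hy.
      assert (J : is_RInt (V := rW) phi x y (minus (F (g y)) (F (g x)))).
      { apply (is_RInt_ext (V := rW) (fun t => scal (dg t : C_AbsRing) (f (g t)))).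
        - intros t Ht; rewrite Rmin_left, Rmax_right in Ht by lra.
          unfold phi, dg', clamp_fun; destruct (Rle_dec t a); [lra|].
          destruct (Rle_dec b t); [lra|reflexivity].
        - apply (is_RInt_curve_derivative W cW); intros t Ht.
          rewrite Rmin_left, Rmax_right in Ht by lra.
          destruct (Hin t) as [H1 H2]; [lra|]; auto. }
      assert (E := filterlim_locally_unique (V := rW) _ _ _ J (HI x y)).
      assert (E2 := RInt_Chasles (V := cRW) phi a x y (ex_intro _ _ (HI a x)) (ex_intro _ _ (HI x y))).
      unfold D; rewrite <- E2, <- E; module_ring W. }
    intros x y Hx Hy; destruct (Rle_dec x y); [|symmetry]; apply Hxy; lra. }
assert (E0 : RInt (V := cRW) phi a a = zero) by apply (RInt_point (V := cRW)).
assert (E : RInt (V := cRW) phi a b = minus (F (g b)) (F (g a))).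
{ unfold D in HD; rewrite E0 in HD.
  transitivity (plus (minus (RInt (V := cRW) phi a b) (F (g b))) (F (g b)) : W); [module_ring W|].
  rewrite <- HD; module_ring W. }
apply (is_RInt_ext (V := rW) phi).
- intros t Ht; rewrite Rmin_left, Rmax_right in Ht by lra.
  unfold phi, dg', clamp_fun; destruct (Rle_dec t a); [lra|].
  destruct (Rle_dec b t); [lra|reflexivity].
- rewrite <- E; apply HI.
Qed.

(** Induction on the list of corners, over all intervals at once: a corner inside the interval
    splits it, any other one is discarded. *)
Lemma is_RInt_contour a b :
  a < b ->
  is_RInt (V := rW) (fun t => scal (dg t : C_AbsRing) (f (g t))) a b
    (minus (F (g b)) (F (g a))).
Proof.
destruct Hg as [_ [[l Hl] _]].
assert (H : forall l' a b, a < b ->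
  (forall t, a < t < b -> ~ In t l' ->
     is_derive (K := R_AbsRing) (V := C_R_NormedModule) g t (dg t) /\ continuous dg t) ->
  is_RInt (V := rW) (fun t => scal (dg t : C_AbsRing) (f (g t))) a b
    (minus (F (g b)) (F (g a)))).
{ clear a b; induction l' as [|c l' IH]; intros a b Hab Hin.
  - apply is_RInt_smooth_piece; [exact Hab|]; intros t Ht; apply Hin; auto.
  - destruct (excluded_middle_informative (a < c < b)) as [Hc|Hc].
    + assert (I1 := IH a c (proj1 Hc)); assert (I2 := IH c b (proj2 Hc)).
      assert (J := is_RInt_Chasles (V := rW) _ a c b _ _
        (I1 ltac:(intros t Ht Hn; apply Hin; [lra|intros [E|E]; [lra|auto]]))
        (I2 ltac:(intros t Ht Hn; apply Hin; [lra|intros [E|E]; [lra|auto]]))).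
      refine (eq_rect _ (is_RInt (V := rW) _ a b) J _ _).
      change (plus (minus (F (g c)) (F (g a))) (minus (F (g b)) (F (g c))) = minus (F (g b)) (F (g a))).
      module_ring W.
    + apply IH; [exact Hab|]; intros t Ht Hn; apply Hin; [exact Ht|].
      intros [E|E]; [subst; contradiction|auto]. }
intros Hab; apply (H l a b Hab); intros t _; apply Hl.
Qed.

Lemma is_RInt_gen_contour Lm Lp :
  filterlim (fun t => F (g t)) (Rbar_locally m_infty) (locally Lm) ->
  filterlim (fun t => F (g t)) (Rbar_locally p_infty) (locally Lp) ->
  is_RInt_gen (V := rW) (fun t => scal (dg t : C_AbsRing) (f (g t)))
    (Rbar_locally m_infty) (Rbar_locally p_infty) (minus Lp Lm).
Proof.
intros Hm Hp P HP.
apply locally_of_norm in HP; destruct HP as [eps [He HP]].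
assert (He2 : 0 < eps / 2) by lra.
assert (H1 := proj1 (filterlim_norm_lt (V := W) _ _ _) Hm _ He2).
assert (H2 := proj1 (filterlim_norm_lt (V := W) _ _ _) Hp _ He2).
(* Keeping the two ends on either side of 0 guarantees that they are in increasing order. *)
assert (H1' : Rbar_locally m_infty (fun t => t < 0)) by (exists 0; auto).
assert (H2' : Rbar_locally p_infty (fun t => 0 < t)) by (exists 0; auto).
apply Filter_prod with (1 := filter_and _ _ H1 H1') (2 := filter_and _ _ H2 H2').
intros a b [Ha Ha0] [Hb Hb0]; exists (minus (F (g b)) (F (g a))); split.
- apply is_RInt_contour; simpl; lra.
- apply HP.
  apply Rle_lt_trans with (norm (minus (F (g b)) Lp) + norm (minus (F (g a)) Lm)); [|lra].
  apply (norm_le_eq (minus (minus (F (g b)) Lp) (minus (F (g a)) Lm))); [module_ring W|].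
  apply norm_minus_compat; apply Rle_refl.
Qed.

End ContourIntegrals.

(** * The principal logarithm and powers *)

Definition slit (z : C) : Prop := ~ (Im z = 0 /\ Re z <= 0).

Definition Cexp (z : C) : C := (exp (Re z) * cos (Im z), exp (Re z) * sin (Im z)).

Definition Clog (z : C) : C := (ln (Cmod z), Carg z).

Lemma Ceq (z w : C) : Re z = Re w -> Im z = Im w -> z = w.
Proof. destruct z, w; simpl; intros -> ->; reflexivity. Qed.

Lemma Cmod_le_Rabs (z : C) : Cmod z <= Rabs (Re z) + Rabs (Im z).
Proof.
replace z with (Cplus (RtoC (Re z)) (Cmult Ci (RtoC (Im z)))) at 1.
- apply Rle_trans with (1 := Cmod_triangle _ _).
  rewrite Cmod_mult, Cmod_Ci, !Cmod_R; lra.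
- apply Ceq; destruct z; simpl; ring.
Qed.

Lemma Rabs_Re_le (z : C) : Rabs (Re z) <= Cmod z.
Proof. apply re_le_Cmod. Qed.

Lemma Rabs_Im_le (z : C) : Rabs (Im z) <= Cmod z.
Proof. apply Rle_trans with (2 := Rmax_Cmod z), Rmax_r. Qed.

Lemma Cmod_sqr (z : C) : Cmod z * Cmod z = Re z * Re z + Im z * Im z.
Proof.
unfold Cmod; rewrite sqrt_sqrt; unfold Re, Im; [ring|].
assert (H1 := pow2_ge_0 (fst z)); assert (H2 := pow2_ge_0 (snd z)); lra.
Qed.

Lemma slit_neq_0 z : slit z -> z <> RtoC 0.
Proof. intros H E; apply H; rewrite E; simpl; lra. Qed.

Lemma Cmod_polar rho theta : 0 <= rho -> Cmod (rho * cos theta, rho * sin theta) = rho.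
Proof.
intros H; apply Rsqr_inj; [apply Cmod_ge_0|exact H|].
unfold Rsqr; rewrite Cmod_sqr; simpl.
assert (E := sin2_cos2 theta); unfold Rsqr in E.
replace (rho * cos theta * (rho * cos theta) + rho * sin theta * (rho * sin theta))
  with (rho * rho * (sin theta * sin theta + cos theta * cos theta)) by ring.
rewrite E; ring.
Qed.

Lemma Carg_polar rho theta :
  0 < rho -> - PI < theta <= PI -> Carg (rho * cos theta, rho * sin theta) = theta.
Proof.
intros Hr Ht; unfold Carg; rewrite Cmod_polar by lra; simpl.
replace (rho * cos theta / rho) with (cos theta) by (field; lra).
destruct (Rle_dec 0 (rho * sin theta)) as [H|H].
- apply acos_cos; split; [|lra].
  destruct (Rle_lt_dec 0 theta) as [|Hn]; [assumption|].
  assert (H1 := sin_lt_0_var theta (proj1 Ht) Hn); nra.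
- rewrite <- cos_neg, acos_cos; [ring|].
  destruct (Rle_lt_dec 0 theta) as [Hn|Hn]; [|lra].
  assert (H1 := sin_ge_0 theta Hn (proj2 Ht)); nra.
Qed.

Lemma Carg_bounds z : z <> RtoC 0 -> - PI < Carg z <= PI.
Proof.
intros Hz; assert (Hm := proj1 (Cmod_gt_0 z) Hz).
assert (HPI := PI_RGT_0).
assert (Hb := acos_bound (Re z / Cmod z)).
unfold Carg; destruct (Rle_dec 0 (Im z)) as [H|H]; [lra|]; split; [|lra].
destruct (Req_dec (acos (Re z / Cmod z)) PI) as [E|E]; [|lra].
exfalso.
assert (H1 := Rabs_Re_le z); apply Rabs_le_between in H1.
assert (H2 : -1 <= Re z / Cmod z <= 1).
{ split; [apply Rle_div_r|apply Rle_div_l]; lra. }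
assert (H3 := cos_acos _ H2); rewrite E, cos_PI in H3.
assert (H4 : Re z = - Cmod z).
{ apply Rmult_eq_reg_r with (/ Cmod z); [|apply Rinv_neq_0_compat; lra].
  unfold Rdiv in H3; rewrite <- H3; field; lra. }
assert (H5 := Cmod_sqr z); rewrite H4 in H5; nra.
Qed.

Lemma polar_form z : z <> RtoC 0 -> z = (Cmod z * cos (Carg z), Cmod z * sin (Carg z)).
Proof.
intros Hz; assert (Hm := proj1 (Cmod_gt_0 z) Hz).
assert (H1 := Rabs_Re_le z); apply Rabs_le_between in H1.
assert (H2 : -1 <= Re z / Cmod z <= 1).
{ split; [apply Rle_div_r|apply Rle_div_l]; lra. }
assert (Hs : Cmod z * sin (acos (Re z / Cmod z)) = Rabs (Im z)).
{ rewrite sin_acos by exact H2.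
  apply Rsqr_inj; [apply Rmult_le_pos; [lra|apply sqrt_pos]|apply Rabs_pos|].
  rewrite Rsqr_mult, Rsqr_sqrt, <- Rsqr_abs.
  - unfold Rsqr; assert (H3 := Cmod_sqr z).
    replace (Cmod z * Cmod z * (1 - Re z / Cmod z * (Re z / Cmod z)))
      with (Cmod z * Cmod z - Re z * Re z) by (field; lra); lra.
  - unfold Rsqr; nra. }
apply Ceq; simpl; unfold Carg; destruct (Rle_dec 0 (Im z)) as [H|H].
- rewrite cos_acos by exact H2; field; lra.
- rewrite cos_neg, cos_acos by exact H2; field; lra.
- rewrite Hs, Rabs_pos_eq; lra.
- rewrite sin_neg. 
  replace (Cmod z * - sin (acos (Re z / Cmod z))) with (- (Cmod z * sin (acos (Re z / Cmod z)))) by ring.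
  rewrite Hs, Rabs_left; lra.
Qed.

Lemma slit_Carg z : slit z -> - PI < Carg z < PI.
Proof.
intros Hz; assert (Hz0 := slit_neq_0 z Hz).
assert (Hb := Carg_bounds z Hz0); split; [lra|].
destruct (Req_dec (Carg z) PI) as [E|E]; [|lra].
exfalso; apply Hz; assert (P := polar_form z Hz0); rewrite E, cos_PI, sin_PI in P.
assert (Hm := Cmod_ge_0 z).
rewrite P; simpl; lra.
Qed.

Lemma Cexp_Clog z : z <> RtoC 0 -> Cexp (Clog z) = z.
Proof.
intros Hz; unfold Cexp, Clog; simpl.
rewrite exp_ln by (apply Cmod_gt_0, Hz); symmetry; apply polar_form, Hz.
Qed.

Lemma Cexp_plus z w : Cexp (Cplus z w) = Cmult (Cexp z) (Cexp w).
Proof.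
apply Ceq; destruct z as [x y], w as [u v]; simpl; rewrite exp_plus.
- rewrite cos_plus; ring.
- rewrite sin_plus; ring.
Qed.

Lemma Rabs_exp_minus_1 t : Rabs t <= 1 -> Rabs (exp t - 1) <= 3 * Rabs t.
Proof.
intros Ht; assert (H := MVT_abs exp exp 0 t).
destruct H as [c [Hc1 Hc2]]; [intros; apply derivable_pt_lim_exp|].
rewrite exp_0, Rminus_0_r in Hc1; rewrite Hc1.
apply Rmult_le_compat_r; [apply Rabs_pos|].
apply Rabs_le_between in Ht.
rewrite Rabs_pos_eq by (apply Rlt_le, exp_pos).
apply Rle_trans with (2 := exp_le_3).
assert (Hc : c <= 1) by (revert Hc2; unfold Rmin, Rmax; destruct (Rle_dec 0 t); lra).
destruct Hc as [Hc|Hc]; [left; apply exp_increasing, Hc|right; rewrite Hc; reflexivity].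
Qed.

Lemma Rabs_sin_le t : Rabs (sin t) <= Rabs t.
Proof.
destruct (MVT_abs sin cos 0 t) as [c [Hc _]]; [intros; apply derivable_pt_lim_sin|].
rewrite sin_0, !Rminus_0_r in Hc; rewrite Hc.
rewrite <- (Rmult_1_l (Rabs t)) at 2; apply Rmult_le_compat_r; [apply Rabs_pos|].
apply Rabs_le; assert (H := COS_bound c); lra.
Qed.

Lemma Rabs_cos_minus_1 t : Rabs (cos t - 1) <= Rabs t.
Proof.
destruct (MVT_abs cos (fun t => - sin t) 0 t) as [c [Hc _]]; [intros; apply derivable_pt_lim_cos|].
rewrite cos_0, !Rminus_0_r in Hc; rewrite Hc.
rewrite <- (Rmult_1_l (Rabs t)) at 2; apply Rmult_le_compat_r; [apply Rabs_pos|].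
apply Rabs_le; assert (H := SIN_bound c); lra.
Qed.

(** Applied to functions along the segment from 0 to a point: a first-order Taylor bound reduces to
    the variation of the derivative along that segment. *)
Lemma unit_interval_mvt (f df : R -> R) l K :
  (forall t, 0 <= t <= 1 -> is_derive f t (df t)) ->
  (forall t, 0 <= t <= 1 -> Rabs (df t - l) <= K) -> Rabs (f 1 - f 0 - l) <= K.
Proof.
intros Hd Hb.
destruct (MVT_gen f 0 1 df) as [c [Hc1 Hc2]].
- intros x Hx; rewrite Rmin_left, Rmax_right in Hx by lra; apply Hd; lra.
- intros x Hx; rewrite Rmin_left, Rmax_right in Hx by lra.
  apply continuity_pt_filterlim, (ex_derive_continuous (V := R_NormedModule)).
  exists (df x); apply Hd; lra.
- rewrite Rmin_left, Rmax_right in Hc1 by lra.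
  rewrite Hc2; replace (df c * (1 - 0) - l) with (df c - l) by ring; apply Hb, Hc1.
Qed.

(** Mean value estimate for each coordinate of t |-> exp(t z). With r = |z| the derivative departs
    from its value at 0 by at most r (4 r) + r (3 r), which gives 7 r^2 per coordinate. *)
Lemma Cexp_taylor z : Cmod z <= 1 ->
  Cmod (Cminus (Cminus (Cexp z) (RtoC 1)) z) <= 14 * (Cmod z * Cmod z).
Proof.
intros Hz; destruct z as [x y].
assert (Hx : Rabs x <= Cmod (x, y)) by exact (Rabs_Re_le (x, y)).
assert (Hy : Rabs y <= Cmod (x, y)) by exact (Rabs_Im_le (x, y)).
set (r := Cmod (x, y)) in *; assert (Hr : 0 <= r) by apply Cmod_ge_0.
assert (B : forall t, 0 <= t <= 1 -> 0 < exp (t * x) <= 3 /\ 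
   Rabs (exp (t * x) * cos (t * y) - 1) <= 4 * r /\ Rabs (exp (t * x) * sin (t * y)) <= 3 * r).
{ intros t Ht.
  assert (Htx : Rabs (t * x) <= r) by (rewrite Rabs_mult, (Rabs_pos_eq t) by lra; assert (H := Rabs_pos x); nra).
  assert (Hty : Rabs (t * y) <= r) by (rewrite Rabs_mult, (Rabs_pos_eq t) by lra; assert (H := Rabs_pos y); nra).
  assert (E1 := Rabs_exp_minus_1 (t * x) ltac:(lra)).
  assert (E2 : 0 < exp (t * x) <= 3).
  { split; [apply exp_pos|]. apply Rle_trans with (2 := exp_le_3).
    assert (H : t * x <= 1) by (apply Rabs_le_between in Htx; lra).
    destruct H as [H|H]; [left; apply exp_increasing, H|right; rewrite H; reflexivity]. }
  assert (E3 := Rabs_cos_minus_1 (t * y)); assert (E4 := Rabs_sin_le (t * y)).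
  assert (E5 : Rabs (cos (t * y)) <= 1) by (apply Rabs_le; assert (H := COS_bound (t * y)); lra).
  split; [exact E2|split].
  - replace (exp (t * x) * cos (t * y) - 1) with ((exp (t * x) - 1) * cos (t * y) + (cos (t * y) - 1)) by ring.
    apply Rle_trans with (1 := Rabs_triang _ _); rewrite Rabs_mult.
    assert (H := Rabs_pos (exp (t * x) - 1)); nra.
  - rewrite Rabs_mult, (Rabs_pos_eq (exp _)) by lra.
    assert (H := Rabs_pos (sin (t * y))); nra. }
assert (P1 : Rabs (exp (1 * x) * cos (1 * y) - exp (0 * x) * cos (0 * y) - x) <= 7 * (r * r)).
{ apply (unit_interval_mvt (fun t => exp (t * x) * cos (t * y))
     (fun t => x * (exp (t * x) * cos (t * y)) - y * (exp (t * x) * sin (t * y)))).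
  - intros t _; auto_derive; [auto|ring].
  - intros t Ht; destruct (B t Ht) as [_ [B1 B2]].
    replace (x * (exp (t * x) * cos (t * y)) - y * (exp (t * x) * sin (t * y)) - x)
      with (x * (exp (t * x) * cos (t * y) - 1) + - (y * (exp (t * x) * sin (t * y)))) by ring.
    apply Rle_trans with (1 := Rabs_triang _ _); rewrite Rabs_Ropp, !(Rabs_mult x), (Rabs_mult y).
    assert (A1 := Rmult_le_compat _ _ _ _ (Rabs_pos _) (Rabs_pos _) Hx B1).
    assert (A2 := Rmult_le_compat _ _ _ _ (Rabs_pos _) (Rabs_pos _) Hy B2); lra. }
assert (P2 : Rabs (exp (1 * x) * sin (1 * y) - exp (0 * x) * sin (0 * y) - y) <= 7 * (r * r)).
{ apply (unit_interval_mvt (fun t => exp (t * x) * sin (t * y))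
     (fun t => x * (exp (t * x) * sin (t * y)) + y * (exp (t * x) * cos (t * y)))).
  - intros t _; auto_derive; [auto|ring].
  - intros t Ht; destruct (B t Ht) as [_ [B1 B2]].
    replace (x * (exp (t * x) * sin (t * y)) + y * (exp (t * x) * cos (t * y)) - y)
      with (y * (exp (t * x) * cos (t * y) - 1) + x * (exp (t * x) * sin (t * y))) by ring.
    apply Rle_trans with (1 := Rabs_triang _ _); rewrite !(Rabs_mult x), (Rabs_mult y).
    assert (A1 := Rmult_le_compat _ _ _ _ (Rabs_pos _) (Rabs_pos _) Hy B1).
    assert (A2 := Rmult_le_compat _ _ _ _ (Rabs_pos _) (Rabs_pos _) Hx B2); lra. }
rewrite !Rmult_0_l, exp_0, cos_0, !Rmult_1_l in P1.
rewrite !Rmult_0_l, sin_0, Rmult_0_r, !Rmult_1_l, Rminus_0_r in P2.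
apply Rle_trans with (1 := Cmod_le_Rabs _); simpl.
replace (exp x * cos y + - (1) + - x) with (exp x * cos y - 1 - x) by ring.
replace (exp x * sin y + - 0 + - y) with (exp x * sin y - y) by ring.
lra.
Qed.

Lemma Cder_quadratic_norm {W : NormedModule C_AbsRing} (f : C -> W) z l d K : 0 < d -> 0 <= K ->
  (forall h : C, Cmod h < d -> norm (minus (minus (f (Cplus z h)) (f z)) (scal (h : C_AbsRing) l))
     <= K * (Cmod h * Cmod h)) ->
  Cder f z l.
Proof.
intros Hd HK H eps He.
destruct (small_factor eps K He HK) as [e [He1 He2]].
exists (Rmin d e); split; [apply Rmin_pos; assumption|]; intros h Hh.
assert (H1 := Rlt_le_trans _ _ _ Hh (Rmin_l _ _)).
assert (H2 := Rlt_le_trans _ _ _ Hh (Rmin_r _ _)).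
apply Rle_trans with (1 := H h H1).
assert (H3 := Cmod_ge_0 h).
assert (H4 : K * Cmod h <= eps) by nra.
rewrite <- Rmult_assoc; apply Rmult_le_compat_r; assumption.
Qed.

Lemma Cder_quadratic (f : C -> C) z l d K : 0 < d -> 0 <= K ->
  (forall h, Cmod h < d -> Cmod (Cminus (Cminus (f (Cplus z h)) (f z)) (Cmult h l)) <= K * (Cmod h * Cmod h)) ->
  Cder (W := C_NormedModule) f z l.
Proof. exact (Cder_quadratic_norm (W := C_NormedModule) f z l d K). Qed.

Lemma Cder_Cexp z : Cder (W := C_NormedModule) Cexp z (Cexp z).
Proof.
apply Cder_quadratic with 1 (Cmod (Cexp z) * 14); [lra|assert (H := Cmod_ge_0 (Cexp z)); lra|].
intros h Hh; rewrite Cexp_plus.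
replace (Cminus (Cminus (Cmult (Cexp z) (Cexp h)) (Cexp z)) (Cmult h (Cexp z)))
  with (Cmult (Cexp z) (Cminus (Cminus (Cexp h) (RtoC 1)) h)) by ring.
rewrite Cmod_mult, Rmult_assoc; apply Rmult_le_compat_l; [apply Cmod_ge_0|].
apply Cexp_taylor; lra.
Qed.

(** Real and imaginary part of log(1 + a + i b), the latter as [atan]. Along the segment from 0 to
    (a, b) the squared modulus of the argument stays above 1/4, the origin of the factor 4 contained
    in 16 and 12. *)
Lemma Clog1p_taylor a b :
  Cmod (a, b) <= 1 / 2 ->
  0 < 1 + a /\
  Rabs (ln ((1 + a) * (1 + a) + b * b) / 2 - a) <= 16 * (Cmod (a, b) * Cmod (a, b)) /\
  Rabs (atan (b / (1 + a)) - b) <= 12 * (Cmod (a, b) * Cmod (a, b)).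
Proof.
intros Hz.
assert (Ha : Rabs a <= Cmod (a, b)) by exact (Rabs_Re_le (a, b)).
assert (Hb : Rabs b <= Cmod (a, b)) by exact (Rabs_Im_le (a, b)).
assert (Hs : Cmod (a, b) * Cmod (a, b) = a * a + b * b) by exact (Cmod_sqr (a, b)).
set (r := Cmod (a, b)) in *; assert (Hr : 0 <= r) by apply Cmod_ge_0.
assert (Ha' := Ha); apply Rabs_le_between in Ha'.
assert (B : forall t, 0 <= t <= 1 -> 1 / 2 <= 1 + t * a /\
   1 / 4 <= (1 + t * a) * (1 + t * a) + t * b * (t * b) /\
   Rabs ((1 + t * a) * (1 + t * a) + t * b * (t * b) - 1) <= 3 * r).
{ intros t Ht; assert (H1 : 1 / 2 <= 1 + t * a) by nra.
  split; [exact H1|split].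
  - assert (H2 := Rle_0_sqr (t * b)); unfold Rsqr in H2; nra.
  - replace ((1 + t * a) * (1 + t * a) + t * b * (t * b) - 1)
      with (2 * (t * a) + t * t * (r * r)) by (rewrite Hs; ring).
    apply Rle_trans with (1 := Rabs_triang _ _).
    rewrite !Rabs_mult, !(Rabs_pos_eq t), (Rabs_pos_eq r), (Rabs_pos_eq 2) by lra.
    assert (H3 : t * Rabs a <= r) by (assert (H := Rabs_pos a); nra).
    assert (H4 : t * t * (r * r) <= 1 * (r * r)) by (apply Rmult_le_compat_r; nra).
    nra. }
split; [destruct (B 1) as [B1 _]; lra|split].
- replace (ln ((1 + a) * (1 + a) + b * b) / 2 - a) with
    (ln ((1 + 1 * a) * (1 + 1 * a) + 1 * b * (1 * b)) / 2
     - ln ((1 + 0 * a) * (1 + 0 * a) + 0 * b * (0 * b)) / 2 - a).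
  2: { replace ((1 + 0 * a) * (1 + 0 * a) + 0 * b * (0 * b)) with 1 by ring.
       rewrite ln_1, !Rmult_1_l; field. }
  apply (unit_interval_mvt (fun t => ln ((1 + t * a) * (1 + t * a) + t * b * (t * b)) / 2)
     (fun t => (a * (1 + t * a) + b * (t * b)) / ((1 + t * a) * (1 + t * a) + t * b * (t * b)))).
  + intros t Ht; destruct (B t Ht) as [_ [B1 _]]; auto_derive; [lra|field; lra].
  + intros t Ht; destruct (B t Ht) as [_ [B1 B2]].
    set (D := (1 + t * a) * (1 + t * a) + t * b * (t * b)) in *.
    replace ((a * (1 + t * a) + b * (t * b)) / D - a)
      with ((t * (r * r) - a * (D - 1)) / D) by (rewrite Hs; field; lra).
    unfold Rdiv; rewrite Rabs_mult, (Rabs_pos_eq (/ D)) by (apply Rlt_le, Rinv_0_lt_compat; lra).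
    replace (16 * (r * r)) with (4 * (r * r) * 4) by ring.
    apply Rmult_le_compat; [apply Rabs_pos|apply Rlt_le, Rinv_0_lt_compat; lra| |].
    * unfold Rminus at 1; apply Rle_trans with (1 := Rabs_triang _ _).
      rewrite Rabs_Ropp, !Rabs_mult, (Rabs_pos_eq t), (Rabs_pos_eq r) by lra.
      assert (A := Rmult_le_compat _ _ _ _ (Rabs_pos _) (Rabs_pos _) Ha B2). nra.
    * replace 4 with (/ (1 / 4)) by field; apply Rinv_le_contravar; lra.
- replace (atan (b / (1 + a)) - b) with
    (atan (1 * b / (1 + 1 * a)) - atan (0 * b / (1 + 0 * a)) - b).
  2: { replace (0 * b / (1 + 0 * a)) with 0 by field. rewrite atan_0, !Rmult_1_l; ring. }
  apply (unit_interval_mvt (fun t => atan (t * b / (1 + t * a)))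
     (fun t => b / ((1 + t * a) * (1 + t * a) + t * b * (t * b)))).
  + intros t Ht; destruct (B t Ht) as [B0 [B1 _]]; auto_derive; [lra|].
    field; split; [|lra]; unfold Rsqr in *; nra.
  + intros t Ht; destruct (B t Ht) as [_ [B1 B2]].
    set (D := (1 + t * a) * (1 + t * a) + t * b * (t * b)) in *.
    replace (b / D - b) with (- (b * (D - 1)) / D) by (field; lra).
    unfold Rdiv; rewrite Rabs_mult, (Rabs_pos_eq (/ D)) by (apply Rlt_le, Rinv_0_lt_compat; lra).
    replace (12 * (r * r)) with (3 * (r * r) * 4) by ring.
    apply Rmult_le_compat; [apply Rabs_pos|apply Rlt_le, Rinv_0_lt_compat; lra| |].
    * rewrite Rabs_Ropp, !Rabs_mult.
      assert (A := Rmult_le_compat _ _ _ _ (Rabs_pos _) (Rabs_pos _) Hb B2); lra.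
    * replace 4 with (/ (1 / 4)) by field; apply Rinv_le_contravar; lra.
Qed.

Lemma polar_form_right_half p q : 0 < p ->
  (p, q) = (Cmod (p, q) * cos (atan (q / p)), Cmod (p, q) * sin (atan (q / p))).
Proof.
intros Hp.
set (phi := atan (q / p)).
assert (Hb := atan_bound (q / p)); fold phi in Hb.
assert (Hc : 0 < cos phi) by (apply cos_gt_0; lra).
assert (Ht : sin phi = q / p * cos phi).
{ replace (q / p) with (tan phi) by (apply atan_right_inv); unfold tan; field; lra. }
assert (H1 := sin2_cos2 phi); unfold Rsqr in H1.
assert (Hm := Cmod_sqr (p, q)); simpl in Hm.
assert (Hm0 := Cmod_ge_0 (p, q)).
assert (E : p = Cmod (p, q) * cos phi).
{ apply Rsqr_inj; [lra|apply Rmult_le_pos; lra|]; unfold Rsqr.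
  replace (Cmod (p, q) * cos phi * (Cmod (p, q) * cos phi))
    with (Cmod (p, q) * Cmod (p, q) * (cos phi * cos phi)) by ring.
  rewrite Hm; rewrite Ht in H1.
  transitivity (p * p * (q / p * cos phi * (q / p * cos phi) + cos phi * cos phi));
    [rewrite H1; ring|field; lra]. }
apply Ceq; simpl; [exact E|].
rewrite Ht; replace (Cmod (p, q) * (q / p * cos phi)) with (q / p * (Cmod (p, q) * cos phi)) by ring.
rewrite <- E; field; lra.
Qed.

Lemma Carg_mult_right_half z p q :
  z <> RtoC 0 -> 0 < p -> - PI < Carg z + atan (q / p) <= PI ->
  Carg (Cmult z (p, q)) = Carg z + atan (q / p).
Proof.
intros Hz Hp H.
assert (Hm : 0 < Cmod z) by (apply Cmod_gt_0, Hz).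
assert (Hw : 0 < Cmod (p, q)).
{ apply Cmod_gt_0; intros E; apply (f_equal Re) in E; simpl in E; lra. }
rewrite (polar_form z Hz) at 1; rewrite (polar_form_right_half p q Hp) at 1.
rewrite <- (Carg_polar (Cmod z * Cmod (p, q)) (Carg z + atan (q / p)));
  [|apply Rmult_lt_0_compat; assumption|exact H].
f_equal; apply Ceq; simpl; [rewrite cos_plus|rewrite sin_plus]; ring.
Qed.

(** log(z + h) = log z + log(1 + h/z) as long as the argument of 1 + h/z is smaller than the
    distance [gap] from the argument of [z] to the ends of the principal range. *)
Lemma Cder_Clog z : slit z -> Cder (W := C_NormedModule) Clog z (Cinv z).
Proof.
intros Hz; assert (Hz0 := slit_neq_0 z Hz).
assert (Hm : 0 < Cmod z) by (apply Cmod_gt_0, Hz0).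
assert (Ha := slit_Carg z Hz).
set (gap := Rmin (PI - Carg z) (Carg z + PI)).
assert (Hgap : 0 < gap) by (apply Rmin_pos; lra).
assert (Hg1 : gap <= PI - Carg z) by apply Rmin_l.
assert (Hg2 : gap <= Carg z + PI) by apply Rmin_r.
(* With w = h/z and |w| < 1/2, the argument of 1 + w is at most 12 |w|^2 + |w| <= 7 |w|, hence below
   [gap]. The constant 28 is 16 + 12, the sum of the errors of the two coordinates. *)
apply Cder_quadratic with (Cmod z * Rmin (1 / 2) (gap / 7)) (28 * (/ Cmod z * / Cmod z)).
- apply Rmult_lt_0_compat; [exact Hm|apply Rmin_pos; lra].
- assert (H := Rinv_0_lt_compat _ Hm); nra.
- intros h Hh.
  set (w := Cdiv h z).
  assert (Hw : Cmod w = Cmod h * / Cmod z) by (unfold w; rewrite Cmod_div by exact Hz0; reflexivity).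
  assert (Hw1 : Cmod w < Rmin (1 / 2) (gap / 7)).
  { rewrite Hw; apply Rmult_lt_reg_r with (Cmod z); [exact Hm|].
    rewrite Rmult_assoc, Rinv_l by lra; lra. }
  assert (Hw2 := Rlt_le_trans _ _ _ Hw1 (Rmin_l _ _)).
  assert (Hw3 := Rlt_le_trans _ _ _ Hw1 (Rmin_r _ _)).
  replace (Cplus z h) with (Cmult z (Cplus (RtoC 1) w)) by (unfold w; field; exact Hz0).
  replace (Cmult h (Cinv z)) with w by reflexivity.
  replace (28 * (/ Cmod z * / Cmod z) * (Cmod h * Cmod h)) with (28 * (Cmod w * Cmod w))
    by (rewrite Hw; ring).
  clearbody w; destruct w as [a b].
  destruct (Clog1p_taylor a b) as [T0 [T1 T2]]; [lra|].
  replace (Cplus (RtoC 1) (a, b)) with ((1 + a, b) : C) by (apply Ceq; simpl; ring).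
  assert (Hr := Cmod_ge_0 (a, b)).
  assert (Hb : Rabs b <= Cmod (a, b)) by exact (Rabs_Im_le (a, b)).
  assert (Hphi : Rabs (atan (b / (1 + a))) < gap).
  { replace (atan (b / (1 + a))) with (atan (b / (1 + a)) - b + b) by ring.
    apply Rle_lt_trans with (1 := Rabs_triang _ _); nra. }
  apply Rabs_def2 in Hphi.
  assert (HA := Carg_mult_right_half z (1 + a) b Hz0 T0 ltac:(lra)).
  assert (Hw0 : 0 < Cmod (1 + a, b)).
  { apply Cmod_gt_0; intros E; apply (f_equal Re) in E; simpl in E; lra. }
  assert (HL : ln (Cmod (1 + a, b)) = ln ((1 + a) * (1 + a) + b * b) / 2).
  { assert (S := Cmod_sqr (1 + a, b)); simpl in S; rewrite <- S, ln_mult by exact Hw0; field. }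
  unfold Clog; rewrite HA, Cmod_mult, ln_mult, HL by assumption.
  apply Rle_trans with (1 := Cmod_le_Rabs _); simpl.
  replace (ln (Cmod z) + ln ((1 + a) * (1 + a) + b * b) / 2 + - ln (Cmod z) + - a)
    with (ln ((1 + a) * (1 + a) + b * b) / 2 - a) by ring.
  replace (Carg z + atan (b / (1 + a)) + - Carg z + - b) with (atan (b / (1 + a)) - b) by ring.
  lra.
Qed.

Lemma Crpower_Cexp z a : Crpower z a = Cexp (Cmult (RtoC a) (Clog z)).
Proof.
unfold Crpower, Cexp, Clog, Rpower; apply Ceq; simpl;
  rewrite !Rmult_0_l, ?Rminus_0_r, ?Rplus_0_r; reflexivity.
Qed.

Lemma Crpower_plus z a b : Crpower z (a + b) = Cmult (Crpower z a) (Crpower z b).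
Proof. rewrite !Crpower_Cexp, <- Cexp_plus, RtoC_plus; f_equal; ring. Qed.

Lemma Crpower_1 z : z <> RtoC 0 -> Crpower z 1 = z.
Proof. intros Hz; rewrite Crpower_Cexp, Cmult_1_l; apply Cexp_Clog, Hz. Qed.

Lemma Cmod_Cexp z : Cmod (Cexp z) = exp (Re z).
Proof. apply Cmod_polar, Rlt_le, exp_pos. Qed.

Lemma Cmod_Crpower z a : Cmod (Crpower z a) = Rpower (Cmod z) a.
Proof.
rewrite Crpower_Cexp, Cmod_Cexp; unfold Clog, Rpower; simpl; f_equal; ring.
Qed.

Lemma Crpower_pred z a : z <> RtoC 0 -> Crpower z (a - 1) = Cdiv (Crpower z a) z.
Proof.
intros Hz; replace a with (a - 1 + 1) at 2 by ring.
rewrite Crpower_plus, Crpower_1 by exact Hz; field; exact Hz.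
Qed.

Lemma Cder_Crpower z a : slit z ->
  Cder (W := C_NormedModule) (fun z => Crpower z a) z (Cmult (RtoC a) (Crpower z (a - 1))).
Proof.
intros Hz; assert (Hz0 := slit_neq_0 z Hz).
apply Cder_ext with (fun z => Cexp (Cmult (RtoC a) (Clog z))); [intros; symmetry; apply Crpower_Cexp|].
assert (L : is_linear (U := C_NormedModule) (V := C_NormedModule) (fun x => scal (RtoC a : C_AbsRing) x)).
{ exact (is_linear_scal_r (K := C_AbsRing) (V := C_NormedModule) (RtoC a) Cmult_comm). }
assert (D1 : Cder (W := C_NormedModule) (fun z => Cmult (RtoC a) (Clog z)) z
               (Cmult (RtoC a) (Cinv z))) by exact (Cder_linear _ L _ _ _ (Cder_Clog z Hz)).
refine (Cder_eq _ _ _ _ _ (Cder_comp Cexp _ _ _ _ D1 (Cder_Cexp _))).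
rewrite <- Crpower_Cexp, Crpower_pred by exact Hz0.
change (Cmult (Cmult (RtoC a) (Cinv z)) (Crpower z a) = Cmult (RtoC a) (Cdiv (Crpower z a) z)).
field; exact Hz0.
Qed.

(** * Limits at infinity and existence of the contour integrals *)

Definition polar (rho theta : R) : C := (rho * cos theta, rho * sin theta).

Lemma Rpower_neg_small beta K eps : 0 < beta -> 0 <= K -> 0 < eps ->
  exists B, 1 <= B /\ forall x, B <= x -> K * Rpower x (- beta) < eps.
Proof.
intros Hb HK He.
set (y := K / eps + 1).
assert (Hy : 1 <= y) by (unfold y; assert (H : 0 <= K / eps) by (apply Rdiv_le_0_compat; lra); lra).
exists (Rpower y (/ beta)); split.
- rewrite <- (Rpower_O y) by lra; apply Rle_Rpower; [exact Hy|apply Rlt_le, Rinv_0_lt_compat, Hb].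
- intros x Hx.
  assert (Hp : 0 < Rpower y (/ beta)) by apply exp_pos.
  assert (H : y <= Rpower x beta).
  { rewrite <- (Rpower_1 y) by lra; rewrite <- (Rinv_l beta), <- Rpower_mult by lra.
    apply Rle_Rpower_l; lra. }
  rewrite Rpower_Ropp.
  apply Rmult_lt_reg_r with (Rpower x beta); [lra|].
  rewrite Rmult_assoc, Rinv_l by lra.
  assert (K < eps * y).
  { unfold y; replace (eps * (K / eps + 1)) with (K + eps) by (field; lra); lra. }
  assert (eps * y <= eps * Rpower x beta) by (apply Rmult_le_compat_l; lra); lra.
Qed.

Lemma polar_is_derive_rho theta t :
  is_derive (K := R_AbsRing) (V := C_R_NormedModule) (fun t => polar t theta) t (polar 1 theta).
Proof.
apply is_derive_eps; intros eps He; exists 1; split; [lra|]; intros h _.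
rewrite Cnorm_Cmod.
apply Rle_trans with (Cmod (RtoC 0)).
- right; f_equal; rewrite scal_R_Cmult.
  change (Cminus (Cminus (polar (t + h) theta) (polar t theta)) (h * polar 1 theta) = RtoC 0)%C.
  apply Ceq; simpl; ring.
- rewrite Cmod_0; apply Rmult_le_pos; [lra|apply Rabs_pos].
Qed.

Lemma is_derive_Cpair (x y : R -> R) t lx ly :
  is_derive x t lx -> is_derive y t ly ->
  is_derive (K := R_AbsRing) (V := C_R_NormedModule) (fun t => (x t, y t)) t (lx, ly).
Proof.
intros Hx Hy.
apply is_derive_eps; intros eps He.
assert (He2 : 0 < eps / 2) by lra.
destruct (proj1 (is_derive_eps (V := R_NormedModule) _ _ _) Hx _ He2) as [d1 [Hd1 H1]].
destruct (proj1 (is_derive_eps (V := R_NormedModule) _ _ _) Hy _ He2) as [d2 [Hd2 H2]].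
exists (Rmin d1 d2); split; [apply Rmin_pos; assumption|]; intros h Hh.
assert (A1 := H1 h (Rlt_le_trans _ _ _ Hh (Rmin_l _ _))).
assert (A2 := H2 h (Rlt_le_trans _ _ _ Hh (Rmin_r _ _))).
rewrite Cnorm_Cmod; apply Rle_trans with (1 := Cmod_le_Rabs _).
replace (eps * Rabs h) with (eps / 2 * Rabs h + eps / 2 * Rabs h) by field.
apply Rplus_le_compat; [exact A1|exact A2].
Qed.

Lemma polar_is_derive_theta rho t :
  is_derive (K := R_AbsRing) (V := C_R_NormedModule) (polar rho) t (polar rho (t + PI / 2)).
Proof.
unfold polar; rewrite cos_plus, sin_plus, cos_PI2, sin_PI2.
apply is_derive_Cpair; auto_derive; auto; ring.
Qed.

Lemma continuous_Cpair (x y : R -> R) t :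
  continuous x t -> continuous y t -> continuous (fun t => (x t, y t) : C) t.
Proof.
intros Hx Hy P [d Hd].
assert (H1 := Hx _ (locally_ball (x t) d)); assert (H2 := Hy _ (locally_ball (y t) d)).
refine (filter_imp _ _ _ (filter_and (fun u => ball (x t) d (x u)) (fun u => ball (y t) d (y u)) H1 H2)).
intros u [Hu1 Hu2]; apply Hd; exact (conj Hu1 Hu2).
Qed.

Section LimitsAtInfinity.

Variable W : NormedModule C_AbsRing.
Variable cW : CompleteSpace.mixin_of W.

Variables (F f : C -> W) (Theta : R -> Prop) (rho0 beta K : R).
Hypothesis Hrho0 : 0 < rho0.
Hypothesis Hbeta : 0 < beta.
Hypothesis Theta_convex : forall a b c, Theta a -> Theta b -> a <= c <= b -> Theta c.
Hypothesis Theta_bounded : forall a, Theta a -> Rabs a <= 4.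
Hypothesis HF : forall rho theta, rho0 <= rho -> Theta theta ->
  Cder F (polar rho theta) (f (polar rho theta)) /\ Ccont f (polar rho theta) /\
  norm (f (polar rho theta)) <= K * Rpower rho (- beta - 1).

(** The integral of K t^(-beta-1) from r1 to r2 is K/beta (r1^(-beta) - r2^(-beta)). *)
Lemma radial_increment_le r1 r2 theta :
  rho0 <= r1 -> r1 <= r2 -> Theta theta ->
  norm (minus (F (polar r2 theta)) (F (polar r1 theta))) <= K / beta * Rpower r1 (- beta).
Proof.
intros H1 H2 Ht.
assert (HK : 0 <= K).
{ destruct (HF r1 theta H1 Ht) as [_ [_ A]].
  assert (B := norm_ge_0 (f (polar r1 theta))).
  assert (P : 0 < Rpower r1 (- beta - 1)) by apply exp_pos.
  apply Rmult_le_reg_r with (1 := P); lra. }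
apply Rle_trans with (- K / beta * Rpower r2 (- beta) - - K / beta * Rpower r1 (- beta)).
- apply (curve_increment_le W cW F f (fun t => polar t theta) (fun _ => polar 1 theta)
     (fun t => K * Rpower t (- beta - 1)) r1 r2); [exact H2| | |].
  + intros t Ht'; destruct (HF t theta) as [A1 [A2 _]]; [lra|exact Ht|].
    split; [apply polar_is_derive_rho|split; [apply continuous_const|auto]].
  + intros t Ht'; unfold polar at 1; rewrite Cmod_polar, Rmult_1_l by lra.
    apply HF; [lra|exact Ht].
  + apply (is_RInt_derive (V := R_CompleteNormedModule) (fun t => - K / beta * Rpower t (- beta)) (fun t => K * Rpower t (- beta - 1)));
      intros t Ht'; rewrite Rmin_left, Rmax_right in Ht' by lra.
    * assert (E : Rpower t (- beta - 1) = Rpower t (- beta) * / t).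
      { unfold Rminus; rewrite Rpower_plus, (Rpower_Ropp t 1), Rpower_1 by lra; reflexivity. }
      rewrite E; unfold Rpower; auto_derive; [lra|field; split; lra].
    * apply (ex_derive_continuous (V := R_NormedModule)); unfold Rpower; auto_derive; lra.
- assert (0 <= K / beta * Rpower r2 (- beta)).
  { apply Rmult_le_pos; [apply Rdiv_le_0_compat; lra|apply Rlt_le, exp_pos]. }
  unfold Rdiv in *; lra.
Qed.

Lemma arc_increment_le r a b :
  rho0 <= r -> a <= b -> Theta a -> Theta b ->
  norm (minus (F (polar r b)) (F (polar r a))) <= (b - a) * (K * Rpower r (- beta)).
Proof.
intros Hr Hab Ha Hb.
apply (curve_increment_le W cW F f (polar r) (fun t => polar r (t + PI / 2))
   (fun t => K * Rpower r (- beta)) a b); [exact Hab| | |].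
- intros t Ht; destruct (HF r t Hr (Theta_convex a b t Ha Hb Ht)) as [A1 [A2 _]].
  split; [apply polar_is_derive_theta|split; [|auto]].
  apply continuous_Cpair; apply (ex_derive_continuous (V := R_NormedModule)); auto_derive; auto.
- intros t Ht; destruct (HF r t Hr (Theta_convex a b t Ha Hb Ht)) as [_ [_ A]].
  unfold polar at 1; rewrite Cmod_polar by lra.
  apply Rle_trans with (r * (K * Rpower r (- beta - 1))); [apply Rmult_le_compat_l; lra|].
  right; replace (- beta) with (- beta - 1 + 1) at 2 by ring.
  rewrite Rpower_plus, Rpower_1 by lra; ring.
- exact (is_RInt_const (V := R_NormedModule) a b (K * Rpower r (- beta))).
Qed.

(** Path along the ray of angle [a], then along the arc of radius [r2]. Angles bounded by 4 differ
    by at most 8, whence the constant. *)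
Lemma polar_increment_le r1 r2 a b :
  rho0 <= r1 -> r1 <= r2 -> Theta a -> Theta b ->
  norm (minus (F (polar r2 b)) (F (polar r1 a))) <= K * (/ beta + 8) * Rpower r1 (- beta).
Proof.
intros H1 H2 Ha Hb.
assert (R1 := radial_increment_le r1 r2 a H1 H2 Ha).
assert (HK : 0 <= K).
{ destruct (HF r1 a H1 Ha) as [_ [_ A]].
  assert (B := norm_ge_0 (f (polar r1 a))).
  assert (P : 0 < Rpower r1 (- beta - 1)) by apply exp_pos.
  apply Rmult_le_reg_r with (1 := P); lra. }
assert (P2 : Rpower r2 (- beta) <= Rpower r1 (- beta)).
{ rewrite !Rpower_Ropp; apply Rinv_le_contravar; [apply exp_pos|].
  apply Rle_Rpower_l; lra. }
assert (P0 : 0 < Rpower r2 (- beta)) by apply exp_pos.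
assert (Ba := Theta_bounded a Ha); assert (Bb := Theta_bounded b Hb).
apply Rabs_le_between in Ba; apply Rabs_le_between in Bb.
assert (R2 : norm (minus (F (polar r2 b)) (F (polar r2 a))) <= 8 * (K * Rpower r1 (- beta))).
{ apply Rle_trans with (8 * (K * Rpower r2 (- beta))).
  - destruct (Rle_dec a b) as [Hab|Hab].
    + apply Rle_trans with (1 := arc_increment_le r2 a b ltac:(lra) Hab Ha Hb).
      apply Rmult_le_compat_r; [apply Rmult_le_pos; lra|lra].
    + rewrite norm_minus_sym.
      apply Rle_trans with (1 := arc_increment_le r2 b a ltac:(lra) ltac:(lra) Hb Ha).
      apply Rmult_le_compat_r; [apply Rmult_le_pos; lra|lra].
  - apply Rmult_le_compat_l; [lra|]; apply Rmult_le_compat_l; lra. }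
apply (norm_le_eq (plus (minus (F (polar r2 b)) (F (polar r2 a)))
                        (minus (F (polar r2 a)) (F (polar r1 a))))); [module_ring W|].
replace (K * (/ beta + 8) * Rpower r1 (- beta)) with
  (8 * (K * Rpower r1 (- beta)) + K / beta * Rpower r1 (- beta)) by (unfold Rdiv; ring).
apply norm_plus_compat; assumption.
Qed.

(** The Cauchy criterion along one ray produces the limit, and [polar_increment_le] spreads the rate
    to all angles. The set of angles is a parameter: it will be a closed-ended sector for contours
    and an open half-plane for the residue. *)
Lemma limit_at_infinity :
  exists L, forall rho theta, rho0 <= rho -> Theta theta ->
    norm (minus (F (polar rho theta)) L) <= K * (/ beta + 8) * Rpower rho (- beta).
Proof.
destruct (excluded_middle_informative (exists a, Theta a)) as [[a Ha]|Hn].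
2: { exists zero; intros rho theta _ Ht; exfalso; eauto. }
assert (HK : 0 <= K * (/ beta + 8)).
{ destruct (HF rho0 a (Rle_refl _) Ha) as [_ [_ A]].
  assert (B := norm_ge_0 (f (polar rho0 a))).
  assert (P : 0 < Rpower rho0 (- beta - 1)) by apply exp_pos.
  assert (0 <= K) by (apply Rmult_le_reg_r with (1 := P); lra).
  assert (Q := Rinv_0_lt_compat _ Hbeta); nra. }
destruct (proj1 (filterlim_locally_cauchy
  (U := CompleteNormedModule.CompleteSpace _ (real_CompleteNormedModule W cW))
  (F := Rbar_locally p_infty) (fun rho => F (polar rho a)))) as [L HL].
{ intros eps.
  destruct (Rpower_neg_small beta (K * (/ beta + 8)) eps Hbeta HK (cond_pos eps)) as [B [HB1 HB]].
  exists (fun rho => rho0 <= rho /\ B <= rho); split.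
  - exists (Rmax rho0 B); intros x Hx; split; apply Rlt_le, Rle_lt_trans with (2 := Hx);
      [apply Rmax_l|apply Rmax_r].
  - intros u v [Hu1 Hu2] [Hv1 Hv2]; apply (norm_compat1 (V := W)).
    destruct (Rle_dec u v) as [Huv|Huv].
    + apply Rle_lt_trans with (1 := polar_increment_le u v a a Hu1 Huv Ha Ha), HB, Hu2.
    + rewrite norm_minus_sym.
      apply Rle_lt_trans with (1 := polar_increment_le v u a a Hv1 ltac:(lra) Ha Ha), HB, Hv2. }
exists L; intros rho theta Hr Ht.
apply le_epsilon; intros eps He.
assert (HL' := proj1 (filterlim_norm_lt (V := W) (Rbar_locally p_infty) _ L) HL eps He).
assert (HL2 : Rbar_locally p_infty (fun x => rho <= x)) by (exists rho; intros; lra).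
destruct (filter_ex _ (filter_and _ _ HL' HL2)) as [x [Hx1 Hx2]].
apply (norm_le_eq (minus (minus (F (polar x a)) L) (minus (F (polar x a)) (F (polar rho theta)))));
  [module_ring W|].
rewrite Rplus_comm; apply norm_minus_compat; [apply Rlt_le, Hx1|].
apply polar_increment_le; assumption.
Qed.

End LimitsAtInfinity.

Lemma Ccont_filterlim {W : NormedModule C_AbsRing} (f : C -> W) z :
  Ccont f z <-> filterlim f (locally (z : C_UniformSpace)) (locally (f z)).
Proof.
split.
- intros H; apply (filterlim_norm_lt (locally (z : C_UniformSpace))); intros eps He.
  destruct (H eps He) as [d [Hd Hf]].
  apply (locally_of_norm (V := C_NormedModule)); exists d; split; [exact Hd|exact Hf].
- intros H eps He.
  assert (H1 := proj1 (filterlim_norm_lt (locally (z : C_UniformSpace)) f (f z)) H eps He).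
  apply (locally_of_norm (V := C_NormedModule)) in H1.
  destruct H1 as [d [Hd Hf]]; exists d; split; [exact Hd|exact Hf].
Qed.

Lemma Ccont_plus {W : NormedModule C_AbsRing} (f g : C -> W) z :
  Ccont f z -> Ccont g z -> Ccont (fun z => plus (f z) (g z)) z.
Proof.
intros Hf Hg; apply Ccont_filterlim; apply Ccont_filterlim in Hf; apply Ccont_filterlim in Hg.
exact (filterlim_comp_2 f g plus Hf Hg (filterlim_plus (f z) (g z))).
Qed.

Lemma Ccont_scal {W : NormedModule C_AbsRing} (a : C -> C) (f : C -> W) z :
  Ccont (W := C_NormedModule) a z -> Ccont f z ->
  Ccont (fun z => scal (a z : C_AbsRing) (f z)) z.
Proof.
intros Ha Hf; apply Ccont_filterlim; apply Ccont_filterlim in Ha; apply Ccont_filterlim in Hf.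
exact (filterlim_Cscal _ a f _ _ Ha Hf).
Qed.

Lemma Cder_opp_id z : Cder (W := C_NormedModule) Copp z (Copp (RtoC 1)).
Proof. apply Cder_affine; intros h; ring. Qed.

Lemma Cder_Crpower_opp z a : slit (Copp z) ->
  Cder (W := C_NormedModule) (fun z => Crpower (Copp z) a) z
    (Cmult (RtoC (- a)) (Crpower (Copp z) (a - 1))).
Proof.
intros Hz.
refine (Cder_eq _ _ _ _ _ (Cder_comp (fun z => Crpower z a) Copp z _ _ (Cder_opp_id z) (Cder_Crpower _ a Hz))).
rewrite RtoC_opp.
change (Cmult (Copp (RtoC 1)) (Cmult (RtoC a) (Crpower (Copp z) (a - 1))) =
        Cmult (Copp (RtoC a)) (Crpower (Copp z) (a - 1))); ring.
Qed.

(** * The region containing the admissible contours *)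

Definition Omega (M : R) (z : C) : Prop :=
  exists s, 0 <= s /\ Cmod (Cminus z (RtoC s)) * M < 2 / 3 * (1 + s).

Definition cut_region (M : R) (z : C) : Prop := Omega M z /\ slit (Copp z).

(** A point of the negative axis, so that segments issued from it avoid the cut; its modulus times
    [M] is 1/2 < 2/3, which puts it in the disc of [Omega] with s = 0. *)
Definition center (M : R) : C := RtoC (- (1 / (2 * M))).

Section Regions.

Variable M : R.
Hypothesis HM : 1 <= M.

Lemma Omega_open z : Omega M z ->
  exists d, 0 < d /\ forall z', Cmod (Cminus z' z) < d -> Omega M z'.
Proof.
intros [s [Hs H]].
set (e := 2 / 3 * (1 + s) - Cmod (Cminus z (RtoC s)) * M).
exists (e / M); split; [apply Rdiv_lt_0_compat; unfold e; lra|].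
intros z' Hz'; exists s; split; [exact Hs|].
assert (H1 : Cmod (Cminus z' z) * M < e).
{ apply Rlt_div_r in Hz'; lra. }
replace (Cminus z' (RtoC s)) with (Cplus (Cminus z' z) (Cminus z (RtoC s))) by ring.
apply Rle_lt_trans with ((Cmod (Cminus z' z) + Cmod (Cminus z (RtoC s))) * M).
- apply Rmult_le_compat_r; [lra|apply Cmod_triangle].
- unfold e in H1; lra.
Qed.

Lemma slit_open z : slit z -> exists d, 0 < d /\ forall z', Cmod (Cminus z' z) < d -> slit z'.
Proof.
intros Hz; destruct (Req_dec (Im z) 0) as [E|E].
- assert (HR : 0 < Re z) by (destruct (Rle_lt_dec (Re z) 0); [exfalso; apply Hz; auto|assumption]).
  exists (Re z); split; [exact HR|]; intros z' H [_ H'].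
  assert (A := Rabs_Re_le (Cminus z' z)); apply Rabs_le_between in A.
  simpl in A; unfold Re in *; lra.
- exists (Rabs (Im z)); split; [apply Rabs_pos_lt, E|]; intros z' H [H' _].
  assert (A := Rabs_Im_le (Cminus z' z)); simpl in A.
  unfold Im in *; rewrite H' in A.
  replace (0 + - snd z) with (- snd z) in A by ring; rewrite Rabs_Ropp in A; lra.
Qed.

Lemma cut_region_open z : cut_region M z ->
  exists d, 0 < d /\ forall z', Cmod (Cminus z' z) < d -> cut_region M z'.
Proof.
intros [H1 H2]; destruct (Omega_open z H1) as [d1 [Hd1 A1]], (slit_open _ H2) as [d2 [Hd2 A2]].
exists (Rmin d1 d2); split; [apply Rmin_pos; assumption|]; intros z' Hz'; split.
- apply A1, (Rlt_le_trans _ _ _ Hz'), Rmin_l.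
- apply A2; replace (Cminus (Copp z') (Copp z)) with (Copp (Cminus z' z)) by ring.
  rewrite Cmod_opp; apply (Rlt_le_trans _ _ _ Hz'), Rmin_r.
Qed.

Lemma cut_region_star z t : cut_region M z -> 0 <= t <= 1 -> cut_region M (segment (center M) z t).
Proof.
intros [[s [Hs H1]] H2] Ht.
assert (Hi : 0 < 1 / (2 * M)) by (apply Rdiv_lt_0_compat; lra).
split.
(* The centres are interpolated like the points. The bound interpolates between 1/2 at the star
   centre and the one at [z], and 1/2 is less than 2/3. *)
- exists (t * s); split; [nra|].
  replace (Cminus (segment (center M) z t) (RtoC (t * s))) with
    (Cplus (Cmult (RtoC (1 - t)) (center M)) (Cmult (RtoC t) (Cminus z (RtoC s))))
    by (unfold segment; rewrite RtoC_minus, RtoC_mult; ring).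
  apply Rle_lt_trans with (((1 - t) * (1 / (2 * M)) + t * Cmod (Cminus z (RtoC s))) * M).
  + apply Rmult_le_compat_r; [lra|].
    apply Rle_trans with (1 := Cmod_triangle _ _).
    rewrite !Cmod_mult, !Cmod_R, (Rabs_pos_eq (1 - t)), (Rabs_pos_eq t) by lra.
    unfold center; rewrite Cmod_R, Rabs_Ropp, (Rabs_pos_eq (1 / (2 * M))); lra.
  + replace (((1 - t) * (1 / (2 * M)) + t * Cmod (Cminus z (RtoC s))) * M)
      with ((1 - t) * (1 / 2) + t * (Cmod (Cminus z (RtoC s)) * M)) by (field; lra).
    assert (H3 : t * (Cmod (Cminus z (RtoC s)) * M) <= t * (2 / 3 * (1 + s))) by (apply Rmult_le_compat_l; lra).
    destruct (Rle_lt_dec 1 t); [|lra].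
    assert (t = 1) by lra; subst t; lra.
(* A point of the segment on the half-line [0, oo) is not the star centre, which is negative; so [z]
   is real as well and nonnegative. *)
- intros [A1 A2]; apply H2; revert A1 A2; unfold segment, center; destruct z as [x y]; simpl.
  intros A1 A2.
  assert (A3 : t * y = 0) by lra.
  assert (A4 : (1 - t) * (1 / (2 * M)) <= t * x) by lra.
  assert (A5 : t <> 0) by (intros E; rewrite E in A4; lra).
  split; [nra|].
  assert (0 <= t * x) by (apply Rle_trans with (2 := A4); apply Rmult_le_pos; lra).
  nra.
Qed.

Definition aperture : R := asin (1 / (2 * M)).

Lemma inv_2M_bounds : 0 < 1 / (2 * M) <= 1 / 2.
Proof.
split; [apply Rdiv_lt_0_compat; lra|].
unfold Rdiv; rewrite !Rmult_1_l; apply Rinv_le_contravar; lra.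
Qed.

Lemma aperture_bounds : 0 < aperture < PI / 2.
Proof.
assert (H := inv_2M_bounds); split.
- rewrite <- asin_0; unfold aperture.
  destruct (Rlt_le_dec (asin 0) (asin (1 / (2 * M)))) as [A|A]; [exact A|].
  exfalso; assert (B0 := asin_bound 0); assert (B1 := asin_bound (1 / (2 * M))).
  assert (C1 := sin_incr_1 _ _ (proj1 B1) (proj2 B1) (proj1 B0) (proj2 B0) A).
  rewrite !sin_asin in C1; lra.
- unfold aperture; destruct (asin_bound (1 / (2 * M))) as [_ [B|B]]; [exact B|].
  exfalso; assert (S := sin_asin (1 / (2 * M)) ltac:(lra)); rewrite B, sin_PI2 in S; lra.
Qed.

(** The sine is at most 1/2, so the cosine is at least sqrt(3)/2. The bound 3/4 is chosen to fit the
    constant of [Omega]: 2/3 * 3/4 = 1/2. *)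
Lemma sin_aperture theta : Rabs theta <= aperture ->
  Rabs (sin theta) <= 1 / (2 * M) /\ 3 / 4 <= cos theta.
Proof.
intros Ht; assert (A := aperture_bounds); assert (H := inv_2M_bounds).
apply Rabs_le_between in Ht.
assert (Hsin : Rabs (sin theta) <= 1 / (2 * M)).
{ assert (S : sin aperture = 1 / (2 * M)) by (apply sin_asin; lra).
  rewrite <- S; apply Rabs_le; rewrite <- sin_neg; split; apply sin_incr_1; lra. }
split; [exact Hsin|].
assert (C0 : 0 <= cos theta) by (apply cos_ge_0; lra).
assert (E := sin2_cos2 theta); unfold Rsqr in E.
assert (sin theta * sin theta <= 1 / 4).
{ replace (sin theta * sin theta) with (Rabs (sin theta) * Rabs (sin theta))
    by (rewrite <- Rabs_mult; apply Rabs_pos_eq; nra).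
  assert (B := Rabs_pos (sin theta)); nra. }
nra.
Qed.

Lemma polar_Omega rho theta : 0 <= rho -> Rabs theta <= aperture -> Omega M (polar rho theta).
Proof.
intros Hr Ht; destruct (sin_aperture theta Ht) as [H1 H2].
(* The disc is centred at the projection on the real axis, and rho/2 < 2/3 (1 + 3/4 rho). *)
exists (rho * cos theta); split; [nra|].
replace (Cminus (polar rho theta) (RtoC (rho * cos theta))) with (Cmult Ci (RtoC (rho * sin theta)))
  by (apply Ceq; simpl; ring).
rewrite Cmod_mult, Cmod_Ci, Rmult_1_l, Cmod_R, Rabs_mult, (Rabs_pos_eq rho) by lra.
assert (H3 : Rabs (sin theta) * M <= 1 / 2).
{ apply Rle_trans with (1 / (2 * M) * M); [apply Rmult_le_compat_r; lra|right; field; lra]. }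
nra.
Qed.

Lemma polar_cut_region rho theta : 0 < rho -> theta <> 0 -> Rabs theta <= aperture ->
  cut_region M (polar rho theta).
Proof.
intros Hr Hn Ht; split; [apply polar_Omega; [lra|exact Ht]|].
intros [H1 _]; simpl in H1; apply Rabs_le_between in Ht; assert (A := aperture_bounds).
assert (S : sin theta = 0) by nra.
destruct (Rtotal_order theta 0) as [B|[B|B]]; [|contradiction|].
- assert (C1 := sin_lt_0_var theta ltac:(lra) B); lra.
- assert (C1 := sin_gt_0 theta B ltac:(lra)); lra.
Qed.

Lemma contour_region_cut psi r0 z :
  0 < psi < aperture -> 0 < r0 < 1 / (2 * M) -> contour_region psi r0 z -> cut_region M z.
Proof.
intros Hpsi Hr0 [H1 H2].
assert (Hs : slit (Copp z)).
{ intros [A1 A2]; apply H2; destruct z; simpl in *; lra. }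
split; [|exact Hs].
destruct H1 as [H1|H1].
- assert (Hz : z <> RtoC 0) by (intros E; apply H2; rewrite E; simpl; lra).
  rewrite (polar_form z Hz); apply polar_Omega; [apply Cmod_ge_0|lra].
- exists 0; split; [lra|].
  replace (Cminus z (RtoC 0)) with z by ring.
  assert (Cmod z * M < 1 / (2 * M) * M) by (apply Rmult_lt_compat_r; lra).
  replace (1 / (2 * M) * M) with (1 / 2) in * by (field; lra); lra.
Qed.

(** Far out, the contour has left the disc and lies in the sector. Its direction tends to exp(i sg
    psi), so the sine of its argument is eventually within sin psi of sin(sg psi), which determines
    the sign of the argument. The factor [sg] treats both ends together. *)
Lemma contour_end psi r0 g (Fl : (R -> Prop) -> Prop) {FF : Filter Fl} sg B :
  (sg = 1 \/ sg = -1) ->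
  0 < psi < aperture -> 0 < r0 < 1 / (2 * M) ->
  (forall t, contour_region psi r0 (g t)) -> goes_to_infinity g Fl (sg * psi) ->
  Fl (fun t => B <= Cmod (g t) /\ g t = polar (Cmod (g t)) (Carg (g t)) /\
               0 < sg * Carg (g t) <= aperture).
Proof.
intros Hsg Hpsi Hr0 Hreg [Hinf Hdir].
assert (A := aperture_bounds).
assert (Hsin : 0 < sin psi) by (apply sin_gt_0; lra).
assert (H1 : Fl (fun t => Rmax (Rmax B r0) 0 < Cmod (g t))).
{ apply Hinf; exists (Rmax (Rmax B r0) 0); auto. }
assert (H2 := proj1 (filterlim_norm_lt (V := C_NormedModule) Fl _ _) Hdir _ Hsin).
refine (filter_imp _ _ _ (filter_and _ _ H1 H2)); intros t [T1 T2].
assert (M1 := Rmax_l (Rmax B r0) 0); assert (M2 := Rmax_r (Rmax B r0) 0).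
assert (M3 := Rmax_l B r0); assert (M4 := Rmax_r B r0).
assert (Hz : g t <> RtoC 0) by (apply Cmod_gt_0; lra).
split; [lra|split; [apply polar_form, Hz|]].
destruct (Hreg t) as [[Ha|Ha] _]; [|lra].
set (theta := Carg (g t)) in *; set (rho := Cmod (g t)) in *.
assert (T3 : Rabs (sin theta - sin (sg * psi)) < sin psi).
{ apply Rle_lt_trans with (2 := T2).
  refine (Rle_trans _ _ _ _ (Rabs_Im_le (minus (Cdiv (g t) (RtoC rho)) (cos (sg * psi), sin (sg * psi))))).
  right; f_equal.
  change (sin theta - sin (sg * psi) = Im (Cminus (Cdiv (g t) (RtoC rho)) (cos (sg * psi), sin (sg * psi)))).
  rewrite (polar_form (g t) Hz); fold rho theta; simpl; field; lra. }
apply Rabs_le_between in Ha; apply Rabs_def2 in T3.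
destruct Hsg as [-> | ->].
- rewrite !Rmult_1_l in *; split; [|lra].
  destruct (Rle_lt_dec theta 0) as [Hn|]; [|assumption].
  exfalso; destruct Hn as [Hn|Hn]; [|rewrite Hn, sin_0 in T3; lra].
  assert (C1 := sin_lt_0_var theta ltac:(lra) Hn); lra.
- replace (-1 * psi) with (- psi) in T3 by ring; rewrite sin_neg in T3.
  split; [|lra].
  destruct (Rle_lt_dec 0 theta) as [Hn|]; [|lra].
  exfalso; assert (C1 := sin_ge_0 theta Hn ltac:(lra)); lra.
Qed.

End Regions.

Section ContourLimits.

Variable W : NormedModule C_AbsRing.
Variable cW : CompleteSpace.mixin_of W.
Variable M : R.
Hypothesis HM : 1 <= M.

Local Notation rW := (real_NormedModule W).

Variables F f : C -> W.
Hypothesis HF : forall z, cut_region M z -> Cder F z (f z).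
Hypothesis Hf : forall z, cut_region M z -> Ccont f z.

Lemma contour_values_filterlim psi r0 g dg (Fl : (R -> Prop) -> Prop) {FF : Filter Fl} sg L beta K :
  (sg = 1 \/ sg = -1) -> 0 < beta -> 0 <= K ->
  (forall rho theta, 1 <= rho -> 0 < sg * theta <= aperture M ->
     norm (minus (F (polar rho theta)) L) <= K * Rpower rho (- beta)) ->
  0 < psi < aperture M -> 0 < r0 < 1 / (2 * M) -> is_contour psi r0 g dg ->
  goes_to_infinity g Fl (sg * psi) ->
  filterlim (fun t => F (g t)) Fl (locally L).
Proof.
intros Hsg Hb HK HL Hpsi Hr0 [_ [Hreg _]] Hinf.
apply filterlim_norm_lt; [exact FF|]; intros eps He.
destruct (Rpower_neg_small beta K eps Hb HK He) as [B [HB1 HB]].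
refine (filter_imp _ _ _ (contour_end M HM psi r0 g Fl sg B Hsg Hpsi Hr0 Hreg Hinf)).
intros t [T1 [T2 T3]]; rewrite T2.
apply Rle_lt_trans with (1 := HL _ _ (Rle_trans _ _ _ HB1 T1) T3), HB, T1.
Qed.

Lemma is_RInt_gen_of_limits psi r0 g dg Lp Lm beta K :
  0 < beta -> 0 <= K ->
  (forall rho theta, 1 <= rho -> 0 < theta <= aperture M ->
     norm (minus (F (polar rho theta)) Lp) <= K * Rpower rho (- beta)) ->
  (forall rho theta, 1 <= rho -> 0 < - theta <= aperture M ->
     norm (minus (F (polar rho theta)) Lm) <= K * Rpower rho (- beta)) ->
  0 < psi < aperture M -> 0 < r0 < 1 / (2 * M) -> is_contour psi r0 g dg ->
  is_RInt_gen (V := rW) (fun t => scal (dg t : C_AbsRing) (f (g t)))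
    (Rbar_locally m_infty) (Rbar_locally p_infty) (minus Lp Lm).
Proof.
intros Hb HK Hp Hm Hpsi Hr0 Hc.
assert (Hcut : forall t, cut_region M (g t)).
{ intros t; apply (contour_region_cut M HM psi r0 (g t) Hpsi Hr0), Hc. }
apply (is_RInt_gen_contour W cW F f g dg).
- intros t; apply HF, Hcut.
- intros t; apply Hf, Hcut.
- apply Hc.
- apply (contour_values_filterlim psi r0 g dg _ (-1) Lm beta K); auto.
  + intros rho theta Hr Ht; apply Hm; [exact Hr|lra].
  + replace (-1 * psi) with (- psi) by ring; apply Hc.
- apply (contour_values_filterlim psi r0 g dg _ 1 Lp beta K); auto.
  + intros rho theta Hr Ht; apply Hp; [exact Hr|lra].
  + rewrite Rmult_1_l; apply Hc.
Qed.

Lemma contour_integral_exists beta K :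
  0 < beta ->
  (forall rho theta, 1 <= rho -> theta <> 0 -> Rabs theta <= aperture M ->
     norm (f (polar rho theta)) <= K * Rpower rho (- beta - 1)) ->
  exists L, forall psi r0 g dg,
    0 < psi < aperture M -> 0 < r0 < 1 / (2 * M) -> is_contour psi r0 g dg ->
    is_RInt_gen (V := rW) (fun t => scal (dg t : C_AbsRing) (f (g t)))
      (Rbar_locally m_infty) (Rbar_locally p_infty) L.
Proof.
intros Hb Hbd.
assert (A := aperture_bounds M HM).
assert (HPI := PI_4).
assert (H : forall sg, sg = 1 \/ sg = -1 -> exists L, forall rho theta, 1 <= rho ->
   0 < sg * theta <= aperture M ->
   norm (minus (F (polar rho theta)) L) <= K * (/ beta + 8) * Rpower rho (- beta)).
{ intros sg Hsg.
  apply (limit_at_infinity W cW F f (fun theta => 0 < sg * theta <= aperture M) 1 beta K); [lra|exact Hb| | |].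
  - intros a b c Ha Hc Hab; destruct Hsg as [-> | ->]; lra.
  - intros a Ha; apply Rabs_le; destruct Hsg as [-> | ->]; lra.
  - intros rho theta Hr Ht.
    assert (Hn : theta <> 0) by (intros E; rewrite E in Ht; lra).
    assert (Ht' : Rabs theta <= aperture M) by (apply Rabs_le; destruct Hsg as [-> | ->]; lra).
    assert (Hc := polar_cut_region M HM rho theta ltac:(lra) Hn Ht').
    auto. }
assert (HK : 0 <= K * (/ beta + 8)).
{ assert (B := Hbd 1 (aperture M) (Rle_refl _) ltac:(lra) ltac:(rewrite Rabs_pos_eq; lra)).
  assert (B' := norm_ge_0 (f (polar 1 (aperture M)))).
  assert (P : 0 < Rpower 1 (- beta - 1)) by apply exp_pos.
  assert (0 <= K) by (apply Rmult_le_reg_r with (1 := P); lra).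
  assert (Q := Rinv_0_lt_compat _ Hb); nra. }
destruct (H 1 (or_introl eq_refl)) as [Lp HLp], (H (-1) (or_intror eq_refl)) as [Lm HLm].
exists (minus Lp Lm); intros psi r0 g dg Hpsi Hr0 Hc.
apply (is_RInt_gen_of_limits psi r0 g dg Lp Lm beta (K * (/ beta + 8))); auto.
- intros rho theta Hr Ht; apply HLp; lra.
- intros rho theta Hr Ht; apply HLm; lra.
Qed.

(** The primitive itself decays, so both of its limits at infinity are zero. *)
Lemma contour_integral_derivative psi r0 g dg beta K :
  0 < beta ->
  (forall rho theta, 1 <= rho -> theta <> 0 -> Rabs theta <= aperture M ->
     norm (F (polar rho theta)) <= K * Rpower rho (- beta)) ->
  0 < psi < aperture M -> 0 < r0 < 1 / (2 * M) -> is_contour psi r0 g dg ->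
  is_RInt_gen (V := rW) (fun t => scal (dg t : C_AbsRing) (f (g t)))
    (Rbar_locally m_infty) (Rbar_locally p_infty) zero.
Proof.
intros Hb Hbd Hpsi Hr0 Hc.
assert (A := aperture_bounds M HM).
assert (HK : 0 <= K).
{ assert (B := Hbd 1 (aperture M) (Rle_refl _) ltac:(lra) ltac:(rewrite Rabs_pos_eq; lra)).
  assert (B' := norm_ge_0 (F (polar 1 (aperture M)))).
  assert (P : 0 < Rpower 1 (- beta)) by apply exp_pos.
  apply Rmult_le_reg_r with (1 := P); lra. }
assert (E : forall rho theta, 1 <= rho -> theta <> 0 -> Rabs theta <= aperture M ->
     norm (minus (F (polar rho theta)) zero) <= K * Rpower rho (- beta)).
{ intros rho theta Hr Hn Ht; apply (norm_le_eq (F (polar rho theta))); [module_ring W|auto]. }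
refine (eq_rect _ (is_RInt_gen (V := rW) _ _ _) (is_RInt_gen_of_limits psi r0 g dg zero zero beta K _ _ _ _ _ _ _) _ _); auto.
- intros rho theta Hr Ht; apply E; [exact Hr|lra|rewrite Rabs_pos_eq; lra].
- intros rho theta Hr Ht; apply E; [exact Hr|lra|rewrite <- Rabs_Ropp, Rabs_pos_eq; lra].
- change (minus zero zero = (zero : W)); module_ring W.
Qed.

End ContourLimits.

(** * Integrals of a power times a decaying holomorphic function *)

Section FractionalIntegrals.

Variable W : NormedModule C_AbsRing.
Variable cW : CompleteSpace.mixin_of W.
Variable M : R.
Hypothesis HM : 1 <= M.

Local Notation rW := (real_NormedModule W).

Variables r r1 : C -> W.
Variable K : R.
Hypothesis Hr : forall z, Omega M z -> Cder r z (r1 z).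
Hypothesis Hr1 : forall z, Omega M z -> Ccont r1 z.
Hypothesis HK : forall z, Omega M z -> (1 + Cmod z) * norm (r z) <= K.

(** [r] stands for z |-> (z + sigma + A)^-1 and [r1] for its derivative; the decay 1/(1 + |z|) of
    [r] gives the integrand the order |z|^(-beta-1). *)
Definition frac (beta : R) (z : C) : W := scal (Crpower (Copp z) (- beta) : C_AbsRing) (r z).

Definition dfrac (beta : R) (z : C) : W :=
  plus (scal (Cmult (RtoC beta) (Crpower (Copp z) (- (beta + 1))) : C_AbsRing) (r z))
       (scal (Crpower (Copp z) (- beta) : C_AbsRing) (r1 z)).

Lemma Ccont_Crpower_opp z a : slit (Copp z) ->
  Ccont (W := C_NormedModule) (fun z => Crpower (Copp z) a) z.
Proof. intros Hz; apply Cder_Ccont with (1 := Cder_Crpower_opp z a Hz). Qed.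

Lemma frac_Cder beta z : cut_region M z -> Cder (frac beta) z (dfrac beta z).
Proof.
intros [H1 H2].
refine (Cder_eq _ _ _ _ _ (Cder_scal _ _ _ _ _ (Cder_Crpower_opp z (- beta) H2) (Hr z H1))).
unfold dfrac; rewrite Ropp_involutive.
replace (- beta - 1) with (- (beta + 1)) by ring; reflexivity.
Qed.

Lemma dfrac_Ccont beta z : cut_region M z -> Ccont (dfrac beta) z.
Proof.
intros [H1 H2]; apply Ccont_plus.
- apply (Ccont_scal (fun z => Cmult (RtoC beta) (Crpower (Copp z) (- (beta + 1))))).
  + apply (Ccont_scal (W := C_NormedModule) (fun _ => RtoC beta)); [|apply Ccont_Crpower_opp, H2].
    apply Cder_Ccont with (1 := Cder_const (W := C_NormedModule) (RtoC beta) z).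
  + apply Cder_Ccont with (1 := Hr z H1).
- apply Ccont_scal; [apply Ccont_Crpower_opp, H2|apply Hr1, H1].
Qed.

Lemma frac_bound beta rho theta : 0 < rho -> theta <> 0 -> Rabs theta <= aperture M ->
  norm (frac beta (polar rho theta)) <= K * Rpower rho (- beta - 1).
Proof.
intros Hrho Hn Ht; unfold frac; rewrite norm_scal_eq, Cmod_Crpower, Cmod_opp.
assert (Hm : Cmod (polar rho theta) = rho) by (apply Cmod_polar; lra).
rewrite Hm.
destruct (polar_cut_region M HM rho theta Hrho Hn Ht) as [H1 _].
assert (B := HK _ H1); rewrite Hm in B.
assert (E : Rpower rho (- beta) = Rpower rho (- beta - 1) * rho).
{ rewrite <- (Rpower_1 rho Hrho) at 3; rewrite <- Rpower_plus; f_equal; ring. }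
rewrite E.
assert (P : 0 < Rpower rho (- beta - 1)) by apply exp_pos.
assert (N := norm_ge_0 (r (polar rho theta))).
rewrite Rmult_assoc, Rmult_comm; apply Rmult_le_compat_r; lra.
Qed.

Lemma frac_integral_exists beta : 0 < beta ->
  exists L, forall psi r0 g dg,
    0 < psi < aperture M -> 0 < r0 < 1 / (2 * M) -> is_contour psi r0 g dg ->
    is_RInt_gen (V := rW) (fun t => scal (dg t : C_AbsRing) (frac beta (g t)))
      (Rbar_locally m_infty) (Rbar_locally p_infty) L.
Proof.
intros Hb.
apply (contour_integral_exists W cW M HM (star_primitive W cW (center M) (frac beta)) (frac beta))
  with beta K.
- intros z Hz; apply (star_primitive_Cder W cW (cut_region M) (cut_region_open M HM) (center M)
    (cut_region_star M HM) (frac beta) (dfrac beta)); auto using frac_Cder, dfrac_Ccont.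
- intros z Hz; apply Cder_Ccont with (1 := frac_Cder beta z Hz).
- exact Hb.
- intros rho theta H1; apply frac_bound; lra.
Qed.

(** The function [frac beta] decays like |z|^(-beta-1), which is enough for all beta > -1. Negative
    exponents occur as beta - 1 when the powers of sigma + A are differentiated in sigma. *)
Lemma dfrac_integral beta psi r0 g dg : - 1 < beta ->
  0 < psi < aperture M -> 0 < r0 < 1 / (2 * M) -> is_contour psi r0 g dg ->
  is_RInt_gen (V := rW) (fun t => scal (dg t : C_AbsRing) (dfrac beta (g t)))
    (Rbar_locally m_infty) (Rbar_locally p_infty) zero.
Proof.
intros Hb.
apply (contour_integral_derivative W cW M HM (frac beta) (dfrac beta)) with (beta + 1) K.
- intros z Hz; apply frac_Cder, Hz.
- intros z Hz; apply dfrac_Ccont, Hz.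
- lra.
- intros rho theta H1 Hn Ht; replace (- (beta + 1)) with (- beta - 1) by ring.
  apply frac_bound; auto; lra.
Qed.

End FractionalIntegrals.

(** * Resolvents *)

Section BoundedOperatorSeries.

Context {V : NormedModule C_AbsRing}.

Fixpoint bl_pow (S : BL V) (n : nat) : BL V :=
  match n with O => bl_id | S m => bl_comp S (bl_pow S m) end.

Lemma op_norm_bl_id : op_norm (bl_id : BL V) <= 1.
Proof. apply op_norm_le; [lra|]; intros x; simpl; lra. Qed.

Lemma op_norm_bl_pow S n : op_norm (bl_pow S n) <= op_norm S ^ n.
Proof.
induction n as [|n IH]; simpl; [apply op_norm_bl_id|].
apply Rle_trans with (1 := op_norm_comp _ _).
apply Rmult_le_compat_l; [apply op_norm_ge_0|exact IH].
Qed.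

Lemma bl_pow_comm S n : bl_comp S (bl_pow S n) = bl_comp (bl_pow S n) S.
Proof.
induction n as [|n IH]; simpl; [apply bl_ext; reflexivity|].
rewrite IH at 1; apply bl_ext; intros x; simpl bl_fun.
change (S (bl_pow S n (S x)) = S (bl_pow S n (S x))); reflexivity.
Qed.

Variable cV : CompleteSpace.mixin_of V.
Local Notation rB := (real_NormedModule (BL_NormedModule V)).

Lemma neumann_inverse (S : BL V) : op_norm S < 1 ->
  exists T : BL V, bl_comp T (minus bl_id S) = bl_id /\ bl_comp (minus bl_id S) T = bl_id.
Proof.
intros HS; assert (HS0 := op_norm_ge_0 S).
destruct (ex_series_le (K := R_AbsRing)
   (V := real_CompleteNormedModule (BL_NormedModule V) (bl_complete_mixin V cV))
   (bl_pow S) (fun n => op_norm S ^ n)) as [T HT].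
- intros n; apply op_norm_bl_pow.
- apply ex_series_geom; rewrite Rabs_pos_eq; assumption.
- set (sN := fun n => sum_n (G := NormedModule.AbelianMonoid _ rB) (bl_pow S) n : BL V).
  assert (sN0 : sN O = bl_id) by apply (sum_O (G := NormedModule.AbelianMonoid _ rB)).
  assert (sNS : forall n, sN (Datatypes.S n) = plus (sN n) (bl_pow S (Datatypes.S n)))
    by (intros n; apply (sum_Sn (G := NormedModule.AbelianMonoid _ rB))).
  assert (HT' : filterlim sN eventually
     (locally (T : BL_NormedModule V))) by exact HT.
  assert (HT1 : filterlim (fun n => sN (Datatypes.S n)) eventually
     (locally (T : BL_NormedModule V))).
  { apply filterlim_comp with (2 := HT'); intros P [N HN]; exists N; intros n Hn; apply HN; lia. }
  (* [L] is composition with [S] on the left or on the right. The partial sums satisfy s_(n+1) = 1 +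
     L s_n, so both inverse identities result from one passage to the limit. *)
  assert (E : forall L : BL V -> BL V, is_linear (U := BL_NormedModule V) (V := BL_NormedModule V) L ->
     (forall n, L (bl_pow S n) = bl_pow S (Datatypes.S n)) ->
     plus (bl_id : BL V) (L T) = T).
  { intros L HL HLn.
    assert (H1 := linear_filterlim (V := BL_NormedModule V) (W := BL_NormedModule V) L HL eventually _ _ HT').
    assert (H2 : forall n, plus (bl_id : BL V) (L (sN n))
         = sN (Datatypes.S n)).
    { induction n as [|n IH].
      - rewrite sNS, sN0; f_equal; exact (HLn O).
      - transitivity (plus (bl_id : BL V) (plus (L (sN n)) (L (bl_pow S (Datatypes.S n))))).
        + rewrite sNS; f_equal; exact (linear_plus _ HL (sN n) (bl_pow S (Datatypes.S n))).
        + rewrite HLn, (sNS (Datatypes.S n)), <- IH; apply (plus_assoc (G := BL_AbelianMonoid V)). }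
    assert (H3 : filterlim (fun n => plus (bl_id : BL V) (L (sN n)))
       eventually (locally (plus (bl_id : BL_NormedModule V) (L T)))).
    { exact (filterlim_comp_2 _ _ plus (filterlim_const (F := eventually) (bl_id : BL_NormedModule V)) H1
        (filterlim_plus (V := BL_NormedModule V) (bl_id : BL_NormedModule V) (L T))). }
    apply (filterlim_locally_unique (V := BL_NormedModule V) (F := eventually) _ _ _ H3).
    refine (filterlim_ext _ _ _ HT1); intros n; symmetry; apply H2. }
  assert (E1 := E _ (bl_comp_linear_l S) (fun n => eq_refl)).
  assert (E2 := E _ (bl_comp_linear_r S) (fun n => eq_sym (bl_pow_comm S n))).
  exists T; split; apply bl_ext; intros x; bl_push.
  + assert (E2x := f_equal (fun U => bl_fun U x) E2); simpl in E2x.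
    transitivity (minus (plus (bl_id x) (T (S x))) (T (S x))); [|simpl; module_ring V].
    f_equal; symmetry; exact E2x.
  + assert (E1x := f_equal (fun U => bl_fun U x) E1); simpl in E1x.
    transitivity (minus (plus (bl_id x) (S (T x))) (S (T x))); [|simpl; module_ring V].
    f_equal; symmetry; exact E1x.
Qed.

End BoundedOperatorSeries.

Section Resolvents.

Context {V : NormedModule C_AbsRing}.

Lemma is_resolvent_unique (B : operator V) z S T :
  is_resolvent B z S -> is_resolvent B z T -> S = T.
Proof.
intros [_ H1] [H2 _]; apply bl_ext; intros x.
destruct (H2 x) as [Hd E]; rewrite <- E at 1; apply H1, Hd.
Qed.

Lemma resolvent_spec (B : operator V) z : resolvent_set B z -> is_resolvent B z (resolvent B z).
Proof. intros H; exact (epsilon_spec _ _ H). Qed.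

Lemma resolvent_eq (B : operator V) z T : is_resolvent B z T -> resolvent B z = T.
Proof.
intros H; apply is_resolvent_unique with B z; [apply resolvent_spec; exists T; exact H|exact H].
Qed.

Lemma resolvent_identity (B : operator V) (z w : C) :
  resolvent_set B z -> resolvent_set B w ->
  minus (resolvent B z) (resolvent B w) =
  scal (Cminus w z : C_AbsRing) (bl_comp (resolvent B z) (resolvent B w)).
Proof.
intros Hz Hw; destruct (resolvent_spec B z Hz) as [_ H2].
destruct (resolvent_spec B w Hw) as [H3 _].
set (Rz := resolvent B z) in *; set (Rw := resolvent B w) in *.
apply bl_ext; intros x; bl_push.
destruct (H3 x) as [Hd E].
assert (E2 := H2 _ Hd).
assert (E3 : x = plus (minus (scal (z : C_AbsRing) (Rw x)) (B (Rw x)))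
                     (scal (Cminus w z : C_AbsRing) (Rw x))).
{ rewrite <- E at 1; module_ring V. }
transitivity (minus (Rz (plus (minus (scal (z : C_AbsRing) (Rw x)) (B (Rw x)))
                     (scal (Cminus w z : C_AbsRing) (Rw x)))) (Rw x));
  [rewrite <- E3; reflexivity|].
rewrite (bl_linear_plus Rz), (bl_linear_scal Rz (Cminus w z)), E2; module_ring V.
Qed.

Variable cV : CompleteSpace.mixin_of V.

(** (z - B) R(w) = 1 - (w - z) R(w), and the right-hand side is inverted by a Neumann series. *)
Lemma resolvent_perturbation (B : operator V) (z w : C) :
  resolvent_set B w -> Cmod (Cminus z w) * op_norm (resolvent B w) < 1 ->
  resolvent_set B z.
Proof.
intros Hw Hlt; destruct (resolvent_spec B w Hw) as [H1 H2].
set (Rw := resolvent B w) in *.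
destruct (neumann_inverse cV (scal (Cminus w z : C_AbsRing) Rw)) as [T [HT1 HT2]].
{ apply Rle_lt_trans with (2 := Hlt).
  replace (Cminus z w) with (Copp (Cminus w z)) by ring; rewrite Cmod_opp.
  exact (op_norm_scal V (Cminus w z) Rw). }
assert (HT1' : forall u, T (minus u (scal (Cminus w z : C_AbsRing) (Rw u))) = u).
{ intros u; assert (E := f_equal (fun U => bl_fun U u) HT1); simpl in E.
  etransitivity; [|exact E]; f_equal; symmetry.
  exact (bl_minus_app bl_id (scal (Cminus w z : C_AbsRing) Rw) u). }
assert (HT2' : forall u, minus (T u) (scal (Cminus w z : C_AbsRing) (Rw (T u))) = u).
{ intros u; assert (E := f_equal (fun U => bl_fun U u) HT2); simpl in E.
  etransitivity; [|exact E]; symmetry.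
  exact (bl_minus_app bl_id (scal (Cminus w z : C_AbsRing) Rw) (T u)). }
exists (bl_comp Rw T); split.
- intros x; rewrite bl_comp_app; destruct (H1 (T x)) as [Hd E]; split; [exact Hd|].
  rewrite <- (HT2' x) at 3.
  transitivity (minus (minus (scal (w : C_AbsRing) (Rw (T x))) (B (Rw (T x))))
     (scal (Cminus w z : C_AbsRing) (Rw (T x)))); [module_ring V|].
  rewrite E; reflexivity.
- intros x Hd; rewrite bl_comp_app.
  assert (E := H2 x Hd).
  set (u := minus (scal (w : C_AbsRing) x) (B x)) in *.
  transitivity (Rw (T (minus u (scal (Cminus w z : C_AbsRing) (Rw u))))).
  + do 2 f_equal; rewrite E; unfold u; module_ring V.
  + rewrite HT1'; exact E.
Qed.

(** The resolvent identity gives |R(z)| <= |R(w)| + q |R(z)|, and the last term is absorbed. *)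
Lemma resolvent_norm_perturbation (B : operator V) (z w : C) q :
  resolvent_set B w -> Cmod (Cminus z w) * op_norm (resolvent B w) <= q -> q < 1 ->
  resolvent_set B z /\ (1 - q) * op_norm (resolvent B z) <= op_norm (resolvent B w).
Proof.
intros Hw Hq Hq1.
assert (Hz : resolvent_set B z) by (apply resolvent_perturbation with w; [exact Hw|lra]).
split; [exact Hz|].
assert (E := resolvent_identity B z w Hz Hw).
assert (N : op_norm (resolvent B z) <=
  op_norm (resolvent B w) + Cmod (Cminus z w) * (op_norm (resolvent B z) * op_norm (resolvent B w))).
{ apply (norm_le_eq (V := BL_NormedModule V) (plus (resolvent B w)
      (scal (Cminus w z : C_AbsRing) (bl_comp (resolvent B z) (resolvent B w))))).
  - rewrite <- E; module_ring (BL_NormedModule V).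
  - apply (norm_plus_compat (V := BL_NormedModule V)); [apply Rle_refl|].
    apply (norm_scal_compat (V := BL_NormedModule V)); [|apply op_norm_comp].
    replace (Cminus w z) with (Copp (Cminus z w)) by ring; rewrite Cmod_opp; apply Rle_refl. }
assert (P := op_norm_ge_0 (resolvent B z)).
assert (Cmod (Cminus z w) * (op_norm (resolvent B z) * op_norm (resolvent B w)) <= q * op_norm (resolvent B z)).
{ replace (Cmod (Cminus z w) * (op_norm (resolvent B z) * op_norm (resolvent B w)))
   with (Cmod (Cminus z w) * op_norm (resolvent B w) * op_norm (resolvent B z)) by ring.
  apply Rmult_le_compat_r; assumption. }
lra.
Qed.

(** Two uses of the resolvent identity give the exact remainder h^2 R(z+h) R(z)^2. With N the norm
    of R(z) and |h| < 1/(2(N+1)), the norm of R(z+h) is at most 2 N. *)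
Lemma Cder_resolvent (B : operator V) z : resolvent_set B z ->
  Cder (W := BL_NormedModule V) (resolvent B) z (opp (bl_comp (resolvent B z) (resolvent B z))).
Proof.
intros Hz; set (N := op_norm (resolvent B z)).
assert (HN : 0 <= N) by apply op_norm_ge_0.
apply Cder_quadratic_norm with (/ (2 * (N + 1))) (2 * N * (N * N)).
- apply Rinv_0_lt_compat; lra.
- apply Rmult_le_pos; nra.
- intros h Hh.
  assert (Hq : Cmod h * N <= 1 / 2).
  { apply Rle_trans with (/ (2 * (N + 1)) * (N + 1)).
    - apply Rmult_le_compat; [apply Cmod_ge_0|exact HN|lra|lra].
    - right; field; lra. }
  destruct (resolvent_norm_perturbation B (Cplus z h) z (1 / 2)) as [Hzh HB]; [exact Hz| |lra|].
  { replace (Cminus (Cplus z h) z) with h by ring; exact Hq. }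
  fold N in HB.
  assert (E := resolvent_identity B (Cplus z h) z Hzh Hz).
  set (Rz := resolvent B z) in *; set (Rh := resolvent B (Cplus z h)) in *.
  apply (norm_le_eq (V := BL_NormedModule V)
     (scal (Cmult h h : C_AbsRing) (bl_comp (bl_comp Rh Rz) Rz))).
  + etransitivity;
      [exact (f_equal (fun D : BL V => minus D (scal (h : C_AbsRing) (opp (bl_comp Rz Rz)))) E)|].
    assert (E3 : bl_comp Rz Rz = minus (bl_comp Rh Rz)
        (bl_comp (scal (Cminus z (Cplus z h) : C_AbsRing) (bl_comp Rh Rz)) Rz)).
    { rewrite <- E; apply bl_ext; intros x; bl_push; module_ring V. }
    rewrite E3; apply bl_ext; intros x; bl_push; module_ring V.
  + rewrite Rmult_comm; apply (norm_scal_compat (V := BL_NormedModule V)).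
    * rewrite Cmod_mult; apply Rle_refl.
    * apply Rle_trans with (1 := op_norm_comp _ _).
      replace (2 * N * (N * N)) with (2 * N * N * N) by ring.
      apply Rmult_le_compat; [apply op_norm_ge_0|exact HN| |apply Rle_refl].
      apply Rle_trans with (1 := op_norm_comp _ _).
      apply Rmult_le_compat; [apply op_norm_ge_0|exact HN|lra|apply Rle_refl].
Qed.

Lemma Ccont_comp (f g : C -> BL V) z :
  Ccont (W := BL_NormedModule V) f z -> Ccont (W := BL_NormedModule V) g z ->
  Ccont (W := BL_NormedModule V) (fun z => bl_comp (f z) (g z)) z.
Proof.
intros Hf Hg eps He.
set (a := op_norm (f z)); set (b := op_norm (g z)).
assert (Ha : 0 <= a) by apply op_norm_ge_0; assert (Hb : 0 <= b) by apply op_norm_ge_0.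
assert (He2 : 0 < eps / 2) by lra.
destruct (small_factor (eps / 2) (a + b + 1) He2) as [e [He1 He3]]; [lra|].
destruct (Hf e He1) as [d1 [Hd1 H1]], (Hg (Rmin e 1)) as [d2 [Hd2 H2]]; [apply Rmin_pos; lra|].
exists (Rmin d1 d2); split; [apply Rmin_pos; assumption|]; intros z' Hz'.
assert (B1 := H1 z' (Rlt_le_trans _ _ _ Hz' (Rmin_l _ _)) : op_norm (minus (f z') (f z)) < e).
assert (B2 := H2 z' (Rlt_le_trans _ _ _ Hz' (Rmin_r _ _)) : op_norm (minus (g z') (g z)) < Rmin e 1).
assert (B3 := Rmin_l e 1); assert (B4 := Rmin_r e 1).
assert (B5 : op_norm (g z') <= 1 + b).
{ apply (norm_le_eq (V := BL_NormedModule V) (plus (minus (g z') (g z)) (g z))).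
  - module_ring (BL_NormedModule V).
  - apply (norm_plus_compat (V := BL_NormedModule V)); [|apply Rle_refl].
    change (op_norm (minus (g z') (g z)) <= 1); lra. }
apply Rle_lt_trans with (e * (1 + b) + a * e); [|nra].
apply (norm_le_eq (V := BL_NormedModule V) (plus (bl_comp (minus (f z') (f z)) (g z'))
   (bl_comp (f z) (minus (g z') (g z))))).
- apply bl_ext; intros x; bl_push; module_ring V.
- apply (norm_plus_compat (V := BL_NormedModule V)).
  + apply Rle_trans with (1 := op_norm_comp _ _).
    apply Rmult_le_compat; try apply op_norm_ge_0; lra.
  + apply Rle_trans with (1 := op_norm_comp _ _).
    apply Rmult_le_compat; try apply op_norm_ge_0; [apply Rle_refl|lra].
Qed.

End Resolvents.

(** * A hyperbolic contour *)

Lemma cosh_sinh_sqr u : cosh u * cosh u - sinh u * sinh u = 1.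
Proof.
unfold cosh, sinh; assert (E : exp u * exp (- u) = 1) by (rewrite <- exp_plus, Rplus_opp_r; apply exp_0).
lra.
Qed.

Lemma cosh_ge_1 u : 1 <= cosh u.
Proof.
assert (E := cosh_sinh_sqr u); assert (0 < cosh u).
{ unfold cosh; assert (A := exp_pos u); assert (B := exp_pos (- u)); lra. }
nra.
Qed.

Lemma Rabs_sinh_le u : Rabs (sinh u) <= cosh u.
Proof. unfold sinh, cosh; assert (A := exp_pos u); assert (B := exp_pos (- u)); apply Rabs_le; lra. Qed.

Lemma sinh_eq_0_cosh u : sinh u = 0 -> cosh u = 1.
Proof. intros H; assert (E := cosh_sinh_sqr u); rewrite H in E; assert (C1 := cosh_ge_1 u); nra. Qed.

Lemma exp_ge_1_plus u : 0 <= u -> 1 + u <= exp u.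
Proof. intros [H|H]; [left; apply exp_ineq1; lra|rewrite <- H, exp_0; lra]. Qed.

Section HyperbolicContour.

Variables psi r : R.
Hypothesis Hpsi : 0 < psi < PI / 2.
Hypothesis Hr : 0 < r.

(* The rays [t exp(+- i psi)], with [|t|] replaced by [cosh u - 2 / cosh u ^ 2] so as to pass
   to the left of the origin without leaving the sector at infinity. *)
Definition hcontour (u : R) : C :=
  (r * cos psi * (cosh u - 2 / (cosh u * cosh u)), r * sin psi * sinh u).

Definition dhcontour (u : R) : C :=
  (r * cos psi * (sinh u + 4 * sinh u / (cosh u * cosh u * cosh u)), r * sin psi * cosh u).

Lemma cos_sin_psi : 0 < cos psi <= 1 /\ 0 < sin psi <= 1.
Proof.
assert (A := COS_bound psi); assert (B := SIN_bound psi).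
assert (0 < cos psi) by (apply cos_gt_0; lra).
assert (0 < sin psi) by (apply sin_gt_0; lra); lra.
Qed.

Lemma inv_cosh_bounds u : 0 < / (cosh u * cosh u) <= 1 /\ 0 < / (cosh u * cosh u * cosh u) <= 1.
Proof.
assert (H := cosh_ge_1 u); assert (1 <= cosh u * cosh u) by nra.
assert (1 <= cosh u * cosh u * cosh u) by nra.
repeat split; try (apply Rinv_0_lt_compat; lra); rewrite <- Rinv_1; apply Rinv_le_contravar; lra.
Qed.

Lemma hcontour_is_derive u :
  is_derive (K := R_AbsRing) (V := C_R_NormedModule) hcontour u (dhcontour u).
Proof.
assert (H := cosh_ge_1 u).
apply is_derive_Cpair.
- auto_derive; [repeat split; nra|field; lra].
- auto_derive; [auto|ring].
Qed.

Lemma continuous_dhcontour u : continuous dhcontour u.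
Proof.
assert (H := cosh_ge_1 u); assert (1 <= cosh u * cosh u) by nra.
apply continuous_Cpair; apply (ex_derive_continuous (V := R_NormedModule)); auto_derive; auto.
nra.
Qed.

Lemma hcontour_approx u :
  Cmod (Cminus (hcontour u) (Cmult (RtoC (r * cosh u)) (cos psi, sin psi))) <= 2 * r + r * Rabs (sinh u - cosh u) /\
  Cmod (Cminus (hcontour u) (Cmult (RtoC (r * cosh u)) (cos (- psi), sin (- psi)))) <= 2 * r + r * Rabs (sinh u + cosh u).
Proof.
assert (H := cosh_ge_1 u); destruct (inv_cosh_bounds u) as [I _].
destruct cos_sin_psi as [Hc Hs].
assert (A : Rabs (r * cos psi * (- (2 * / (cosh u * cosh u)))) <= 2 * r).
{ assert (0 <= r * cos psi <= r) by nra.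
  rewrite Rabs_mult, Rabs_Ropp, (Rabs_pos_eq (r * cos psi)), (Rabs_pos_eq (2 * _)) by lra.
  replace (2 * r) with (r * (2 * 1)) by ring; apply Rmult_le_compat; lra. }
assert (B : forall x, Rabs (r * sin psi * x) <= r * Rabs x).
{ intros x; rewrite Rabs_mult, Rabs_pos_eq by nra.
  apply Rmult_le_compat_r; [apply Rabs_pos|nra]. }
split; apply Rle_trans with (1 := Cmod_le_Rabs _); simpl; apply Rplus_le_compat.
- replace (r * cos psi * (cosh u - 2 / (cosh u * cosh u)) + - (r * cosh u * cos psi - 0 * sin psi))
    with (r * cos psi * (- (2 * / (cosh u * cosh u)))) by (field; lra); exact A.
- replace (r * sin psi * sinh u + - (r * cosh u * sin psi + 0 * cos psi)) with (r * sin psi * (sinh u - cosh u)) by ring.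
  apply B.
- rewrite cos_neg.
  replace (r * cos psi * (cosh u - 2 / (cosh u * cosh u)) + - (r * cosh u * cos psi - 0 * sin (- psi)))
    with (r * cos psi * (- (2 * / (cosh u * cosh u)))) by (field; lra); exact A.
- rewrite sin_neg.
  replace (r * sin psi * sinh u + - (r * cosh u * - sin psi + 0 * cos (- psi))) with (r * sin psi * (sinh u + cosh u)) by ring.
  apply B.
Qed.

(** At distance at most K from the point rho exp(i theta), the modulus differs from rho by at most
    K, so the direction differs from exp(i theta) by at most 2 K / |g|. *)
Lemma goes_to_infinity_of_approx (g : R -> C) (rho : R -> R) (Fl : (R -> Prop) -> Prop)
    {FF : Filter Fl} theta K :
  0 <= K -> filterlim rho Fl (Rbar_locally p_infty) ->
  Fl (fun t => Cmod (Cminus (g t) (Cmult (RtoC (rho t)) (cos theta, sin theta))) <= K) ->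
  goes_to_infinity g Fl theta.
Proof.
intros HK Hrho Happ.
assert (E1 : Cmod (cos theta, sin theta) = 1).
{ replace (cos theta, sin theta) with ((1 * cos theta, 1 * sin theta) : C) by (f_equal; ring).
  apply Cmod_polar; lra. }
assert (Hmod : Fl (fun t => Rabs (Cmod (g t) - rho t) <= K /\
    Cmod (Cminus (g t) (Cmult (RtoC (rho t)) (cos theta, sin theta))) <= K)).
{ assert (H0 : Fl (fun t => 0 < rho t)) by (apply Hrho; exists 0; auto).
  refine (filter_imp _ _ _ (filter_and _ _ Happ H0)); intros t [Ht Ht0]; split; [|exact Ht].
  set (e := (cos theta, sin theta) : C) in *.
  assert (E2 : Cmod (Cmult (RtoC (rho t)) e) = rho t).
  { rewrite Cmod_mult, E1, Cmod_R, Rabs_pos_eq; lra. }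
  assert (T1 := Cmod_triangle (Cminus (g t) (Cmult (RtoC (rho t)) e)) (Cmult (RtoC (rho t)) e)).
  assert (T2 := Cmod_triangle (Copp (Cminus (g t) (Cmult (RtoC (rho t)) e))) (g t)).
  replace (Cplus (Cminus (g t) (Cmult (RtoC (rho t)) e)) (Cmult (RtoC (rho t)) e)) with (g t) in T1 by ring.
  replace (Cplus (Copp (Cminus (g t) (Cmult (RtoC (rho t)) e))) (g t)) with (Cmult (RtoC (rho t)) e) in T2 by ring.
  rewrite Cmod_opp in T2; apply Rabs_le; lra. }
assert (Hbig : forall B, Fl (fun t => B < Cmod (g t))).
{ intros B; assert (H0 : Fl (fun t => B + K < rho t)) by (apply Hrho; exists (B + K); auto).
  refine (filter_imp _ _ _ (filter_and _ _ Hmod H0)); intros t [[Ht _] Ht0].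
  apply Rabs_le_between in Ht; lra. }
split.
- intros P [B HB]; refine (filter_imp _ _ _ (Hbig B)); intros t Ht; apply HB, Ht.
- refine (proj2 (filterlim_norm_lt (V := C_NormedModule) Fl _ _) _); intros eps He.
  refine (filter_imp _ _ _ (filter_and _ _ Hmod (Hbig (2 * K / eps)))); intros t [[T1 T2] T3].
  assert (T0 : 0 <= 2 * K / eps) by (apply Rdiv_le_0_compat; lra).
  set (e := (cos theta, sin theta) : C) in *.
  change (Cmod (Cminus (Cdiv (g t) (RtoC (Cmod (g t)))) e) < eps).
  assert (Hn : RtoC (Cmod (g t)) <> RtoC 0) by (intros E; apply RtoC_inj in E; lra).
  replace (Cminus (Cdiv (g t) (RtoC (Cmod (g t)))) e) with
    (Cdiv (Cminus (Cminus (g t) (Cmult (RtoC (rho t)) e)) (Cmult (RtoC (Cmod (g t) - rho t)) e)) (RtoC (Cmod (g t)))).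
  2: { rewrite RtoC_minus; field; exact Hn. }
  rewrite Cmod_div by exact Hn; rewrite (Cmod_R (Cmod (g t))), Rabs_pos_eq by lra.
  apply Rlt_div_l; [lra|].
  apply Rle_lt_trans with (2 * K).
  + unfold Cminus at 1; apply Rle_trans with (1 := Cmod_triangle _ _).
    rewrite Cmod_opp, Cmod_mult, E1, Cmod_R; lra.
  + replace (2 * K) with (eps * (2 * K / eps)) by (field; lra).
    apply Rmult_lt_compat_l; lra.
Qed.

Lemma hcontour_goes_to_infinity :
  goes_to_infinity hcontour (Rbar_locally m_infty) (- psi) /\
  goes_to_infinity hcontour (Rbar_locally p_infty) psi.
Proof.
assert (Hbig : forall u B, B < Rabs u -> r * B / 2 < r * cosh u).
{ intros u B Hu; assert (A : Rabs u < 2 * cosh u).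
  { unfold cosh; unfold Rabs in *; destruct (Rcase_abs u) as [Hn|Hn].
    - assert (E := exp_ge_1_plus (- u) ltac:(lra)); assert (E2 := exp_pos u); lra.
    - assert (E := exp_ge_1_plus u ltac:(lra)); assert (E2 := exp_pos (- u)); lra. }
  nra. }
split; apply (goes_to_infinity_of_approx hcontour (fun u => r * cosh u) _ _ (3 * r)); try lra.
- intros P [B HB]; exists (Rmin 0 (- (2 * B / r))); intros u Hu; apply HB.
  assert (M1 := Rmin_l 0 (- (2 * B / r))); assert (M2 := Rmin_r 0 (- (2 * B / r))).
  replace B with (r * (2 * B / r) / 2) by (field; lra); apply Hbig; rewrite Rabs_left; lra.
- exists 0; intros u Hu; destruct (hcontour_approx u) as [_ A].
  apply Rle_trans with (1 := A).
  assert (E : Rabs (sinh u + cosh u) <= 1).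
  { replace (sinh u + cosh u) with (exp u) by (unfold sinh, cosh; field).
    rewrite Rabs_pos_eq by apply Rlt_le, exp_pos.
    left; rewrite <- exp_0; apply exp_increasing, Hu. }
  nra.
- intros P [B HB]; exists (Rmax 0 (2 * B / r)); intros u Hu; apply HB.
  assert (M1 := Rmax_l 0 (2 * B / r)); assert (M2 := Rmax_r 0 (2 * B / r)).
  replace B with (r * (2 * B / r) / 2) by (field; lra); apply Hbig; rewrite Rabs_pos_eq; lra.
- exists 0; intros u Hu; destruct (hcontour_approx u) as [A _].
  apply Rle_trans with (1 := A).
  assert (E : Rabs (sinh u - cosh u) <= 1).
  { replace (sinh u - cosh u) with (- exp (- u)) by (unfold sinh, cosh; field).
    rewrite Rabs_Ropp, Rabs_pos_eq by apply Rlt_le, exp_pos.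
    left; rewrite <- exp_0; apply exp_increasing; lra. }
  nra.
Qed.

(** Since cosh - |sinh| >= 1/(2 cosh), the correction 2/cosh^2 stays within this gap once cosh >= 4,
    and the point is in the sector. For cosh < 4 both coordinates are at most 4 r. The curve meets
    the real axis only at u = 0, at -r cos psi. *)
Lemma hcontour_region u : contour_region psi (10 * r) (hcontour u).
Proof.
assert (H := cosh_ge_1 u); destruct (inv_cosh_bounds u) as [I1 _].
destruct cos_sin_psi as [Hc Hs]; assert (E := cosh_sinh_sqr u).
split.
- destruct (Rle_lt_dec 4 (cosh u)) as [H4|H4].
  + left.
    assert (Hsh : Rabs (sinh u) <= cosh u - 2 / (cosh u * cosh u)).
    { assert (A : 2 / (cosh u * cosh u) <= / (2 * cosh u)).
      { apply Rle_div_l; [nra|]. 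
        replace (/ (2 * cosh u) * (cosh u * cosh u)) with (cosh u / 2) by (field; lra); lra. }
      assert (B : Rabs (sinh u) <= cosh u - / (2 * cosh u)).
      { apply Rsqr_incr_0_var.
        - rewrite <- Rsqr_abs; unfold Rsqr.
          replace ((cosh u - / (2 * cosh u)) * (cosh u - / (2 * cosh u)))
            with (cosh u * cosh u - 1 + / (2 * cosh u) * / (2 * cosh u)) by (field; lra).
          assert (J := Rle_0_sqr (/ (2 * cosh u))); unfold Rsqr in J; lra.
        - assert (/ (2 * cosh u) <= 1); [|lra].
          rewrite <- Rinv_1; apply Rinv_le_contravar; lra. }
      lra. }
    assert (Hre : 0 < cosh u - 2 / (cosh u * cosh u)) by (unfold Rdiv; lra).
    set (X := cosh u - 2 / (cosh u * cosh u)) in *.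
    assert (Hz : hcontour u <> RtoC 0).
    { intros E0; apply (f_equal Re) in E0; simpl in E0; fold X in E0.
      assert (0 < r * cos psi * X) by (apply Rmult_lt_0_compat; [nra|exact Hre]); lra. }
    assert (Hb := Carg_bounds _ Hz); assert (P := polar_form _ Hz).
    assert (Hm : 0 < Cmod (hcontour u)) by (apply Cmod_gt_0, Hz).
    set (theta := Carg (hcontour u)) in *; set (m := Cmod (hcontour u)) in *.
    assert (PR := f_equal Re P); assert (PI' := f_equal Im P); simpl in PR, PI'; fold X in PR.
    apply Rabs_le_between in Hsh.
    (* In polar form, |sinh u| <= X reads sin(theta - psi) <= 0 <= sin(theta + psi), which confines
       theta to [-psi, psi]. *)
    assert (Q1 : m * (sin theta * cos psi) <= m * (cos theta * sin psi)).
    { replace (m * (sin theta * cos psi)) with (m * sin theta * cos psi) by ring.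
      replace (m * (cos theta * sin psi)) with (m * cos theta * sin psi) by ring.
      rewrite <- PR, <- PI'.
      replace (r * sin psi * sinh u * cos psi) with (r * sin psi * cos psi * sinh u) by ring.
      replace (r * cos psi * X * sin psi) with (r * sin psi * cos psi * X) by ring.
      apply Rmult_le_compat_l; [|lra]. apply Rmult_le_pos; nra. }
    assert (Q2 : m * (cos theta * - sin psi) <= m * (sin theta * cos psi)).
    { replace (m * (sin theta * cos psi)) with (m * sin theta * cos psi) by ring.
      replace (m * (cos theta * - sin psi)) with (- (m * cos theta * sin psi)) by ring.
      rewrite <- PR, <- PI'.
      replace (r * sin psi * sinh u * cos psi) with (r * sin psi * cos psi * sinh u) by ring.
      replace (- (r * cos psi * X * sin psi)) with (r * sin psi * cos psi * - X) by ring.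
      apply Rmult_le_compat_l; [|lra]. apply Rmult_le_pos; nra. }
    apply Rmult_le_reg_l in Q1; [|exact Hm]; apply Rmult_le_reg_l in Q2; [|exact Hm].
    apply Rabs_le; split.
    * destruct (Rle_lt_dec (- psi) theta) as [|Hn]; [assumption|].
      assert (S := sin_lt_0_var (theta + psi) ltac:(lra) ltac:(lra)).
      rewrite sin_plus in S; lra.
    * destruct (Rle_lt_dec theta psi) as [|Hn]; [assumption|].
      assert (S := sin_gt_0 (theta - psi) ltac:(lra) ltac:(lra)).
      rewrite sin_minus in S; lra.
  + right; apply Rle_lt_trans with (1 := Cmod_le_Rabs _); simpl.
    rewrite !Rabs_mult, (Rabs_pos_eq r), (Rabs_pos_eq (cos psi)), (Rabs_pos_eq (sin psi)) by lra.
    assert (B1 : Rabs (cosh u - 2 / (cosh u * cosh u)) <= 4) by (apply Rabs_le; unfold Rdiv; lra).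
    assert (B2 := Rabs_sinh_le u).
    assert (B3 := Rabs_pos (cosh u - 2 / (cosh u * cosh u))); assert (B4 := Rabs_pos (sinh u)).
    assert (r * cos psi * Rabs (cosh u - 2 / (cosh u * cosh u)) <= r * 1 * 4)
      by (apply Rmult_le_compat; nra).
    assert (r * sin psi * Rabs (sinh u) <= r * 1 * 4) by (apply Rmult_le_compat; nra).
    lra.
- simpl; intros [A1 A2].
  assert (S0 : sinh u = 0).
  { apply Rmult_integral in A1; destruct A1 as [A1|A1]; [|exact A1].
    assert (0 < r * sin psi) by nra; lra. }
  rewrite (sinh_eq_0_cosh u S0) in A2.
  replace (r * cos psi * (1 - 2 / (1 * 1))) with (- (r * cos psi)) in A2 by field.
  assert (0 < r * cos psi) by nra; lra.
Qed.

Lemma hcontour_is_contour : is_contour psi (10 * r) hcontour dhcontour.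
Proof.
split; [|split; [exact hcontour_region|exact hcontour_goes_to_infinity]].
split; [|split].
- intros t; apply (ex_derive_continuous (V := C_R_NormedModule)); eexists; apply hcontour_is_derive.
- exists nil; intros t _; split; [apply hcontour_is_derive|apply continuous_dhcontour].
- intros t; split; exists (dhcontour t).
  + apply filterlim_filter_le_1 with (2 := continuous_dhcontour t).
    intros P [d Hd]; exists d; intros u Hu _; apply Hd, Hu.
  + apply filterlim_filter_le_1 with (2 := continuous_dhcontour t).
    intros P [d Hd]; exists d; intros u Hu _; apply Hd, Hu.
Qed.

Lemma dhcontour_le u : Cmod (dhcontour u) <= 6 * r * cosh u.
Proof.
assert (H := cosh_ge_1 u); destruct (inv_cosh_bounds u) as [_ I2]; destruct cos_sin_psi as [Hc Hs].
apply Rle_trans with (1 := Cmod_le_Rabs _); simpl.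
assert (B2 := Rabs_sinh_le u); assert (B4 := Rabs_pos (sinh u)).
replace (sinh u + 4 * sinh u / (cosh u * cosh u * cosh u)) with (sinh u * (1 + 4 * / (cosh u * cosh u * cosh u)))
  by (field; lra).
rewrite !Rabs_mult, (Rabs_pos_eq r), (Rabs_pos_eq (cos psi)), (Rabs_pos_eq (sin psi)),
  (Rabs_pos_eq (cosh u)), (Rabs_pos_eq (1 + _)) by lra.
assert (r * cos psi * (Rabs (sinh u) * (1 + 4 * / (cosh u * cosh u * cosh u))) <= r * 1 * (cosh u * 5)).
{ apply Rmult_le_compat; [nra|apply Rmult_le_pos; lra|nra|].
  apply Rmult_le_compat; lra. }
assert (r * sin psi * cosh u <= r * 1 * cosh u) by (apply Rmult_le_compat; nra).
lra.
Qed.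

(** For cosh >= 11/10 the imaginary part is large enough, below it the real part is. In the two
    ranges |sinh| and |cosh - 2/cosh^2| respectively are at least 2/5 cosh. *)
Lemma hcontour_ge : exists kappa, 0 < kappa /\ forall u, kappa * cosh u <= Cmod (hcontour u).
Proof.
destruct cos_sin_psi as [Hc Hs].
exists (2 / 5 * r * Rmin (cos psi) (sin psi)).
assert (M1 := Rmin_l (cos psi) (sin psi)); assert (M2 := Rmin_r (cos psi) (sin psi)).
assert (M3 : 0 < Rmin (cos psi) (sin psi)) by (apply Rmin_pos; lra).
split; [nra|]; intros u; assert (H := cosh_ge_1 u); assert (E := cosh_sinh_sqr u).
destruct (Rle_lt_dec (11 / 10) (cosh u)) as [Hu|Hu].
- apply Rle_trans with (2 := Rabs_Im_le _); simpl.
  rewrite !Rabs_mult, (Rabs_pos_eq r), (Rabs_pos_eq (sin psi)) by lra.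
  assert (B : 2 / 5 * cosh u <= Rabs (sinh u)).
  { apply Rsqr_incr_0_var; [|apply Rabs_pos]; rewrite <- Rsqr_abs; unfold Rsqr; nra. }
  replace (2 / 5 * r * Rmin (cos psi) (sin psi) * cosh u) with (r * Rmin (cos psi) (sin psi) * (2 / 5 * cosh u)) by ring.
  apply Rmult_le_compat; nra.
- apply Rle_trans with (2 := Rabs_Re_le _); simpl.
  rewrite !Rabs_mult, (Rabs_pos_eq r), (Rabs_pos_eq (cos psi)) by lra.
  assert (B : 2 / 5 * cosh u <= Rabs (cosh u - 2 / (cosh u * cosh u))).
  { assert (A : 2 / (121 / 100) <= 2 / (cosh u * cosh u)).
    { apply Rmult_le_compat_l; [lra|]; apply Rinv_le_contravar; nra. }
    rewrite Rabs_left; lra. }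
  replace (2 / 5 * r * Rmin (cos psi) (sin psi) * cosh u) with (r * Rmin (cos psi) (sin psi) * (2 / 5 * cosh u)) by ring.
  apply Rmult_le_compat; nra.
Qed.

End HyperbolicContour.

(** * Negative powers of a positive operator *)

Section PositiveOperators.

Context {V : NormedModule C_AbsRing}.
Variable cV : CompleteSpace.mixin_of V.
Variable A : operator V.

Local Notation BV := (BL_NormedModule V).
Local Notation rB := (real_NormedModule (BL_NormedModule V)).
Local Notation cB := (real_CompleteNormedModule (BL_NormedModule V) (bl_complete_mixin V cV)).
Local Notation res := (resolvent (op_opp A)).
Local Notation res_set := (resolvent_set (op_opp A)).

Section Constant.

Variable M : R.
Hypothesis hM : positivity_constant A M.

Lemma positive_resolvent_set s : 0 <= s -> res_set (RtoC s).
Proof. apply hM. Qed.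

(** The definition bounds the resolvent only for s > 0; the case s = 0 follows by letting s tend to
    0 in the resolvent identity. *)
Lemma positive_resolvent_bound s : 0 <= s -> (1 + s) * op_norm (res (RtoC s)) <= M.
Proof.
destruct hM as [H1 [H2 H3]].
intros [Hs|<-]; [apply H3, Hs|].
rewrite Rplus_0_r, Rmult_1_l.
set (N := op_norm (res (RtoC 0))); assert (HN : 0 <= N) by apply op_norm_ge_0.
apply le_epsilon; intros eps He.
destruct (small_factor eps (M * N) He) as [s [Hs Hs2]]; [nra|].
assert (B := H3 s Hs).
assert (P := op_norm_ge_0 (res (RtoC s))).
assert (Rs : op_norm (res (RtoC s)) <= M) by nra.
assert (E := resolvent_identity (op_opp A) (RtoC 0) (RtoC s) (H2 0 (Rle_refl _)) (H2 s ltac:(lra))).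
apply Rle_trans with (M + s * (N * M)); [|nra].
apply (norm_le_eq (V := BV) (plus (res (RtoC s))
   (scal (Cminus (RtoC s) (RtoC 0) : C_AbsRing) (bl_comp (res (RtoC 0)) (res (RtoC s)))))).
- etransitivity; [|exact (f_equal (fun D : BL V => plus (res (RtoC s)) D) E)]; module_ring (BL_NormedModule V).
- apply (norm_plus_compat (V := BV)); [exact Rs|].
  apply (norm_scal_compat (V := BV)).
  + rewrite <- RtoC_minus, Cmod_R, Rminus_0_r, Rabs_pos_eq; lra.
  + apply Rle_trans with (1 := op_norm_comp _ _); apply Rmult_le_compat; try assumption.
    apply Rle_refl.
Qed.

(** The shift moves the centre s of the disc to s + sigma without changing the distance, where the
    resolvent is at most M/(1 + s + sigma), so the bound is uniform in sigma. The constant 6 is 2 *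
    3: 1 + |z| <= 2 (1 + s), and the Neumann factor is 1/(1 - 2/3). *)
Lemma Omega_resolvent z sigma : Omega M z -> 0 <= sigma ->
  res_set (Cplus z (RtoC sigma)) /\ (1 + Cmod z) * op_norm (res (Cplus z (RtoC sigma))) <= 6 * M.
Proof.
assert (H1 : 1 <= M) by apply hM.
intros [s [Hs Hz]] Hsig.
assert (B := positive_resolvent_bound (s + sigma) ltac:(lra)).
set (N := op_norm (res (RtoC (s + sigma)))) in *; assert (HN : 0 <= N) by apply op_norm_ge_0.
assert (Hd : Cminus (Cplus z (RtoC sigma)) (RtoC (s + sigma)) = Cminus z (RtoC s))
  by (rewrite RtoC_plus; ring).
set (d := Cmod (Cminus z (RtoC s))) in *; assert (Hd0 : 0 <= d) by apply Cmod_ge_0.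
destruct (resolvent_norm_perturbation cV (op_opp A) (Cplus z (RtoC sigma)) (RtoC (s + sigma)) (2 / 3))
  as [R1 R2].
- apply positive_resolvent_set; lra.
- rewrite Hd; fold d N.
  apply Rmult_le_reg_r with (1 + (s + sigma)); [lra|].
  apply Rle_trans with (d * M).
  + rewrite Rmult_assoc, (Rmult_comm N); apply Rmult_le_compat_l; lra.
  + lra.
- lra.
- split; [exact R1|]; fold N in R2.
  set (N' := op_norm (res (Cplus z (RtoC sigma)))) in *; assert (HN' : 0 <= N') by apply op_norm_ge_0.
  assert (Hz2 : Cmod z <= d + s).
  { replace z with (Cplus (Cminus z (RtoC s)) (RtoC s)) by ring.
    apply Rle_trans with (1 := Cmod_triangle _ _); fold d; rewrite Cmod_R, Rabs_pos_eq; lra. }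
  assert (Hd2 : d <= 2 / 3 * (1 + s)) by nra.
  apply Rle_trans with (2 * (1 + s) * N'); [apply Rmult_le_compat_r; lra|].
  apply Rle_trans with (2 * (1 + s) * (3 * N)); [apply Rmult_le_compat_l; lra|].
  nra.
Qed.

Definition shifted_resolvent (sigma : R) (z : C) : BL V := res (Cplus z (RtoC sigma)).

Lemma shifted_resolvent_Cder sigma z : Omega M z -> 0 <= sigma ->
  Cder (W := BV) (shifted_resolvent sigma) z
    (opp (bl_comp (shifted_resolvent sigma z) (shifted_resolvent sigma z))).
Proof.
intros Hz Hs; destruct (Omega_resolvent z sigma Hz Hs) as [H _].
assert (D : Cder (W := C_NormedModule) (fun z => Cplus z (RtoC sigma)) z (RtoC 1)) by (apply Cder_affine; intros h; ring).
refine (Cder_eq _ _ _ _ _ (Cder_comp (W := BV) res _ _ _ _ D (Cder_resolvent cV (op_opp A) _ H))).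
unfold shifted_resolvent; module_ring (BL_NormedModule V).
Qed.

Lemma shifted_resolvent_sqr_Ccont sigma z : Omega M z -> 0 <= sigma ->
  Ccont (W := BV) (fun z => opp (bl_comp (shifted_resolvent sigma z) (shifted_resolvent sigma z))) z.
Proof.
intros Hz Hs; assert (D := Cder_Ccont _ _ _ (shifted_resolvent_Cder sigma z Hz Hs)).
intros eps He; destruct (Ccont_comp _ _ z D D eps He) as [d [Hd H]].
exists d; split; [exact Hd|]; intros z' Hz'.
apply Rle_lt_trans with (2 := H z' Hz').
rewrite norm_minus_sym; right; f_equal; module_ring (BL_NormedModule V).
Qed.

Lemma shifted_resolvent_bound sigma z : 0 <= sigma -> Omega M z ->
  (1 + Cmod z) * norm (shifted_resolvent sigma z : BV) <= 6 * M.
Proof. intros Hs Hz; apply (Omega_resolvent z sigma Hz Hs). Qed.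

Definition shifted_frac (sigma beta : R) (z : C) : BL V :=
  frac BV (shifted_resolvent sigma) beta z.

Lemma shifted_frac_integral_exists sigma beta : 0 <= sigma -> 0 < beta ->
  exists L : BL V, forall psi r0 g dg,
    0 < psi < aperture M -> 0 < r0 < 1 / (2 * M) -> is_contour psi r0 g dg ->
    is_RInt_gen (V := rB) (fun t => scal (dg t : C_AbsRing) (shifted_frac sigma beta (g t)))
      (Rbar_locally m_infty) (Rbar_locally p_infty) L.
Proof.
intros Hs Hb.
apply (frac_integral_exists BV (bl_complete_mixin V cV) M (proj1 hM) (shifted_resolvent sigma)
  (fun z => opp (bl_comp (shifted_resolvent sigma z) (shifted_resolvent sigma z))) (6 * M)); [| | |exact Hb].
- intros z Hz; apply shifted_resolvent_Cder; assumption.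
- intros z Hz; apply shifted_resolvent_sqr_Ccont; assumption.
- intros z Hz; apply shifted_resolvent_bound; assumption.
Qed.

(* Integrates the derivative of [(-z)^(-beta) (z + sigma + A)^-1]. *)
Lemma sqr_resolvent_integral sigma beta psi r0 g dg : 0 <= sigma -> - 1 < beta ->
  0 < psi < aperture M -> 0 < r0 < 1 / (2 * M) -> is_contour psi r0 g dg ->
  is_RInt_gen (V := rB) (fun t => scal (dg t : C_AbsRing)
     (minus (scal (RtoC beta : C_AbsRing) (shifted_frac sigma (beta + 1) (g t)))
        (scal (Crpower (Copp (g t)) (- beta) : C_AbsRing)
           (bl_comp (shifted_resolvent sigma (g t)) (shifted_resolvent sigma (g t))))))
      (Rbar_locally m_infty) (Rbar_locally p_infty) (zero : BL V).
Proof.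
intros Hs Hb Hpsi Hr0 Hc.
assert (I := dfrac_integral BV (bl_complete_mixin V cV) M (proj1 hM) (shifted_resolvent sigma)
  (fun z => opp (bl_comp (shifted_resolvent sigma z) (shifted_resolvent sigma z))) (6 * M)
  (fun z Hz => shifted_resolvent_Cder sigma z Hz Hs)
  (fun z Hz => shifted_resolvent_sqr_Ccont sigma z Hz Hs)
  (fun z Hz => shifted_resolvent_bound sigma z Hs Hz) beta psi r0 g dg Hb Hpsi Hr0 Hc).
refine (is_RInt_gen_ext (V := rB) _ _ _ _ I).
apply filter_forall; intros ab t _; unfold dfrac, shifted_frac, frac.
module_ring (BL_NormedModule V).
Qed.

(** A multiple of (-z)^(-beta) T is a decaying primitive. The lemma removes the resolvent-free term
    that appears when A^(-alpha-1) is factored. *)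
Lemma power_integral beta (T : BL V) psi r0 g dg : 0 < beta ->
  0 < psi < aperture M -> 0 < r0 < 1 / (2 * M) -> is_contour psi r0 g dg ->
  is_RInt_gen (V := rB) (fun t => scal (dg t : C_AbsRing)
     (scal (Crpower (Copp (g t)) (- (beta + 1)) : C_AbsRing) T))
      (Rbar_locally m_infty) (Rbar_locally p_infty) (zero : BL V).
Proof.
intros Hb Hpsi Hr0 Hc.
assert (I : is_RInt_gen (V := rB) (fun t => scal (dg t : C_AbsRing)
     (scal (Cmult (RtoC beta) (Crpower (Copp (g t)) (- beta - 1)) : C_AbsRing) T))
      (Rbar_locally m_infty) (Rbar_locally p_infty) (zero : BL V)).
{ apply (contour_integral_derivative BV (bl_complete_mixin V cV) M (proj1 hM)
    (fun z => scal (Crpower (Copp z) (- beta) : C_AbsRing) T)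
    (fun z => scal (Cmult (RtoC beta) (Crpower (Copp z) (- beta - 1)) : C_AbsRing) T)) with psi r0 beta (op_norm T);
    try assumption.
  - intros z [_ Hz].
    refine (Cder_eq _ _ _ _ _ (Cder_scal _ (fun _ => T : BV) _ _ _ (Cder_Crpower_opp z (- beta) Hz) (Cder_const T z))).
    rewrite Ropp_involutive; module_ring (BL_NormedModule V).
  - intros z [_ Hz]; apply (Ccont_scal (fun z => Cmult (RtoC beta) (Crpower (Copp z) (- beta - 1))) (fun _ => T : BV)).
    + apply (Ccont_scal (W := C_NormedModule) (fun _ => RtoC beta)); [|apply Ccont_Crpower_opp, Hz].
      apply Cder_Ccont with (1 := Cder_const (W := C_NormedModule) (RtoC beta) z).
    + apply Cder_Ccont with (1 := Cder_const (W := BV) T z).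
  - intros rho theta Hr _ _.
    refine (Rle_trans _ _ _ (Req_le _ _ (norm_scal_eq (V := BV) _ T)) _).
    rewrite Cmod_Crpower, Cmod_opp.
    unfold polar; rewrite Cmod_polar by lra; right; apply Rmult_comm. }
assert (L : is_linear (U := BV) (V := BV) (fun x => scal (Cinv (RtoC beta) : C_AbsRing) x)).
{ exact (is_linear_scal_r (K := C_AbsRing) (V := BV) (Cinv (RtoC beta)) Cmult_comm). }
assert (Hb0 : RtoC beta <> RtoC 0) by (intros E; apply RtoC_inj in E; lra).
refine (eq_rect _ (is_RInt_gen (V := rB) _ _ _) (is_RInt_gen_ext (V := rB) _ _ _ _ (is_RInt_gen_linear _ L _ _ _ _ I)) _ _).
- apply filter_forall; intros ab t _.
  replace (- (beta + 1)) with (- beta - 1) by ring.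
  module_coefs (BL_NormedModule V). field; exact Hb0.
- change (scal (Cinv (RtoC beta) : C_AbsRing) (zero : BV) = (zero : BV)); module_ring (BL_NormedModule V).
Qed.

Lemma shifted_frac_0 beta z : shifted_frac 0 beta z =
  scal (Crpower (Copp z) (- beta) : C_AbsRing) (res z).
Proof. unfold shifted_frac, frac, shifted_resolvent; rewrite Cplus_0_r; reflexivity. Qed.

Definition Ctwopii : C := Cmult (RtoC (2 * PI)) Ci.

Lemma Ctwopii_neq_0 : Ctwopii <> RtoC 0.
Proof.
apply Cmult_neq_0; [|apply Ci_nz].
intros E; apply RtoC_inj in E; assert (H := PI_RGT_0); lra.
Qed.

Lemma is_contour_integral_frac beta g dg (T : BL V) :
  is_contour_integral V A beta g dg T <->
  is_RInt_gen (V := rB) (fun t => scal (dg t : C_AbsRing) (shifted_frac 0 beta (g t)))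
      (Rbar_locally m_infty) (Rbar_locally p_infty) (scal (Ctwopii : C_AbsRing) T : BL V).
Proof.
assert (E : forall t, scal (Cmult (dg t) (Crpower (Copp (g t)) (- beta)) : C_AbsRing) (res (g t)) =
   scal (dg t : C_AbsRing) (shifted_frac 0 beta (g t)) :> BL V).
{ intros t; rewrite shifted_frac_0; module_ring (BL_NormedModule V). }
split.
- intros [I [HI HT]].
  refine (eq_rect _ (is_RInt_gen (V := rB) _ _ _) (is_RInt_gen_ext (V := rB) _ _ _ _ HI) _ _).
  + apply filter_forall; intros ab t _; apply E.
  + rewrite HT; fold Ctwopii; module_coefs (BL_NormedModule V); field; apply Ctwopii_neq_0.
- intros H; exists (scal (Ctwopii : C_AbsRing) T); split.
  + refine (is_RInt_gen_ext (V := rB) _ _ _ _ H).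
    apply filter_forall; intros ab t _; symmetry; apply E.
  + fold Ctwopii; module_coefs (BL_NormedModule V); field; apply Ctwopii_neq_0.
Qed.

(** Data of one fixed admissible contour. The disc of [hcontour_region] has radius 10 r, so r =
    1/(40 M) makes it half of the bound 1/(2 M). *)
Definition std_psi : R := aperture M / 2.
Definition std_r : R := 1 / (40 * M).
Definition std_g : R -> C := hcontour std_psi std_r.
Definition std_dg : R -> C := dhcontour std_psi std_r.

Lemma std_psi_bounds : 0 < std_psi < aperture M.
Proof. assert (H := aperture_bounds M (proj1 hM)); unfold std_psi; lra. Qed.

Lemma std_r_bounds : 0 < 10 * std_r < 1 / (2 * M).
Proof.
assert (H := inv_2M_bounds M (proj1 hM)); assert (H1 := proj1 hM).
assert (E : 10 * std_r = 1 / (2 * M) / 2) by (unfold std_r; field; lra); lra.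
Qed.

Lemma std_is_contour : is_contour std_psi (10 * std_r) std_g std_dg.
Proof.
assert (H := aperture_bounds M (proj1 hM)); assert (H1 := std_psi_bounds); assert (H2 := std_r_bounds).
apply hcontour_is_contour; lra.
Qed.

End Constant.

Lemma is_RInt_gen_bl_unique (f : R -> BL V) (S T : BL V) :
  is_RInt_gen (V := rB) f (Rbar_locally m_infty) (Rbar_locally p_infty) S ->
  is_RInt_gen (V := rB) f (Rbar_locally m_infty) (Rbar_locally p_infty) T -> S = T.
Proof.
intros HS HT.
apply (filterlimi_locally_unique (V := rB) (F := filter_prod (Rbar_locally m_infty) (Rbar_locally p_infty))
  (fun ab => is_RInt (V := rB) f (fst ab) (snd ab)) S T); [|exact HS|exact HT].
apply filter_forall; intros ab y1 y2 H1 H2; exact (filterlim_locally_unique (V := rB) _ _ _ H1 H2).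
Qed.

Lemma contour_integral_unique beta g dg (S T : BL V) :
  is_contour_integral V A beta g dg S -> is_contour_integral V A beta g dg T -> S = T.
Proof.
intros [I [HI ->]] [J [HJ ->]]; rewrite (is_RInt_gen_bl_unique _ I J HI HJ); reflexivity.
Qed.

Lemma contour_integral_value M beta : positivity_constant A M -> 0 < beta ->
  exists T, forall psi r0 g dg,
    0 < psi < aperture M -> 0 < r0 < 1 / (2 * M) -> is_contour psi r0 g dg ->
    is_contour_integral V A beta g dg T.
Proof.
intros hM Hb.
destruct (shifted_frac_integral_exists M hM 0 beta (Rle_refl _) Hb) as [L HL].
exists (scal (Cinv Ctwopii : C_AbsRing) L); intros psi r0 g dg H1 H2 H3.
apply is_contour_integral_frac.
refine (eq_rect _ (is_RInt_gen (V := rB) _ _ _) (HL psi r0 g dg H1 H2 H3) _ _).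
module_coefs (BL_NormedModule V); field; apply Ctwopii_neq_0.
Qed.

Lemma admissible_mono M m psi r0 : 1 <= m -> m <= M ->
  0 < psi < aperture M -> 0 < r0 < 1 / (2 * M) -> 0 < psi < aperture m /\ 0 < r0 < 1 / (2 * m).
Proof.
intros H1 H2 Hpsi Hr0.
assert (I : 1 / (2 * M) <= 1 / (2 * m)).
{ unfold Rdiv; rewrite !Rmult_1_l; apply Rinv_le_contravar; lra. }
split; [|lra].
assert (IM := inv_2M_bounds M ltac:(lra)); assert (Im := inv_2M_bounds m H1).
split; [lra|]; apply Rlt_le_trans with (aperture M); [lra|].
unfold aperture; apply Rnot_lt_le; intros Hlt.
assert (B0 := asin_bound (1 / (2 * m))); assert (B1 := asin_bound (1 / (2 * M))).
assert (C1 := sin_increasing_1 _ _ (proj1 B0) (proj2 B0) (proj1 B1) (proj2 B1) Hlt).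
rewrite !sin_asin in C1; lra.
Qed.

(** One value has to serve every positivity constant. A larger constant admits fewer data; for a
    smaller constant, the standard contour of the larger one is admissible for both, and uniqueness
    of its integral identifies the two values. *)
Lemma is_neg_power_exists M beta : positivity_constant A M -> 0 < beta ->
  exists T, is_neg_power A beta T.
Proof.
intros hM Hb; destruct (contour_integral_value M beta hM Hb) as [T HT].
exists T; intros M' psi r0 g dg hM' Hpsi Hr0 Hc.
destruct (Rle_lt_dec M M') as [Hle|Hlt].
- destruct (admissible_mono M' M psi r0 (proj1 hM) Hle Hpsi Hr0) as [A1 A2].
  apply (HT psi r0); assumption.
- destruct (contour_integral_value M' beta hM' Hb) as [T' HT'].
  replace T with T'; [apply (HT' psi r0); assumption|].
  destruct (admissible_mono M M' _ _ (proj1 hM') (Rlt_le _ _ Hlt) (std_psi_bounds M hM) (std_r_bounds M hM)) as [A1 A2].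
  apply contour_integral_unique with beta (std_g M) (std_dg M).
  + apply (HT' _ _ _ _ A1 A2), std_is_contour, hM.
  + apply (HT _ _ _ _ (std_psi_bounds M hM) (std_r_bounds M hM)), std_is_contour, hM.
Qed.

Lemma neg_power_spec M beta : positivity_constant A M -> 0 < beta ->
  is_neg_power A beta (neg_power A beta).
Proof. intros hM Hb; exact (epsilon_spec _ _ (is_neg_power_exists M beta hM Hb)). Qed.

(** The chosen [neg_power] is known only through admissible contours; since [std_g] is one of them,
    its integral alone determines the operator. *)
Lemma neg_power_eq M beta (T : BL V) : positivity_constant A M -> 0 < beta ->
  is_contour_integral V A beta (std_g M) (std_dg M) T -> neg_power A beta = T.
Proof.
intros hM Hb HT; apply contour_integral_unique with beta (std_g M) (std_dg M); [|exact HT].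
exact (neg_power_spec M beta hM Hb M (std_psi M) (10 * std_r M) _ _ hM
  (std_psi_bounds M hM) (std_r_bounds M hM) (std_is_contour M hM)).
Qed.

Lemma neg_power_std_integral M beta : positivity_constant A M -> 0 < beta ->
  is_RInt_gen (V := rB) (fun t => scal (std_dg M t : C_AbsRing) (shifted_frac 0 beta (std_g M t)))
      (Rbar_locally m_infty) (Rbar_locally p_infty) (scal (Ctwopii : C_AbsRing) (neg_power A beta) : BL V).
Proof.
intros hM Hb; apply is_contour_integral_frac.
apply (neg_power_spec M beta hM Hb M (std_psi M) (10 * std_r M) _ _ hM
  (std_psi_bounds M hM) (std_r_bounds M hM) (std_is_contour M hM)).
Qed.

End PositiveOperators.

(** * The residue at - s *)

Definition C_complete_mixin : CompleteSpace.mixin_of C_NormedModule := C_CompleteSpace_mixin.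

Lemma Carg_RtoC s : 0 < s -> Carg (RtoC s) = 0.
Proof.
intros Hs; transitivity (Carg (s * cos 0, s * sin 0)).
2: { apply Carg_polar; [exact Hs|assert (H := PI_RGT_0); lra]. }
f_equal; apply Ceq; simpl; [rewrite cos_0|rewrite sin_0]; ring.
Qed.

Lemma Crpower_RtoC s a : 0 < s -> Crpower (RtoC s) a = RtoC (Rpower s a).
Proof.
intros Hs; unfold Crpower; rewrite Carg_RtoC, Rmult_0_r, cos_0, sin_0, Cmod_R, Rabs_pos_eq by lra.
apply Ceq; simpl; ring.
Qed.

Section Residue.

Variables s beta : R.
Hypothesis Hs : 0 < s.
Hypothesis Hbeta : 0 < beta.

Local Notation D := (fun z => slit (Copp z)).
Local Notation p := (RtoC (- s)).
Local Notation CC := C_NormedModule.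

(** A family closed under differentiation, so that the successive derivatives of (-z)^(-beta) are
    all covered by one lemma. *)
Definition pow_deriv (k : C) (a : R) (z : C) : C := Cmult k (Crpower (Copp z) a).

Lemma pow_deriv_Cder k a z : D z ->
  Cder (W := CC) (pow_deriv k a) z (pow_deriv (Cmult k (RtoC (- a))) (a - 1) z).
Proof.
intros Hz.
assert (L : is_linear (U := CC) (V := CC) (fun x => scal (k : C_AbsRing) x)).
{ exact (is_linear_scal_r (K := C_AbsRing) (V := CC) k Cmult_comm). }
refine (Cder_eq (W := CC) _ _ _ _ _ (Cder_linear _ L _ _ _ (Cder_Crpower_opp z a Hz))).
unfold pow_deriv; change (Cmult k (Cmult (RtoC (- a)) (Crpower (Copp z) (a - 1))) =
  Cmult (Cmult k (RtoC (- a))) (Crpower (Copp z) (a - 1))); ring.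
Qed.

Lemma pow_deriv_Ccont k a z : D z -> Ccont (W := CC) (pow_deriv k a) z.
Proof. intros Hz; apply Cder_Ccont with (1 := pow_deriv_Cder k a z Hz). Qed.

Lemma D_open z : D z -> exists d, 0 < d /\ forall z', Cmod (Cminus z' z) < d -> D z'.
Proof.
intros Hz; destruct (slit_open _ Hz) as [d [Hd H]]; exists d; split; [exact Hd|].
intros z' Hz'; apply H; replace (Cminus (Copp z') (Copp z)) with (Copp (Cminus z' z)) by ring.
rewrite Cmod_opp; exact Hz'.
Qed.

Lemma D_star z t : D z -> 0 <= t <= 1 -> D (segment p z t).
Proof.
intros Hz Ht [A1 A2]; apply Hz; revert A1 A2; unfold segment; destruct z as [x y]; simpl; intros A1 A2.
assert (A3 : t * y = 0) by lra.
assert (A4 : (1 - t) * s <= t * x) by lra.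
assert (A5 : t <> 0) by (intros E; rewrite E in A4; lra).
split; [nra|].
assert (0 <= t * x) by (apply Rle_trans with (2 := A4); apply Rmult_le_pos; lra); nra.
Qed.

Local Notation f := (pow_deriv (RtoC 1) (- beta)).
Local Notation f1 := (pow_deriv (Cmult (RtoC 1) (RtoC (- - beta))) (- beta - 1)).

(** The divided difference (f(z) - f(p)) / (z - p) at p = -s. The integral of f' along the segment
    defines it at [p] as well, so no removable singularity has to be discussed. *)
Definition quotient : C -> C := wint CC C_complete_mixin p (fun _ => 1) f1.
Definition quotient_primitive : C -> C := star_primitive CC C_complete_mixin p quotient.

Lemma quotient_eq z : D z -> Cmult (Cplus z (RtoC s)) (quotient z) = Cminus (f z) (f p).
Proof.
intros Hz.
assert (I := wint_correct CC C_complete_mixin D p D_star (fun _ => 1) f1 z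
  (fun t => continuous_const _ _) (fun w Hw => pow_deriv_Ccont _ _ w Hw) Hz).
assert (L : is_linear (U := CC) (V := CC) (fun x => scal (Cminus z p : C_AbsRing) x)).
{ exact (is_linear_scal_r (K := C_AbsRing) (V := CC) (Cminus z p) Cmult_comm). }
assert (I2 := is_RInt_linear _ L _ _ _ _ I).
assert (I3 : is_RInt (V := real_NormedModule CC) (fun t => scal (Cminus z p : C_AbsRing) (f1 (segment p z t) : CC)) 0 1
  (minus (f (segment p z 1) : CC) (f (segment p z 0)))).
{ apply (is_RInt_curve_derivative CC C_complete_mixin f f1 (segment p z) (fun _ => Cminus z p)).
  intros t Ht; rewrite Rmin_left, Rmax_right in Ht by lra.
  split; [apply segment_is_derive|split; [apply continuous_const|split]].
  - apply pow_deriv_Cder, D_star; assumption.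
  - apply pow_deriv_Ccont, D_star; assumption. }
assert (I4 : is_RInt (V := real_NormedModule CC) (fun t => scal (Cminus z p : C_AbsRing) (f1 (segment p z t) : CC)) 0 1
   (scal (Cminus z p : C_AbsRing) (quotient z : CC))).
{ refine (is_RInt_ext (V := real_NormedModule CC) _ _ _ _ _ _ I2); intros t _.
  change (Cmult (Cminus z p) (Cmult (RtoC 1) (f1 (segment p z t))) = Cmult (Cminus z p) (f1 (segment p z t))).
  ring. }
assert (E := filterlim_locally_unique (V := real_NormedModule CC) _ _ _ I4 I3).
replace (segment p z 1) with z in E by (unfold segment; ring).
replace (segment p z 0) with p in E by (unfold segment; ring).
replace (Cplus z (RtoC s)) with (Cminus z p) by (rewrite RtoC_opp; ring).
exact E.
Qed.

(** The construction of a primitive requires [quotient] to have a continuous derivative. Two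
    differentiations under the integral supply it, which brings in the second and third derivatives
    [f2] and [f3] of the power. *)
Lemma quotient_primitive_Cder z : D z -> Cder (W := CC) quotient_primitive z (quotient z) /\
  Ccont (W := CC) quotient z.
Proof.
intros Hz.
set (f2 := pow_deriv (Cmult (Cmult (RtoC 1) (RtoC (- - beta))) (RtoC (- (- beta - 1)))) (- beta - 1 - 1)).
set (f3 := pow_deriv (Cmult (Cmult (Cmult (RtoC 1) (RtoC (- - beta))) (RtoC (- (- beta - 1)))) (RtoC (- (- beta - 1 - 1)))) (- beta - 1 - 1 - 1)).
assert (C1 : forall t, continuous (fun _ : R => 1) t) by (intros t; apply continuous_const).
assert (C2 : forall t, continuous (fun t : R => t * 1) t).
{ intros t; apply continuous_ext with (fun t : R => t); [intros u; exact (eq_sym (Rmult_1_r u))|apply continuous_id]. }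
assert (D1 : forall w, D w -> Cder (W := CC) quotient w (wint CC C_complete_mixin p (fun t => t * 1) f2 w)).
{ intros w Hw; apply (wint_Cder CC C_complete_mixin D D_open p D_star (fun _ => 1) f1 f2); auto.
  - intros t _; rewrite Rabs_pos_eq; lra.
  - intros; apply pow_deriv_Cder; assumption.
  - intros; apply pow_deriv_Ccont; assumption. }
split; [|apply Cder_Ccont with (1 := D1 z Hz)].
apply (star_primitive_Cder CC C_complete_mixin D D_open p D_star quotient
   (wint CC C_complete_mixin p (fun t => t * 1) f2)); auto.
intros w Hw; apply Cder_Ccont with (wint CC C_complete_mixin p (fun t => t * (t * 1)) f3 w).
apply (wint_Cder CC C_complete_mixin D D_open p D_star (fun t => t * 1) f2 f3); auto.
- intros t Ht; rewrite Rabs_pos_eq; lra.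
- intros; apply pow_deriv_Cder; assumption.
- intros; apply pow_deriv_Ccont; assumption.
Qed.

Definition cauchy_kernel (z : C) : C := Cdiv (Crpower (Copp z) (- beta)) (Cplus (RtoC s) z).

(** The kernel is the divided difference plus f(p)/(s + z); a primitive of the latter is a multiple
    of the logarithm, which carries the residue. *)
Definition cauchy_primitive (z : C) : C :=
  Cplus (quotient_primitive z) (Cmult (f p) (Clog (Cplus (RtoC s) z))).

Lemma f_p : f p = RtoC (Rpower s (- beta)).
Proof.
unfold pow_deriv; rewrite Cmult_1_l, RtoC_opp.
replace (Copp (Copp (RtoC s))) with (RtoC s) by ring; apply Crpower_RtoC, Hs.
Qed.

Lemma cauchy_primitive_Cder z : D z -> slit (Cplus (RtoC s) z) ->
  Cder (W := CC) cauchy_primitive z (cauchy_kernel z) /\ Ccont (W := CC) cauchy_kernel z.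
Proof.
intros Hz Hsz; assert (Hn := slit_neq_0 _ Hsz).
assert (Dt : Cder (W := CC) (fun z => Cplus (RtoC s) z) z (RtoC 1)) by (apply Cder_affine; intros h; ring).
assert (L : is_linear (U := CC) (V := CC) (fun x => scal (f p : C_AbsRing) x)).
{ exact (is_linear_scal_r (K := C_AbsRing) (V := CC) (f p) Cmult_comm). }
assert (Dl := Cder_linear _ L _ _ _ (Cder_comp (W := CC) Clog _ _ _ _ Dt (Cder_Clog _ Hsz))).
destruct (quotient_primitive_Cder z Hz) as [Dq _].
split.
- refine (Cder_eq (W := CC) _ _ _ _ _ (Cder_plus (W := CC) _ _ _ _ _ Dq Dl)).
  change (Cplus (quotient z) (Cmult (f p) (Cmult (RtoC 1) (Cinv (Cplus (RtoC s) z)))) = cauchy_kernel z).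
  assert (E := quotient_eq z Hz).
  unfold cauchy_kernel; replace (Crpower (Copp z) (- beta)) with (f z) by (unfold pow_deriv; ring).
  replace (f z) with (Cplus (Cmult (Cplus z (RtoC s)) (quotient z)) (f p)) by (rewrite E; ring).
  field; exact Hn.
- assert (Hi := Cder_comp (W := CC) (fun z => Crpower z (-1)) _ _ _ _ Dt (Cder_Crpower _ (-1) Hsz)).
  assert (Cc := Ccont_scal (W := CC) f _ z (pow_deriv_Ccont _ _ z Hz) (Cder_Ccont _ _ _ Hi)).
  intros eps He; destruct (Cc eps He) as [d1 [Hd1 H1]].
  destruct (slit_open _ Hsz) as [d2 [Hd2 H2]].
  exists (Rmin d1 d2); split; [apply Rmin_pos; assumption|]; intros z' Hz'.
  assert (Hsz' : slit (Cplus (RtoC s) z')).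
  { apply H2; replace (Cminus (Cplus (RtoC s) z') (Cplus (RtoC s) z)) with (Cminus z' z) by ring.
    apply (Rlt_le_trans _ _ _ Hz'), Rmin_r. }
  (* On the slit domain 1/(s + w) is the power with exponent -1, whose continuity is already
     established. *)
  assert (K : forall w, slit (Cplus (RtoC s) w) ->
     cauchy_kernel w = Cmult (f w) (Crpower (Cplus (RtoC s) w) (-1))).
  { intros w Hw; assert (Hw0 := slit_neq_0 _ Hw).
    replace (-1) with (0 - 1) by ring; rewrite Crpower_pred by exact Hw0.
    assert (E0 : Crpower (Cplus (RtoC s) w) 0 = RtoC 1).
    { unfold Crpower; rewrite Rmult_0_l, cos_0, sin_0, Rpower_O by (apply Cmod_gt_0, Hw0).
      apply Ceq; simpl; ring. }
    rewrite E0; unfold cauchy_kernel, pow_deriv; field; exact Hw0. }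
  rewrite (K z Hsz), (K z' Hsz').
  apply H1, (Rlt_le_trans _ _ _ Hz'), Rmin_l.
Qed.

Lemma polar_sin_neq_0 rho theta : 0 < rho -> sin theta <> 0 ->
  slit (polar rho theta) /\ D (Cminus (polar rho theta) (RtoC s)).
Proof.
intros Hr Hn; split; intros [A _]; simpl in A; apply Hn; nra.
Qed.

(** Recentred at -s: in the variable zeta = s + z the logarithm is cut along the negative axis, and
    the two half-planes are 0 < theta < pi and 0 < -theta < pi. *)
Definition shifted_primitive (zeta : C) : C := cauchy_primitive (Cminus zeta (RtoC s)).

(** For rho >= 2 s the point z = zeta - s has modulus at least rho/2, so |z|^(-beta) <= 2^beta
    rho^(-beta). *)
Lemma shifted_primitive_bound rho theta : 2 * s <= rho -> sin theta <> 0 ->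
  Cder (W := CC) shifted_primitive (polar rho theta) (cauchy_kernel (Cminus (polar rho theta) (RtoC s))) /\
  Ccont (W := CC) (fun zeta => cauchy_kernel (Cminus zeta (RtoC s))) (polar rho theta) /\
  norm (cauchy_kernel (Cminus (polar rho theta) (RtoC s)) : CC) <= Rpower 2 beta * Rpower rho (- beta - 1).
Proof.
intros Hr Hn; destruct (polar_sin_neq_0 rho theta ltac:(lra) Hn) as [S1 S2].
set (z := Cminus (polar rho theta) (RtoC s)).
assert (Ez : Cplus (RtoC s) z = polar rho theta) by (unfold z; ring).
destruct (cauchy_primitive_Cder z S2) as [A1 A2]; [rewrite Ez; exact S1|].
assert (Dt : Cder (W := CC) (fun z => Cminus z (RtoC s)) (polar rho theta) (RtoC 1)) by (apply Cder_affine; intros h; ring).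
split; [|split].
- refine (Cder_eq (W := CC) _ _ _ _ _ (Cder_comp (W := CC) cauchy_primitive _ _ _ _ Dt A1)).
  exact (Cmult_1_l _).
- intros eps He; destruct (A2 eps He) as [d [Hd H]]; exists d; split; [exact Hd|].
  intros w Hw; apply H; unfold z.
  replace (Cminus (Cminus w (RtoC s)) (Cminus (polar rho theta) (RtoC s))) with (Cminus w (polar rho theta)) by ring.
  exact Hw.
- change (Cmod (cauchy_kernel z) <= Rpower 2 beta * Rpower rho (- beta - 1)).
  assert (Hp0 : polar rho theta <> RtoC 0) by (apply slit_neq_0, S1).
  assert (Hm : Cmod (polar rho theta) = rho) by (apply Cmod_polar; lra).
  unfold cauchy_kernel; rewrite Ez, Cmod_div by exact Hp0.
  rewrite Cmod_Crpower, Cmod_opp, Hm.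
  assert (Hz : rho / 2 <= Cmod z).
  { assert (T := Cmod_triangle z (RtoC s)).
    replace (Cplus z (RtoC s)) with (polar rho theta) in T by (unfold z; ring).
    rewrite Hm, Cmod_R, Rabs_pos_eq in T by lra; lra. }
  apply Rle_div_l; [lra|].
  rewrite Rmult_assoc.
  replace (Rpower rho (- beta - 1) * rho) with (Rpower rho (- beta)).
  2: { rewrite <- (Rpower_1 rho) at 3 by lra; rewrite <- Rpower_plus; f_equal; ring. }
  rewrite !Rpower_Ropp.
  apply Rmult_le_reg_r with (Rpower (Cmod z) beta); [apply exp_pos|].
  rewrite Rinv_l by (apply Rgt_not_eq, exp_pos).
  apply Rmult_le_reg_r with (Rpower rho beta); [apply exp_pos|].
  replace (Rpower 2 beta * / Rpower rho beta * Rpower (Cmod z) beta * Rpower rho beta)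
    with (Rpower 2 beta * Rpower (Cmod z) beta) by (field; apply Rgt_not_eq, exp_pos).
  rewrite Rpower_mult_distr by lra; rewrite Rmult_1_l; apply Rle_Rpower_l; lra.
Qed.

Lemma shifted_primitive_limit sg : sg = 1 \/ sg = -1 ->
  exists L : C, forall rho theta, 2 * s <= rho -> 0 < sg * theta < PI ->
    Cmod (Cminus (shifted_primitive (polar rho theta)) L)
    <= Rpower 2 beta * (/ beta + 8) * Rpower rho (- beta).
Proof.
intros Hsg.
assert (HPI := PI_4); assert (HPI0 := PI_RGT_0).
apply (limit_at_infinity CC C_complete_mixin shifted_primitive (fun zeta => cauchy_kernel (Cminus zeta (RtoC s)))
  (fun theta => 0 < sg * theta < PI) (2 * s) beta (Rpower 2 beta)); [lra|exact Hbeta| | |].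
- intros a b c Ha Hb Hc; destruct Hsg as [-> | ->]; lra.
- intros a Ha; apply Rabs_le; destruct Hsg as [-> | ->]; lra.
- intros rho theta Hr Ht; apply shifted_primitive_bound; [exact Hr|].
  destruct Hsg as [-> | ->].
  + apply Rgt_not_eq, sin_gt_0; lra.
  + apply Rlt_not_eq, sin_lt_0_var; lra.
Qed.

(* Across the negative axis only the logarithm jumps. *)
Lemma shifted_primitive_jump Lp Lm K : 0 <= K ->
  (forall rho theta, 2 * s <= rho -> 0 < theta < PI ->
     Cmod (Cminus (shifted_primitive (polar rho theta)) Lp) <= K * Rpower rho (- beta)) ->
  (forall rho theta, 2 * s <= rho -> 0 < - theta < PI ->
     Cmod (Cminus (shifted_primitive (polar rho theta)) Lm) <= K * Rpower rho (- beta)) ->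
  Cminus Lp Lm = Cmult Ctwopii (RtoC (Rpower s (- beta))).
Proof.
intros HK Hp Hm; rewrite <- f_p.
apply (norm_minus_arbitrarily_small (V := CC)); intros eps He.
(* Five errors: two from the limits at infinity, two from the continuity of [quotient_primitive],
   and one because the angles pi - eta and -(pi - eta) differ by 2 eta less than 2 pi. *)
destruct (Rpower_neg_small beta K (eps / 5) Hbeta HK ltac:(lra)) as [B [HB1 HB]].
set (rho := Rmax B (2 * s)).
assert (Hr1 : B <= rho) by apply Rmax_l; assert (Hr2 : 2 * s <= rho) by apply Rmax_r.
(* A point of the negative axis beyond -s, approached from both sides at the angles plus and minus
   (pi - eta): [quotient_primitive] is continuous there, the logarithm is not. *)
set (w0 := Cminus (polar rho PI) (RtoC s)).
assert (HPI := PI_RGT_0).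
assert (Hw0 : D w0).
{ intros [_ A]; unfold w0, polar in A; simpl in A; rewrite cos_PI in A; lra. }
destruct (Cder_Ccont _ _ _ (proj1 (quotient_primitive_Cder w0 Hw0)) (eps / 5)) as [d [Hd Hcont]]; [lra|].
assert (Hfp := Cmod_ge_0 (f p)).
destruct (small_factor (eps / 5) (2 * Cmod (f p))) as [e1 [He1 He1']]; [lra|lra|].
destruct (small_factor (d / 2) (2 * rho)) as [e2 [He2 He2']]; [lra|lra|].
set (eta := Rmin (Rmin e1 e2) (PI / 2)).
assert (N1 := Rmin_l (Rmin e1 e2) (PI / 2)); assert (N2 := Rmin_r (Rmin e1 e2) (PI / 2)).
assert (N3 := Rmin_l e1 e2); assert (N4 := Rmin_r e1 e2).
assert (Heta : 0 < eta) by (repeat apply Rmin_pos; lra).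
fold eta in N1, N2.
assert (Hclose : forall sg, sg = 1 \/ sg = -1 ->
   Cmod (Cminus (Cminus (polar rho (sg * (PI - eta))) (RtoC s)) w0) < d).
{ intros sg Hsg; unfold w0.
  replace (Cminus (Cminus (polar rho (sg * (PI - eta))) (RtoC s)) (Cminus (polar rho PI) (RtoC s)))
    with (Cminus (polar rho (sg * (PI - eta))) (polar rho PI)) by ring.
  assert (E : Cminus (polar rho (sg * (PI - eta))) (polar rho PI) = (- (rho * (cos eta - 1)), rho * (sg * sin eta))).
  { unfold polar; destruct Hsg as [-> | ->]; apply Ceq; simpl.
    - rewrite Rmult_1_l, cos_minus, cos_PI, sin_PI; ring.
    - rewrite Rmult_1_l, sin_minus, cos_PI, sin_PI; ring.
    - replace (-1 * (PI - eta)) with (- (PI - eta)) by ring; rewrite cos_neg, cos_minus, cos_PI, sin_PI; ring.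
    - replace (-1 * (PI - eta)) with (- (PI - eta)) by ring; rewrite sin_neg, sin_minus, cos_PI, sin_PI; ring. }
  rewrite E; apply Rle_lt_trans with (1 := Cmod_le_Rabs _); simpl.
  assert (C1 := Rabs_cos_minus_1 eta); assert (C2 := Rabs_sin_le eta).
  rewrite (Rabs_pos_eq eta) in C1, C2 by lra.
  rewrite Rabs_Ropp, !Rabs_mult, (Rabs_pos_eq rho) by lra.
  replace (Rabs sg) with 1 by (destruct Hsg as [-> | ->]; [rewrite Rabs_pos_eq|rewrite Rabs_left]; lra).
  nra. }
assert (Q1 := Hcont _ (Hclose 1 (or_introl eq_refl))).
assert (Q2 := Hcont _ (Hclose (-1) (or_intror eq_refl))).
change (Cmod (Cminus (quotient_primitive (Cminus (polar rho (1 * (PI - eta))) (RtoC s))) (quotient_primitive w0)) < eps / 5) in Q1.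
change (Cmod (Cminus (quotient_primitive (Cminus (polar rho (-1 * (PI - eta))) (RtoC s))) (quotient_primitive w0)) < eps / 5) in Q2.
assert (P1 := Hp rho (1 * (PI - eta)) Hr2 ltac:(lra)).
assert (P2 := Hm rho (-1 * (PI - eta)) Hr2 ltac:(lra)).
assert (Hbnd := HB rho Hr1).
assert (HL : forall sg, sg = 1 \/ sg = -1 ->
   shifted_primitive (polar rho (sg * (PI - eta))) =
   Cplus (quotient_primitive (Cminus (polar rho (sg * (PI - eta))) (RtoC s)))
     (Cmult (f p) (Cplus (RtoC (ln rho)) (Cmult Ci (RtoC (sg * (PI - eta))))))).
{ intros sg Hsg; unfold shifted_primitive, cauchy_primitive; do 2 f_equal.
  replace (Cplus (RtoC s) (Cminus (polar rho (sg * (PI - eta))) (RtoC s))) with (polar rho (sg * (PI - eta))) by ring.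
  unfold Clog; unfold polar at 1; rewrite Cmod_polar by lra.
  unfold polar; rewrite Carg_polar; [|lra|destruct Hsg as [-> | ->]; lra].
  apply Ceq; simpl; ring. }
rewrite (HL 1) in P1 by auto; rewrite (HL (-1)) in P2 by auto.
set (q1 := quotient_primitive (Cminus (polar rho (1 * (PI - eta))) (RtoC s))) in *.
set (q2 := quotient_primitive (Cminus (polar rho (-1 * (PI - eta))) (RtoC s))) in *.
set (q0 := quotient_primitive w0) in *.
set (cs := f p) in *.
change (Cmod (Cminus (Cminus Lp Lm) (Cmult Ctwopii cs)) <= eps).
set (X1 := Cminus (Cplus q1 (Cmult cs (Cplus (RtoC (ln rho)) (Cmult Ci (RtoC (1 * (PI - eta))))))) Lp) in *.
set (X2 := Cminus (Cplus q2 (Cmult cs (Cplus (RtoC (ln rho)) (Cmult Ci (RtoC (-1 * (PI - eta))))))) Lm) in *.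
assert (E : Cminus (Cminus Lp Lm) (Cmult Ctwopii cs) =
  Cplus (Cplus (Cminus X2 X1) (Cminus (Cminus q1 q0) (Cminus q2 q0))) (Copp (Cmult (RtoC (2 * eta)) (Cmult Ci cs)))).
{ unfold X1, X2, Ctwopii; rewrite !RtoC_mult, !RtoC_minus; ring. }
rewrite E.
apply Rle_trans with (1 := Cmod_triangle _ _).
rewrite Cmod_opp, !Cmod_mult, Cmod_Ci, Cmod_R, Rabs_pos_eq by lra.
assert (T1 := Cmod_triangle (Cminus X2 X1) (Cminus (Cminus q1 q0) (Cminus q2 q0))).
assert (T2 := Cmod_triangle X2 (Copp X1)); rewrite Cmod_opp in T2.
assert (T3 := Cmod_triangle (Cminus q1 q0) (Copp (Cminus q2 q0))); rewrite Cmod_opp in T3.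
fold (Cminus X2 X1) in T2; fold (Cminus (Cminus q1 q0) (Cminus q2 q0)) in T3.
assert (T4 : 2 * eta * (1 * Cmod cs) <= eps / 5) by nra.
lra.
Qed.

Variables psi r : R.
Hypothesis Hpsi : 0 < psi < PI / 2.
Hypothesis Hr : 0 < r.
Hypothesis Hrs : r < s.

Lemma hcontour_Re u : - r <= Re (hcontour psi r u).
Proof.
simpl; assert (H := cosh_ge_1 u); destruct (inv_cosh_bounds u) as [I _].
destruct (cos_sin_psi psi Hpsi) as [Hc _]; unfold Rdiv.
assert (A : -1 <= cosh u - 2 * / (cosh u * cosh u)) by lra.
assert (0 < r * cos psi <= r) by nra; nra.
Qed.

Lemma hcontour_cut u : D (hcontour psi r u) /\ slit (Cplus (RtoC s) (hcontour psi r u)).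
Proof.
split.
- destruct (hcontour_region psi r Hpsi Hr u) as [_ H]; intros [A1 A2]; apply H.
  simpl in *; lra.
- intros [_ A]; assert (B := hcontour_Re u).
  assert (E : Re (Cplus (RtoC s) (hcontour psi r u)) = s + Re (hcontour psi r u)) by reflexivity.
  rewrite E in A; lra.
Qed.

(** Seen from -s, the contour keeps its imaginary part, whose sign is that of [u]. Each end
    therefore stays in one half-plane about -s, where the limit of the primitive is known. *)
Lemma hcontour_primitive_filterlim (Fl : (R -> Prop) -> Prop) {FF : Filter Fl} sg L K :
  (sg = 1 \/ sg = -1) -> 0 <= K ->
  (forall rho theta, 2 * s <= rho -> 0 < sg * theta < PI ->
     Cmod (Cminus (shifted_primitive (polar rho theta)) L) <= K * Rpower rho (- beta)) ->
  Fl (fun u => 0 < sg * u) ->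
  filterlim (fun u => Cmod (hcontour psi r u)) Fl (Rbar_locally p_infty) ->
  filterlim (fun u => cauchy_primitive (hcontour psi r u)) Fl (locally (L : CC)).
Proof.
intros Hsg HK HL Hsign Hinf.
refine (proj2 (filterlim_norm_lt (V := CC) Fl _ _) _); intros eps He.
destruct (Rpower_neg_small beta K eps Hbeta HK He) as [B [HB1 HB]].
assert (Hbig : Fl (fun u => Rmax B (2 * s) + s < Cmod (hcontour psi r u))).
{ apply Hinf; exists (Rmax B (2 * s) + s); auto. }
refine (filter_imp _ _ _ (filter_and _ _ Hbig Hsign)); intros u [Hu1 Hu2].
assert (M1 := Rmax_l B (2 * s)); assert (M2 := Rmax_r B (2 * s)).
set (zeta := Cplus (RtoC s) (hcontour psi r u)).
assert (Hz : zeta <> RtoC 0) by (apply slit_neq_0, hcontour_cut).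
assert (Hm : Rmax B (2 * s) < Cmod zeta).
{ assert (T := Cmod_triangle zeta (Copp (RtoC s))).
  replace (Cplus zeta (Copp (RtoC s))) with (hcontour psi r u) in T by (unfold zeta; ring).
  rewrite Cmod_opp, Cmod_R, Rabs_pos_eq in T by lra; lra. }
assert (P := polar_form zeta Hz).
assert (Hb := slit_Carg zeta (proj2 (hcontour_cut u))).
assert (Hsin : 0 < sg * sin (Carg zeta)).
{ assert (EI : Im zeta = r * sin psi * sinh u) by (unfold zeta; simpl; ring).
  assert (EI2 : Im zeta = Cmod zeta * sin (Carg zeta)) by exact (f_equal Im P).
  assert (HsI : 0 < sg * (r * sin psi * sinh u)).
  { destruct (cos_sin_psi psi Hpsi) as [_ Hsn].
    assert (0 < sg * sinh u).
    { unfold sinh; destruct Hsg as [-> | ->].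
      - assert (exp (- u) < exp u) by (apply exp_increasing; lra); lra.
      - assert (exp u < exp (- u)) by (apply exp_increasing; lra); lra. }
    replace (sg * (r * sin psi * sinh u)) with (r * sin psi * (sg * sinh u)) by ring.
    apply Rmult_lt_0_compat; [nra|assumption]. }
  assert (Hc : 0 < Cmod zeta) by lra.
  replace (r * sin psi * sinh u) with (Cmod zeta * sin (Carg zeta)) in HsI by lra.
  replace (sg * (Cmod zeta * sin (Carg zeta))) with (Cmod zeta * (sg * sin (Carg zeta))) in HsI by ring.
  apply Rmult_lt_reg_l with (Cmod zeta); lra. }
assert (Ht : 0 < sg * Carg zeta < PI).
{ destruct Hsg as [-> | ->].
  - split; [|lra]; rewrite Rmult_1_l in *; destruct (Rle_lt_dec (Carg zeta) 0) as [[Hn|Hn]|]; [| |assumption].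
    + assert (S := sin_lt_0_var (Carg zeta) ltac:(lra) Hn); lra.
    + rewrite Hn, sin_0 in Hsin; lra.
  - split; [|lra]; destruct (Rle_lt_dec 0 (Carg zeta)) as [Hn|]; [|lra].
    assert (S := sin_ge_0 (Carg zeta) Hn ltac:(lra)); lra. }
assert (A := HL (Cmod zeta) (Carg zeta) ltac:(lra) Ht).
replace (polar (Cmod zeta) (Carg zeta)) with zeta in A by exact P.
unfold shifted_primitive in A.
replace (Cminus zeta (RtoC s)) with (hcontour psi r u) in A by (unfold zeta; ring).
apply Rle_lt_trans with (1 := A), HB; lra.
Qed.

Lemma cauchy_kernel_integral :
  is_RInt_gen (V := real_NormedModule CC)
    (fun u => scal (dhcontour psi r u : C_AbsRing) (cauchy_kernel (hcontour psi r u) : CC))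
    (Rbar_locally m_infty) (Rbar_locally p_infty) (Cmult Ctwopii (RtoC (Rpower s (- beta))) : CC).
Proof.
destruct (shifted_primitive_limit 1 (or_introl eq_refl)) as [Lp HLp].
destruct (shifted_primitive_limit (-1) (or_intror eq_refl)) as [Lm HLm].
set (K := Rpower 2 beta * (/ beta + 8)) in *.
assert (HK : 0 <= K).
{ apply Rmult_le_pos; [apply Rlt_le, exp_pos|].
  assert (I := Rinv_0_lt_compat _ Hbeta); lra. }
rewrite <- (shifted_primitive_jump Lp Lm K HK).
- destruct (hcontour_is_contour psi r Hpsi Hr) as [Hg [_ [[Hm _] [Hp _]]]].
  apply (is_RInt_gen_contour CC C_complete_mixin cauchy_primitive cauchy_kernel).
  + intros t; apply cauchy_primitive_Cder; apply hcontour_cut.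
  + intros t; apply cauchy_primitive_Cder; apply hcontour_cut.
  + exact Hg.
  + apply (hcontour_primitive_filterlim _ (-1) Lm K); auto.
    exists 0; intros u Hu; lra.
  + apply (hcontour_primitive_filterlim _ 1 Lp K); auto.
    exists 0; intros u Hu; lra.
- intros rho theta H1 H2; apply HLp; lra.
- intros rho theta H1 H2; apply HLm; lra.
Qed.

End Residue.

(** * Negative powers of s + A *)

(** The logistic density, derivative of -1/(1 + exp(beta u)): an integrable majorant, up to a
    factor, of cosh^(-beta) with an explicit integral. *)
Lemma bump_integral beta : 0 < beta ->
  is_RInt_gen (fun u => beta * (exp (beta * u) / ((1 + exp (beta * u)) * (1 + exp (beta * u)))))
    (Rbar_locally m_infty) (Rbar_locally p_infty) 1.
Proof.
intros Hb.
set (F := fun u => - / (1 + exp (beta * u))).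
assert (D : forall u, is_derive F u (beta * (exp (beta * u) / ((1 + exp (beta * u)) * (1 + exp (beta * u)))))).
{ intros u; assert (H := exp_pos (beta * u)); unfold F; auto_derive; [lra|field; lra]. }
assert (I : is_RInt_gen (Derive F) (Rbar_locally m_infty) (Rbar_locally p_infty) (0 - - 1)).
{ apply is_RInt_gen_Derive.
  - apply filter_forall; intros ab x _; eexists; apply D.
  - apply filter_forall; intros ab x _.
    apply continuous_ext with (fun u => beta * (exp (beta * u) / ((1 + exp (beta * u)) * (1 + exp (beta * u))))).
    + intros u; symmetry; apply is_derive_unique, D.
    + apply (ex_derive_continuous (V := R_NormedModule)).
      assert (H := exp_pos (beta * x)); auto_derive; nra.
  - intros P [eps HP]; exists (- / (beta * eps)); intros u Hu; apply HP.
    change (Rabs (F u - -1) < eps); unfold F; assert (He := cond_pos eps).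
    assert (H := exp_pos (beta * u)).
    replace (- / (1 + exp (beta * u)) - -1) with (exp (beta * u) / (1 + exp (beta * u))) by (field; lra).
    assert (Q : / eps < - (beta * u)).
    { assert (T : beta * - u > beta * / (beta * eps)) by (apply Rmult_lt_compat_l; lra).
      replace (beta * / (beta * eps)) with (/ eps) in T by (field; lra); lra. }
    assert (Hi := Rinv_0_lt_compat _ He).
    assert (Q2 := exp_ge_1_plus (- (beta * u)) ltac:(lra)).
    assert (Q3 : exp (beta * u) < eps).
    { replace (beta * u) with (- - (beta * u)) by ring; rewrite exp_Ropp.
      rewrite <- (Rinv_inv eps); apply Rinv_0_lt_contravar; lra. }
    rewrite Rabs_pos_eq by (apply Rdiv_le_0_compat; lra).
    apply Rlt_div_l; [lra|nra].
  - intros P [eps HP]; exists (/ (beta * eps)); intros u Hu; apply HP.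
    change (Rabs (F u - 0) < eps); unfold F; assert (He := cond_pos eps).
    assert (H := exp_pos (beta * u)).
    assert (Q : / eps < beta * u).
    { assert (T : beta * u > beta * / (beta * eps)) by (apply Rmult_lt_compat_l; lra).
      replace (beta * / (beta * eps)) with (/ eps) in T by (field; lra); lra. }
    assert (Hi := Rinv_0_lt_compat _ He).
    assert (Q2 := exp_ge_1_plus (beta * u) ltac:(lra)).
    rewrite Rminus_0_r, Rabs_Ropp, Rabs_pos_eq by (apply Rlt_le, Rinv_0_lt_compat; lra).
    rewrite <- (Rinv_inv eps); apply Rinv_0_lt_contravar; lra. }
replace (0 - - 1) with 1 in I by ring.
refine (is_RInt_gen_ext _ _ _ _ I).
apply filter_forall; intros ab x _; apply is_derive_unique, D.
Qed.

Lemma Rpower_neg_le x y a : 0 <= a -> 0 < x -> x <= y -> Rpower y (- a) <= Rpower x (- a).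
Proof.
intros Ha Hx Hxy; rewrite !Rpower_Ropp; apply Rinv_le_contravar; [apply exp_pos|].
apply Rle_Rpower_l; lra.
Qed.

(** From cosh u >= exp|u|/2, and exp(-x) <= 4 exp x / (1 + exp x)^2 for x >= 0 because (1 + e)^2 <=
    4 e^2 when e >= 1. The quotient is even in x, which covers both signs of [u]. *)
Lemma Rpower_cosh_le beta u : 0 < beta ->
  Rpower (cosh u) (- beta) <= Rpower 2 beta * 4 * (exp (beta * u) / ((1 + exp (beta * u)) * (1 + exp (beta * u)))).
Proof.
intros Hb.
assert (H : exp (Rabs u) / 2 <= cosh u).
{ unfold cosh, Rabs; destruct (Rcase_abs u); [assert (A := exp_pos u)|assert (A := exp_pos (- u))]; lra. }
assert (H0 := exp_pos (Rabs u)).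
apply Rle_trans with (1 := Rpower_neg_le (exp (Rabs u) / 2) (cosh u) beta ltac:(lra) ltac:(lra) H).
replace (Rpower (exp (Rabs u) / 2) (- beta)) with (Rpower 2 beta * exp (- (beta * Rabs u))).
2: { unfold Rdiv; rewrite <- Rpower_mult_distr by lra.
     replace (/ 2) with (Rpower 2 (- (1))) by (rewrite Rpower_Ropp, Rpower_1; lra).
     rewrite Rpower_mult; replace (- (1) * - beta) with beta by ring.
     unfold Rpower at 2; rewrite ln_exp; rewrite Rmult_comm; do 2 f_equal; ring. }
rewrite Rmult_assoc; apply Rmult_le_compat_l; [apply Rlt_le, exp_pos|].
assert (K : forall x, 0 <= x -> exp (- x) <= 4 * (exp x / ((1 + exp x) * (1 + exp x))) /\
   exp (- x) <= 4 * (exp (- x) / ((1 + exp (- x)) * (1 + exp (- x))))).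
{ intros x Hx; assert (E1 := exp_ge_1_plus x Hx); rewrite exp_Ropp.
  set (e := exp x) in *; assert (He : 1 <= e) by lra; split.
  - replace (4 * (e / ((1 + e) * (1 + e)))) with (4 * e * / ((1 + e) * (1 + e))) by (field; lra).
    apply Rmult_le_reg_r with (e * ((1 + e) * (1 + e))); [nra|].
    replace (/ e * (e * ((1 + e) * (1 + e)))) with ((1 + e) * (1 + e)) by (field; lra).
    replace (4 * e * / ((1 + e) * (1 + e)) * (e * ((1 + e) * (1 + e)))) with (4 * e * e) by (field; lra).
    nra.
  - replace (4 * (/ e / ((1 + / e) * (1 + / e)))) with (4 * e * / ((1 + e) * (1 + e))).
    2: { field; repeat split; lra. }
    apply Rmult_le_reg_r with (e * ((1 + e) * (1 + e))); [nra|].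
    replace (/ e * (e * ((1 + e) * (1 + e)))) with ((1 + e) * (1 + e)) by (field; lra).
    replace (4 * e * / ((1 + e) * (1 + e)) * (e * ((1 + e) * (1 + e)))) with (4 * e * e) by (field; lra).
    nra. }
unfold Rabs; destruct (Rcase_abs u) as [Hu|Hu].
- destruct (K (- (beta * u)) ltac:(nra)) as [_ K2]; rewrite Ropp_involutive in K2.
  replace (- (beta * - u)) with (beta * u) by ring; exact K2.
- destruct (K (beta * u) ltac:(nra)) as [K1 _]; exact K1.
Qed.

Section SemigroupProperty.

Context {V : NormedModule C_AbsRing}.
Variable cV : CompleteSpace.mixin_of V.
Variable A : operator V.
Variable M : R.
Hypothesis hM : positivity_constant A M.

Local Notation BV := (BL_NormedModule V).
Local Notation rB := (real_NormedModule (BL_NormedModule V)).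
Local Notation cB := (real_CompleteNormedModule (BL_NormedModule V) (bl_complete_mixin V cV)).
Local Notation res := (resolvent (op_opp A)).
Local Notation res_set := (resolvent_set (op_opp A)).
Local Notation g := (std_g M).
Local Notation dg := (std_dg M).
Local Notation Rs := (fun sigma => res (RtoC sigma)).
Local Notation Rl := (shifted_resolvent A).

Lemma std_psi_lt : 0 < std_psi M < PI / 2.
Proof.
assert (H1 := std_psi_bounds A M hM); assert (H2 := aperture_bounds M (proj1 hM)); lra.
Qed.

Lemma std_r_pos : 0 < std_r M.
Proof. assert (H := std_r_bounds A M hM); lra. Qed.

Lemma std_g_cut u : cut_region M (g u).
Proof.
apply (contour_region_cut M (proj1 hM) (std_psi M) (10 * std_r M)).
- apply std_psi_bounds with A, hM.
- apply std_r_bounds with A, hM.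
- apply hcontour_region; [apply std_psi_lt|apply std_r_pos].
Qed.

(** [C0] precedes the integrand: bounds that are uniform in a parameter, or small in it, pass to the
    integral. The decay 1/(1 + |g|) compensates the growth of |dg| like cosh, and cosh^(-beta)
    remains. *)
Lemma std_integral_bound beta : 0 < beta -> exists C0, 0 <= C0 /\
  forall (f : C -> BL V) B (L : BL V), 0 <= B ->
  (forall u, op_norm (f (g u)) <= B * (Rpower (Cmod (g u)) (- beta) / (1 + Cmod (g u)))) ->
  is_RInt_gen (V := rB) (fun u => scal (dg u : C_AbsRing) (f (g u)))
    (Rbar_locally m_infty) (Rbar_locally p_infty) L ->
  op_norm L <= B * C0.
Proof.
intros Hb.
assert (Hr := std_r_pos).
destruct (hcontour_ge (std_psi M) (std_r M) std_psi_lt Hr) as [kappa [Hk Hkap]].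
(* 6 r comes from [dhcontour_le], 1/kappa and kappa^(-beta) from [hcontour_ge], 4 * 2^beta from
   [Rpower_cosh_le]; 1/beta cancels the factor of the bump. *)
set (K := 6 * std_r M / kappa * Rpower kappa (- beta) * (Rpower 2 beta * 4) / beta).
assert (HK : 0 <= K).
{ unfold K; assert (P1 : 0 < Rpower kappa (- beta)) by apply exp_pos.
  assert (P2 : 0 < Rpower 2 beta) by apply exp_pos.
  apply Rdiv_le_0_compat; [|lra]; apply Rmult_le_pos; [|lra]; apply Rmult_le_pos; [|lra].
  apply Rdiv_le_0_compat; lra. }
exists K; split; [exact HK|].
intros f B L HB Hf HI.
assert (J := is_RInt_gen_scal (V := R_NormedModule) _ (B * K) _ (bump_integral beta Hb)).
assert (Hle : norm (L : BV) <= scal (B * K) 1).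
{ refine (RInt_gen_norm (V := cB) (Fa := Rbar_locally m_infty) (Fb := Rbar_locally p_infty) _ _ L _ _ _ HI J).
  - apply Filter_prod with (fun x => x < 0) (fun x => 0 < x); [exists 0; auto|exists 0; auto|].
    intros x y Hx Hy; simpl; lra.
  - apply filter_forall; intros ab u _.
    change (op_norm (scal (dg u : C_AbsRing) (f (g u))) <=
       B * K * (beta * (exp (beta * u) / ((1 + exp (beta * u)) * (1 + exp (beta * u)))))).
    apply Rle_trans with (Cmod (dg u) * op_norm (f (g u))).
    { right; exact (norm_scal_eq (V := BV) (dg u) (f (g u))). }
    assert (Hd := dhcontour_le (std_psi M) (std_r M) std_psi_lt Hr u); fold (std_dg M) in Hd.
    change (dhcontour (std_psi M) (std_r M) u) with (dg u) in Hd.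
    assert (Hg := Hkap u); change (hcontour (std_psi M) (std_r M) u) with (g u) in Hg.
    assert (Hc := cosh_ge_1 u).
    assert (Hkc : 0 < kappa * cosh u) by nra.
    assert (P0 : 0 < Rpower (Cmod (g u)) (- beta)) by apply exp_pos.
    assert (P1 := Rpower_neg_le _ _ beta (Rlt_le _ _ Hb) Hkc Hg).
    rewrite <- Rpower_mult_distr in P1 by lra.
    assert (P2 := Rpower_cosh_le beta u Hb).
    assert (P3 : 0 < Rpower kappa (- beta)) by apply exp_pos.
    apply Rle_trans with (6 * std_r M * cosh u * (B * (Rpower kappa (- beta) * Rpower (cosh u) (- beta) / (kappa * cosh u)))).
    + apply Rmult_le_compat; [apply Cmod_ge_0|apply op_norm_ge_0|exact Hd|].
      apply Rle_trans with (1 := Hf u), Rmult_le_compat_l; [exact HB|].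
      apply Rmult_le_compat; [lra|apply Rlt_le, Rinv_0_lt_compat; lra|exact P1|].
      apply Rinv_le_contravar; lra.
    + replace (6 * std_r M * cosh u * (B * (Rpower kappa (- beta) * Rpower (cosh u) (- beta) / (kappa * cosh u))))
        with (B * (6 * std_r M / kappa * Rpower kappa (- beta)) * Rpower (cosh u) (- beta)) by (field; lra).
      set (E := exp (beta * u) / ((1 + exp (beta * u)) * (1 + exp (beta * u)))) in *.
      replace (B * K * (beta * E)) with (B * (6 * std_r M / kappa * Rpower kappa (- beta)) * (Rpower 2 beta * 4 * E))
        by (unfold K; field; lra).
      apply Rmult_le_compat_l; [|exact P2].
      apply Rmult_le_pos; [exact HB|]; apply Rmult_le_pos; [apply Rdiv_le_0_compat; lra|lra]. }
apply Rle_trans with (1 := Hle); right; apply Rmult_1_r.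
Qed.

(** The operator (sigma + A)^(-beta), integrated for every sigma over the contour of [A], so that
    only the integrand varies with sigma. *)
Definition Phi (beta sigma : R) : BL V :=
  scal (Cinv Ctwopii : C_AbsRing)
    (RInt_gen (V := cB) (fun t => scal (dg t : C_AbsRing) (shifted_frac A sigma beta (g t)))
      (Rbar_locally m_infty) (Rbar_locally p_infty)).

Lemma Phi_spec beta sigma : 0 < beta -> 0 <= sigma ->
  is_RInt_gen (V := rB) (fun t => scal (dg t : C_AbsRing) (shifted_frac A sigma beta (g t)))
      (Rbar_locally m_infty) (Rbar_locally p_infty) (scal (Ctwopii : C_AbsRing) (Phi beta sigma) : BL V).
Proof.
intros Hb Hs.
destruct (shifted_frac_integral_exists cV A M hM sigma beta Hs Hb) as [L HL].
assert (I := HL _ _ _ _ (std_psi_bounds A M hM) (std_r_bounds A M hM) (std_is_contour A M hM)).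
refine (eq_rect _ (is_RInt_gen (V := rB) _ _ _) I _ _).
unfold Phi; rewrite (is_RInt_gen_unique (V := cB) _ L I).
module_coefs (BL_NormedModule V); field; apply Ctwopii_neq_0.
Qed.

Lemma Phi_0 beta : 0 < beta -> Phi beta 0 = neg_power A beta.
Proof.
intros Hb.
assert (E := is_RInt_gen_bl_unique _ _ _ (Phi_spec beta 0 Hb (Rle_refl _)) (neg_power_std_integral cV A M beta hM Hb)).
transitivity (scal (Cinv Ctwopii : C_AbsRing) (scal (Ctwopii : C_AbsRing) (Phi beta 0)) : BL V).
- module_coefs (BL_NormedModule V); field; apply Ctwopii_neq_0.
- rewrite E; module_coefs (BL_NormedModule V); field; apply Ctwopii_neq_0.
Qed.

Lemma Rl_set sigma u : 0 <= sigma -> res_set (Cplus (g u) (RtoC sigma)).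
Proof. intros Hs; apply (Omega_resolvent cV A M hM); [apply std_g_cut|exact Hs]. Qed.

Lemma Rs_set sigma : 0 <= sigma -> res_set (RtoC sigma).
Proof. apply (positive_resolvent_set A M hM). Qed.

Lemma Rl_bound sigma u : 0 <= sigma ->
  op_norm (Rl sigma (g u)) <= 6 * M / (1 + Cmod (g u)) /\ op_norm (Rl sigma (g u)) <= 6 * M.
Proof.
intros Hs; assert (H1 : 1 <= M) by apply hM.
destruct (Omega_resolvent cV A M hM (g u) sigma (proj1 (std_g_cut u)) Hs) as [_ B].
assert (Hc := Cmod_ge_0 (g u)).
assert (N := op_norm_ge_0 (Rl sigma (g u))).
unfold shifted_resolvent in *; split; [|nra].
apply Rle_div_r; [lra|]; rewrite Rmult_comm; exact B.
Qed.

Lemma Rs_bound sigma : 0 <= sigma -> op_norm (res (RtoC sigma)) <= M.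
Proof.
intros Hs; assert (B := positive_resolvent_bound A M hM sigma Hs).
assert (N := op_norm_ge_0 (res (RtoC sigma))); nra.
Qed.

Lemma is_RInt_gen_std_plus (f1 f2 : R -> BL V) (L1 L2 : BL V) :
  is_RInt_gen (V := rB) f1 (Rbar_locally m_infty) (Rbar_locally p_infty) L1 ->
  is_RInt_gen (V := rB) f2 (Rbar_locally m_infty) (Rbar_locally p_infty) L2 ->
  is_RInt_gen (V := rB) (fun t => plus (f1 t) (f2 t)) (Rbar_locally m_infty) (Rbar_locally p_infty) (plus L1 L2 : BL V).
Proof. exact (is_RInt_gen_plus (V := rB) f1 f2 L1 L2). Qed.

Lemma is_RInt_gen_std_scal (c : C) (f : R -> BL V) (L : BL V) :
  is_RInt_gen (V := rB) f (Rbar_locally m_infty) (Rbar_locally p_infty) L ->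
  is_RInt_gen (V := rB) (fun t => scal (c : C_AbsRing) (f t)) (Rbar_locally m_infty) (Rbar_locally p_infty)
    (scal (c : C_AbsRing) L : BL V).
Proof.
exact (is_RInt_gen_linear (V := BV) (W := BV) (fun x => scal (c : C_AbsRing) x)
  (is_linear_scal_r (K := C_AbsRing) (V := BV) c Cmult_comm) f _ _ L).
Qed.

Lemma is_RInt_gen_std_eq (f1 f2 : R -> BL V) (L1 L2 : BL V) :
  is_RInt_gen (V := rB) f1 (Rbar_locally m_infty) (Rbar_locally p_infty) L1 ->
  (forall t, f1 t = f2 t) -> L1 = L2 ->
  is_RInt_gen (V := rB) f2 (Rbar_locally m_infty) (Rbar_locally p_infty) L2.
Proof.
intros H E <-; refine (is_RInt_gen_ext (V := rB) _ _ _ _ H).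
apply filter_forall; intros ab t _; apply E.
Qed.

Lemma Crpower_opp_pred z a : slit (Copp z) ->
  Crpower (Copp z) (- (a - 1)) = Cmult (Copp z) (Crpower (Copp z) (- a)).
Proof.
intros Hz; replace (- (a - 1)) with (1 + - a) by ring.
rewrite Crpower_plus, Crpower_1; [reflexivity|apply slit_neq_0, Hz].
Qed.

(* With [R_l = (l + sigma + A)^-1] and [R_s = (sigma + A)^-1], the derivative of
   [(-l)^(1 - beta) R_l R_s] is [(-l)^(-beta) (beta R_l R_s - R_l^2)]. *)
Lemma Phi_derivative_integral beta sigma : 0 < beta -> 0 <= sigma ->
  is_RInt_gen (V := rB) (fun t => scal (dg t : C_AbsRing)
     (scal (Crpower (Copp (g t)) (- beta) : C_AbsRing) (bl_comp (Rl sigma (g t)) (Rl sigma (g t)))))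
    (Rbar_locally m_infty) (Rbar_locally p_infty)
    (scal (Cmult Ctwopii (RtoC beta) : C_AbsRing) (bl_comp (Phi beta sigma) (res (RtoC sigma))) : BL V) /\
  is_RInt_gen (V := rB) (fun t => scal (dg t : C_AbsRing)
     (scal (Crpower (Copp (g t)) (- beta) : C_AbsRing) (bl_comp (Rl sigma (g t)) (Rl sigma (g t)))))
    (Rbar_locally m_infty) (Rbar_locally p_infty)
    (scal (Cmult Ctwopii (RtoC beta) : C_AbsRing) (bl_comp (res (RtoC sigma)) (Phi beta sigma)) : BL V).
Proof.
intros Hb Hs.
assert (I0 := sqr_resolvent_integral cV A M hM sigma (beta - 1) _ _ _ _ Hs ltac:(lra)
  (std_psi_bounds A M hM) (std_r_bounds A M hM) (std_is_contour A M hM)).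
replace (beta - 1 + 1) with beta in I0 by ring.
assert (I1 := Phi_spec beta sigma Hb Hs).
set (S := res (RtoC sigma)).
split.
- assert (J0 := is_RInt_gen_linear (V := BV) (W := BV) _ (bl_comp_linear_r S) _ _ _ _ I0).
  assert (J1 := is_RInt_gen_linear (V := BV) (W := BV) _ (bl_comp_linear_r S) _ _ _ _ I1).
  refine (is_RInt_gen_std_eq _ _ _ _ (is_RInt_gen_std_plus _ _ _ _ (is_RInt_gen_std_scal (RtoC beta) _ _ J1)
     (is_RInt_gen_std_scal (Copp (RtoC 1)) _ _ J0)) _ _).
  + intros t.
    assert (E := resolvent_identity (op_opp A) _ _ (Rl_set sigma t Hs) (Rs_set sigma Hs)); fold S in E.
    rewrite (Crpower_opp_pred _ beta (proj2 (std_g_cut t))).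
    unfold shifted_frac, frac, shifted_resolvent; set (T := res (Cplus (g t) (RtoC sigma))) in *.
    set (l := g t) in *; set (w := Crpower (Copp l) (- beta)).
    apply bl_ext; intros x; bl_push.
    assert (Ex : T (T x) = plus (T (S x)) (scal (Cminus (RtoC sigma) (Cplus l (RtoC sigma)) : C_AbsRing) (T (T (S x))))).
    { assert (E1 := f_equal (fun U => bl_fun U x) E); cbv beta in E1.
      assert (E2 : T x = plus (S x) (scal (Cminus (RtoC sigma) (Cplus l (RtoC sigma)) : C_AbsRing) (T (S x)))).
      { transitivity (plus (S x) (minus T S x)); [bl_push; module_ring V|rewrite E1; reflexivity]. }
      rewrite E2 at 1; bl_push; reflexivity. }
    rewrite Ex, RtoC_minus; module_ring V.
  + apply bl_ext; intros x; bl_push; module_ring V.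
- assert (J0 := is_RInt_gen_linear (V := BV) (W := BV) _ (bl_comp_linear_l S) _ _ _ _ I0).
  assert (J1 := is_RInt_gen_linear (V := BV) (W := BV) _ (bl_comp_linear_l S) _ _ _ _ I1).
  refine (is_RInt_gen_std_eq _ _ _ _ (is_RInt_gen_std_plus _ _ _ _ (is_RInt_gen_std_scal (RtoC beta) _ _ J1)
     (is_RInt_gen_std_scal (Copp (RtoC 1)) _ _ J0)) _ _).
  + intros t.
    assert (E := resolvent_identity (op_opp A) _ _ (Rs_set sigma Hs) (Rl_set sigma t Hs)); fold S in E.
    rewrite (Crpower_opp_pred _ beta (proj2 (std_g_cut t))).
    unfold shifted_frac, frac, shifted_resolvent; set (T := res (Cplus (g t) (RtoC sigma))) in *.
    set (l := g t) in *; set (w := Crpower (Copp l) (- beta)).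
    apply bl_ext; intros x; bl_push.
    assert (Ex : T (T x) = minus (S (T x)) (scal (Cminus (Cplus l (RtoC sigma)) (RtoC sigma) : C_AbsRing) (S (T (T x))))).
    { assert (E1 := f_equal (fun U => bl_fun U (T x)) E); cbv beta in E1.
      transitivity (minus (S (T x)) (minus S T (T x))); [bl_push; module_ring V|rewrite E1; reflexivity]. }
    rewrite Ex at 2; rewrite RtoC_minus; module_ring V.
  + apply bl_ext; intros x; bl_push; module_ring V.
Qed.

End SemigroupProperty.

(** N steps of length S/N accumulate an error of at most C S^2 / N. This is the form in which a
    vanishing derivative is used. *)
Lemma quadratic_increments_constant {V : NormedModule C_AbsRing} (w : R -> V) S C :
  0 <= S -> 0 <= C ->
  (forall x h, 0 <= x -> 0 <= h <= 1 -> x + h <= S -> norm (minus (w (x + h)) (w x)) <= C * (h * h)) ->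
  w S = w 0.
Proof.
intros HS HC H.
apply norm_minus_arbitrarily_small; intros eps He.
(* The first term makes the accumulated error at most [eps], the second makes the steps at most
   1. *)
set (B := C * (S * S) / eps + S + 1).
assert (HB : 0 <= C * (S * S) / eps) by (apply Rdiv_le_0_compat; nra).
destruct (nfloor_ex B) as [n [Hn1 Hn2]]; [unfold B; lra|].
set (N := INR n + 1) in *; assert (HN : 0 < N) by (assert (P := pos_INR n); unfold N; lra).
set (h := S / N).
assert (Hh : 0 <= h <= 1).
{ unfold h; split; [apply Rdiv_le_0_compat; lra|apply Rle_div_l; [lra|]]; unfold B in Hn2; lra. }
assert (HNh : N * h = S) by (unfold h; field; lra).
assert (Hk : forall k : nat, INR k <= N -> norm (minus (w (INR k * h)) (w 0)) <= INR k * (C * (h * h))).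
{ induction k as [|k IH]; intros Hkn.
  - simpl INR; rewrite !Rmult_0_l; apply (norm_le_eq zero); [module_ring V|].
    right; exact (norm_zero (V := V)).
  - rewrite S_INR in *; replace ((INR k + 1) * h) with (INR k * h + h) by ring.
    apply (norm_le_eq (plus (minus (w (INR k * h)) (w 0)) (minus (w (INR k * h + h)) (w (INR k * h)))));
      [module_ring V|].
    replace ((INR k + 1) * (C * (h * h))) with (INR k * (C * (h * h)) + C * (h * h)) by ring.
    assert (P := pos_INR k).
    apply norm_plus_compat; [apply IH; lra|apply H; [nra|exact Hh|nra]]. }
assert (E := Hk (Datatypes.S n)); rewrite S_INR in E; fold N in E.
rewrite HNh in E; apply Rle_trans with (1 := E (Rle_refl _)).
replace (N * (C * (h * h))) with (C * (S * S) / N) by (unfold h; field; lra).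
apply Rle_div_l; [exact HN|].
apply Rle_trans with (eps * B); [|apply Rmult_le_compat_l; lra].
unfold B; replace (eps * (C * (S * S) / eps + S + 1)) with (C * (S * S) + eps * (S + 1)) by (field; lra).
nra.
Qed.

(** * Increments of (sigma + A)^(-beta) in sigma and asymptotics *)

Section ComplementaryPowers.

Context {V : NormedModule C_AbsRing}.
Variable cV : CompleteSpace.mixin_of V.
Variable A : operator V.
Variable M : R.
Hypothesis hM : positivity_constant A M.

Local Notation BV := (BL_NormedModule V).
Local Notation rB := (real_NormedModule (BL_NormedModule V)).
Local Notation res := (resolvent (op_opp A)).
Local Notation g := (std_g M).
Local Notation dg := (std_dg M).
Local Notation Rl := (shifted_resolvent A).
Local Notation Phi := (Phi cV A M).

Lemma op_norm_2pii_le (T : BL V) : op_norm T <= op_norm (scal (Ctwopii : C_AbsRing) T : BL V).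
Proof.
apply Rle_trans with (Cmod Ctwopii * op_norm T).
- unfold Ctwopii; rewrite Cmod_mult, Cmod_Ci, Cmod_R, Rabs_pos_eq by (assert (H := PI_RGT_0); lra).
  assert (H := PI2_1); assert (N := op_norm_ge_0 T); nra.
- right; symmetry; exact (norm_scal_eq (V := BV) Ctwopii T).
Qed.

Lemma Phi_bounded beta : 0 < beta -> exists N, 0 <= N /\ forall sigma, 0 <= sigma -> op_norm (Phi beta sigma) <= N.
Proof.
intros Hb; destruct (std_integral_bound cV A M hM beta Hb) as [C0 [HC0 H]].
assert (H1 : 1 <= M) by apply hM.
exists (6 * M * C0); split; [nra|]; intros sigma Hs.
apply Rle_trans with (1 := op_norm_2pii_le _).
apply (H (shifted_frac A sigma beta)); [lra| |exact (Phi_spec cV A M hM beta sigma Hb Hs)].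
intros u; destruct (Rl_bound cV A M hM sigma u Hs) as [B _].
refine (Rle_trans _ _ _ (Req_le _ _ (norm_scal_eq (V := BV) _ _)) _).
rewrite Cmod_Crpower, Cmod_opp.
replace (6 * M * (Rpower (Cmod (g u)) (- beta) / (1 + Cmod (g u))))
  with (Rpower (Cmod (g u)) (- beta) * (6 * M / (1 + Cmod (g u)))) by (unfold Rdiv; ring).
apply Rmult_le_compat_l; [apply Rlt_le, exp_pos|exact B].
Qed.

(** Under the integral, R' = R - h R^2 + h^2 R' R^2 with R, R' the resolvents for sigma and sigma +
    h; [Phi_derivative_integral] evaluates the linear term. Both orders of the product are recorded:
    the first is used for [Phi alpha] and the second for [Phi (1 - alpha)], so that in each case the
    resolvent meets the middle factor. *)
Lemma Phi_increment beta : 0 < beta -> exists C, 0 <= C /\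
  forall sigma h, 0 <= sigma -> 0 <= h ->
    op_norm (minus (Phi beta (sigma + h)) (minus (Phi beta sigma)
      (scal (RtoC (h * beta) : C_AbsRing) (bl_comp (Phi beta sigma) (res (RtoC sigma)))))) <= C * (h * h) /\
    op_norm (minus (Phi beta (sigma + h)) (minus (Phi beta sigma)
      (scal (RtoC (h * beta) : C_AbsRing) (bl_comp (res (RtoC sigma)) (Phi beta sigma))))) <= C * (h * h).
Proof.
intros Hb; destruct (std_integral_bound cV A M hM beta Hb) as [C0 [HC0 HB]].
assert (H1 : 1 <= M) by apply hM.
exists (6 * M * (6 * M) * (6 * M) * C0); split; [repeat apply Rmult_le_pos; lra|].
intros sigma h Hs Hh.
assert (Hsh : 0 <= sigma + h) by lra.
set (f := fun z => scal (Cmult (RtoC (h * h)) (Crpower (Copp z) (- beta)) : C_AbsRing)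
   (bl_comp (bl_comp (Rl (sigma + h) z) (Rl sigma z)) (Rl sigma z))).
assert (Hf : forall u, op_norm (f (g u)) <=
   h * h * (6 * M * (6 * M) * (6 * M)) * (Rpower (Cmod (g u)) (- beta) / (1 + Cmod (g u)))).
{ intros u; destruct (Rl_bound cV A M hM sigma u Hs) as [B1 B2], (Rl_bound cV A M hM (sigma + h) u Hsh) as [_ B3].
  refine (Rle_trans _ _ _ (Req_le _ _ (norm_scal_eq (V := BV) _ _)) _).
  rewrite Cmod_mult, Cmod_Crpower, Cmod_opp, Cmod_R, Rabs_pos_eq by nra.
  replace (h * h * (6 * M * (6 * M) * (6 * M)) * (Rpower (Cmod (g u)) (- beta) / (1 + Cmod (g u))))
    with (h * h * Rpower (Cmod (g u)) (- beta) * (6 * M * (6 * M) * (6 * M / (1 + Cmod (g u))))) by (unfold Rdiv; ring).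
  apply Rmult_le_compat_l; [apply Rmult_le_pos; [nra|apply Rlt_le, exp_pos]|].
  apply Rle_trans with (1 := op_norm_comp _ _).
  apply Rmult_le_compat; [apply op_norm_ge_0|apply op_norm_ge_0| |exact B1].
  apply Rle_trans with (1 := op_norm_comp _ _).
  apply Rmult_le_compat; try apply op_norm_ge_0; assumption. }
assert (K : forall D : BL V,
  is_RInt_gen (V := rB) (fun t => scal (dg t : C_AbsRing)
     (scal (Crpower (Copp (g t)) (- beta) : C_AbsRing) (bl_comp (Rl sigma (g t)) (Rl sigma (g t)))))
    (Rbar_locally m_infty) (Rbar_locally p_infty) (scal (Cmult Ctwopii (RtoC beta) : C_AbsRing) D : BL V) ->
  op_norm (minus (Phi beta (sigma + h)) (minus (Phi beta sigma) (scal (RtoC (h * beta) : C_AbsRing) D)))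
   <= 6 * M * (6 * M) * (6 * M) * C0 * (h * h)).
{ intros D HD.
  apply Rle_trans with (1 := op_norm_2pii_le _).
  replace (6 * M * (6 * M) * (6 * M) * C0 * (h * h)) with (h * h * (6 * M * (6 * M) * (6 * M)) * C0) by ring.
  apply (HB f); [repeat apply Rmult_le_pos; lra|exact Hf|].
  refine (is_RInt_gen_std_eq _ _ _ _ (is_RInt_gen_std_plus _ _ _ _
     (is_RInt_gen_std_plus _ _ _ _ (Phi_spec cV A M hM beta (sigma + h) Hb Hsh)
        (is_RInt_gen_std_scal (Copp (RtoC 1)) _ _ (Phi_spec cV A M hM beta sigma Hb Hs)))
     (is_RInt_gen_std_scal (RtoC h) _ _ HD)) _ _).
  - intros t.
    assert (E := resolvent_identity (op_opp A) _ _ (Rl_set cV A M hM (sigma + h) t Hsh) (Rl_set cV A M hM sigma t Hs)).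
    replace (Cminus (Cplus (g t) (RtoC sigma)) (Cplus (g t) (RtoC (sigma + h)))) with (Copp (RtoC h)) in E
      by (rewrite RtoC_plus; ring).
    unfold f, shifted_frac, frac, shifted_resolvent in *.
    set (T := res (Cplus (g t) (RtoC sigma))) in *; set (T' := res (Cplus (g t) (RtoC (sigma + h)))) in *.
    set (w := Crpower (Copp (g t)) (- beta)).
    apply bl_ext; intros x; bl_push.
    assert (E1 : forall y, T' y = minus (T y) (scal (RtoC h : C_AbsRing) (T' (T y)))).
    { intros y; assert (E1 := f_equal (fun U => bl_fun U y) E); cbv beta in E1.
      transitivity (plus (T y) (minus T' T y)); [bl_push; module_ring V|rewrite E1; bl_push; module_ring V]. }
    rewrite (E1 x), (E1 (T x)); module_ring V.
  - apply bl_ext; intros x; bl_push; module_ring V. }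
destruct (Phi_derivative_integral cV A M hM beta sigma Hb Hs) as [D1 D2].
split; apply K; assumption.
Qed.

(** The contour stays in the half-plane Re >= -r, hence at distance at least s - r from -s. *)
Lemma std_shift_ge s u : 2 * std_r M <= s -> s / 2 <= Cmod (Cplus (RtoC s) (g u)).
Proof.
intros Hs; assert (Hr := std_r_pos A M hM).
apply Rle_trans with (2 := Rabs_Re_le _), Rle_trans with (2 := Rle_abs _).
assert (H := hcontour_Re (std_psi M) (std_r M) (std_psi_lt A M hM) Hr u).
change (s / 2 <= s + Re (g u)); unfold std_g in *; lra.
Qed.

(* [R_0 R_(s+l) = (R_0 - R_(s+l)) / (s + l)], and the scalar integral of the first term is
   [2 pi i s^(-beta)]. *)
Lemma Phi_asymptotics beta : 0 < beta -> exists C, 0 <= C /\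
  forall s, 2 * std_r M <= s ->
    op_norm (minus (bl_comp (res (RtoC 0)) (Phi beta s))
       (scal (RtoC (Rpower s (- beta)) : C_AbsRing) (res (RtoC 0)))) <= C / s.
Proof.
intros Hb; destruct (std_integral_bound cV A M hM beta Hb) as [C0 [HC0 HB]].
assert (H1 : 1 <= M) by apply hM; assert (Hr := std_r_pos A M hM).
exists (12 * M * C0); split; [nra|]; intros s Hs.
assert (Hs0 : 0 < s) by lra.
set (R0 := res (RtoC 0)).
set (f := fun z => scal (Copp (cauchy_kernel s beta z) : C_AbsRing) (Rl s z)).
assert (Hf : forall u, op_norm (f (g u)) <= 12 * M / s * (Rpower (Cmod (g u)) (- beta) / (1 + Cmod (g u)))).
{ intros u; destruct (Rl_bound cV A M hM s u ltac:(lra)) as [B _].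
  assert (B2 := std_shift_ge s u Hs).
  assert (Hn : Cplus (RtoC s) (g u) <> RtoC 0) by (apply Cmod_gt_0; lra).
  refine (Rle_trans _ _ _ (Req_le _ _ (norm_scal_eq (V := BV) _ _)) _).
  unfold cauchy_kernel; rewrite Cmod_opp, Cmod_div by exact Hn; rewrite Cmod_Crpower, Cmod_opp.
  replace (12 * M / s * (Rpower (Cmod (g u)) (- beta) / (1 + Cmod (g u))))
    with (Rpower (Cmod (g u)) (- beta) * / (s / 2) * (6 * M / (1 + Cmod (g u))))
    by (assert (Hc := Cmod_ge_0 (g u)); field; lra).
  assert (P : 0 < Rpower (Cmod (g u)) (- beta)) by apply exp_pos.
  apply Rmult_le_compat; [|apply op_norm_ge_0| |exact B].
  - apply Rmult_le_pos; [lra|apply Rlt_le, Rinv_0_lt_compat; lra].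
  - apply Rmult_le_compat_l; [lra|apply Rinv_le_contravar; lra]. }
apply Rle_trans with (1 := op_norm_2pii_le _).
replace (12 * M * C0 / s) with (12 * M / s * C0) by (field; lra).
apply (HB f); [apply Rdiv_le_0_compat; lra|exact Hf|].
assert (J1 := is_RInt_gen_linear (V := BV) (W := BV) _ (bl_comp_linear_l R0) _ _ _ _ (Phi_spec cV A M hM beta s Hb (Rlt_le _ _ Hs0))).
assert (Hrs : std_r M < s) by lra.
(* The linear map c |-> c R0 turns the scalar residue integral into an operator-valued one. *)
assert (Hsc : is_linear (U := C_NormedModule) (V := BV) (fun c : C => scal (c : C_AbsRing) R0)).
{ split.
  - intros x y; exact (scal_distr_r (K := C_Ring) (V := BL_ModuleSpace V) x y R0).
  - intros k x; symmetry; exact (scal_assoc (K := C_Ring) (V := BL_ModuleSpace V) k x R0).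
  - exists (op_norm R0 + 1); assert (N := op_norm_ge_0 R0); split; [lra|]; intros c.
    refine (Rle_trans _ _ _ (Req_le _ _ (norm_scal_eq (V := BV) c R0)) _).
    assert (Hc := Cmod_ge_0 c); change (Cmod c * op_norm R0 <= (op_norm R0 + 1) * Cmod c); nra. }
assert (J2 := is_RInt_gen_linear (V := C_NormedModule) (W := BV) _ Hsc _ _ _ _
  (cauchy_kernel_integral s beta Hs0 Hb (std_psi M) (std_r M) (std_psi_lt A M hM) Hr Hrs)).
refine (is_RInt_gen_std_eq _ _ _ _ (is_RInt_gen_std_plus _ _ _ _ J1
     (is_RInt_gen_std_scal (Copp (RtoC 1)) _ _ J2)) _ _).
- intros t.
  assert (E := resolvent_identity (op_opp A) _ _ (Rs_set A M hM 0 (Rle_refl _)) (Rl_set cV A M hM s t (Rlt_le _ _ Hs0))).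
  change (hcontour (std_psi M) (std_r M) t) with (g t); change (dhcontour (std_psi M) (std_r M) t) with (dg t).
  unfold f, shifted_frac, frac, shifted_resolvent, cauchy_kernel in *; fold R0 in E |- *.
  set (T := res (Cplus (g t) (RtoC s))) in *; set (w := Crpower (Copp (g t)) (- beta)).
  assert (B2 := std_shift_ge s t Hs).
  assert (Hn : Cplus (RtoC s) (g t) <> RtoC 0) by (apply Cmod_gt_0; lra).
  change (scal (dg t : C_AbsRing) (Cdiv w (Cplus (RtoC s) (g t)) : C_NormedModule)) with (Cmult (dg t) (Cdiv w (Cplus (RtoC s) (g t)))).
  apply bl_ext; intros x; bl_push.
  assert (E1 : R0 (T x) = scal (Cinv (Cplus (RtoC s) (g t)) : C_AbsRing) (minus (R0 x) (T x))).
  { assert (E1 := f_equal (fun U => bl_fun U x) E); cbv beta in E1.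
    transitivity (scal (Cinv (Cplus (RtoC s) (g t)) : C_AbsRing) (minus R0 T x)); [|bl_push; reflexivity].
    rewrite E1; bl_push; module_coefs V; field; exact Hn. }
  rewrite E1; module_coefs V; field; exact Hn.
- apply bl_ext; intros x; bl_push; module_ring V.
Qed.

End ComplementaryPowers.

Section OpNormCompat.

Context {V : NormedModule C_AbsRing}.
Implicit Types S T : BL V.

Lemma op_norm_plus_compat S T a b : op_norm S <= a -> op_norm T <= b -> op_norm (plus S T) <= a + b.
Proof. exact (norm_plus_compat (V := BL_NormedModule V) S T a b). Qed.

Lemma op_norm_minus_compat S T a b : op_norm S <= a -> op_norm T <= b -> op_norm (minus S T) <= a + b.
Proof. exact (norm_minus_compat (V := BL_NormedModule V) S T a b). Qed.

Lemma op_norm_scal_compat (c : R) S a b :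
  Rabs c <= a -> op_norm S <= b -> op_norm (scal (RtoC c : C_AbsRing) S) <= a * b.
Proof. rewrite <- Cmod_R; exact (norm_scal_compat (V := BL_NormedModule V) (RtoC c) S a b). Qed.

Lemma op_norm_comp_compat S T a b : op_norm S <= a -> op_norm T <= b -> op_norm (bl_comp S T) <= a * b.
Proof.
intros; apply Rle_trans with (1 := op_norm_comp _ _).
apply Rmult_le_compat; auto using op_norm_ge_0.
Qed.

Lemma op_norm_eq_compat S T a : T = S -> op_norm S <= a -> op_norm T <= a.
Proof. intros ->; auto. Qed.

End OpNormCompat.

(** * The product of complementary powers *)

Section Identities.

Context {V : NormedModule C_AbsRing}.
Variable cV : CompleteSpace.mixin_of V.
Variable A : operator V.
Variable M : R.
Hypothesis hM : positivity_constant A M.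

Local Notation BV := (BL_NormedModule V).
Local Notation rB := (real_NormedModule (BL_NormedModule V)).
Local Notation res := (resolvent (op_opp A)).
Local Notation Phi := (Phi cV A M).
Local Notation R0 := (resolvent (op_opp A) (RtoC 0)).

Lemma R0_spec : is_resolvent (op_opp A) (RtoC 0) R0.
Proof. apply resolvent_spec, (Rs_set A M hM), Rle_refl. Qed.

Lemma R0_injective x y : R0 x = R0 y -> x = y.
Proof.
intros E; destruct R0_spec as [H _].
rewrite <- (proj2 (H x)), <- (proj2 (H y)), E; reflexivity.
Qed.

(** The operator (sigma + A) A^-1, a bounded substitute for sigma + A. *)
Definition shift_op (sigma : R) : BL V := plus bl_id (scal (RtoC sigma : C_AbsRing) R0).

Lemma resolvent_shift_op sigma x : 0 <= sigma ->
  res (RtoC sigma) (shift_op sigma x) = R0 x /\ shift_op sigma (res (RtoC sigma) x) = R0 x.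
Proof.
intros Hs.
assert (E1 := resolvent_identity (op_opp A) _ _ (Rs_set A M hM 0 (Rle_refl _)) (Rs_set A M hM sigma Hs)).
assert (E2 := resolvent_identity (op_opp A) _ _ (Rs_set A M hM sigma Hs) (Rs_set A M hM 0 (Rle_refl _))).
apply (f_equal (fun U => bl_fun U x)) in E1; apply (f_equal (fun U => bl_fun U x)) in E2.
set (S := res (RtoC sigma)) in *; unfold shift_op; split; bl_push.
- transitivity (minus (S x) (minus S R0 x)); [|bl_push; module_ring V].
  rewrite E2; bl_push; module_ring V.
- transitivity (plus (S x) (minus R0 S x)); [|bl_push; module_ring V].
  rewrite E1; bl_push; module_ring V.
Qed.

Variable alpha : R.
Hypothesis Halpha : 0 < alpha < 1.

Local Notation beta := (1 - alpha).

Definition weighted_product (sigma : R) : BL V :=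
  bl_comp (Phi alpha sigma) (bl_comp (shift_op sigma) (Phi beta sigma)).

(* Since [Phi alpha' = - alpha Phi alpha R] and [Phi beta' = - beta R Phi beta], where [R] is the
   resolvent and [R (1 + sigma R0) = R0], the derivative of the product vanishes. *)
Lemma weighted_product_increment S : 0 <= S -> exists C, 0 <= C /\
  forall x h, 0 <= x -> 0 <= h <= 1 -> x + h <= S ->
    op_norm (minus (weighted_product (x + h)) (weighted_product x)) <= C * (h * h).
Proof.
intros HS.
assert (H1 : 1 <= M) by apply hM.
destruct (Phi_bounded cV A M hM alpha) as [nF [HnF BF]]; [lra|].
destruct (Phi_bounded cV A M hM beta) as [nG [HnG BG]]; [lra|].
destruct (Phi_increment cV A M hM alpha) as [C1 [HC1 I1]]; [lra|].
destruct (Phi_increment cV A M hM beta) as [C2 [HC2 I2]]; [lra|].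
(* Bound for [shift_op] on [0, S]. It grows with [S], which is harmless: the increment constant only
   has to be uniform on that interval. *)
set (nK := 1 + S * M); assert (HnK : 0 <= nK) by (unfold nK; nra).
set (nY := M * M + M * M + M * M + M * (M * M)); assert (HnY : 0 <= nY) by (unfold nY; nra).
exists (C1 * (nK * nG) + (nF + nF * M) * (nK * C2) + nF * (nY * nG)).
split; [repeat apply Rplus_le_le_0_compat; repeat apply Rmult_le_pos; nra|].
intros x h Hx Hh HxS.
assert (Hxh : 0 <= x + h) by lra.
destruct (I1 x h Hx (proj1 Hh)) as [E1 _]; destruct (I2 x h Hx (proj1 Hh)) as [_ E2].
assert (Rk := resolvent_shift_op x).
assert (BR := Rs_bound A M hM x Hx).
assert (BR0 := Rs_bound A M hM 0 (Rle_refl _)).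
assert (BK : op_norm (shift_op (x + h)) <= nK).
{ unfold shift_op, nK; apply op_norm_plus_compat; [apply op_norm_bl_id|].
  apply op_norm_scal_compat; [rewrite Rabs_pos_eq; lra|exact BR0]. }
set (F := Phi alpha x) in *; set (F' := Phi alpha (x + h)) in *.
set (G := Phi beta x) in *; set (G' := Phi beta (x + h)) in *.
set (T := res (RtoC x)) in *.
set (a := minus F (scal (RtoC (h * alpha) : C_AbsRing) (bl_comp F T))) in *.
set (b := minus G (scal (RtoC (h * beta) : C_AbsRing) (bl_comp T G))) in *.
(* Expanding (1 - h alpha T)(K + h R0)(1 - h beta T), with K the shift at [x], the terms of order h
   cancel because T K = K T = R0 and alpha + beta = 1. [Y] is what remains after division by h^2. *)
set (Y := plus (minus (scal (RtoC (alpha * beta) : C_AbsRing) (bl_comp R0 T))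
      (plus (scal (RtoC alpha : C_AbsRing) (bl_comp T R0)) (scal (RtoC beta : C_AbsRing) (bl_comp R0 T))))
      (scal (RtoC (h * (alpha * beta)) : C_AbsRing) (bl_comp T (bl_comp R0 T))) : BL V).
assert (Hab : 0 <= alpha * beta <= 1) by nra.
assert (Hhab : 0 <= h * (alpha * beta) <= 1).
{ split; [apply Rmult_le_pos; lra|]; rewrite <- (Rmult_1_l 1); apply Rmult_le_compat; lra. }
assert (BY : op_norm Y <= nY).
{ unfold nY; apply Rle_trans with (1 * (M * M) + (1 * (M * M) + 1 * (M * M)) + 1 * (M * (M * M))); [|right; ring].
  apply op_norm_plus_compat; [apply op_norm_minus_compat; [|apply op_norm_plus_compat]|];
    (apply op_norm_scal_compat; [rewrite Rabs_pos_eq; lra|repeat apply op_norm_comp_compat; assumption]). }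
assert (Ba : op_norm a <= nF + nF * M).
{ apply op_norm_minus_compat; [apply BF, Hx|]; rewrite <- (Rmult_1_l (nF * M)).
  apply op_norm_scal_compat; [rewrite Rabs_pos_eq; nra|apply op_norm_comp_compat; [apply BF, Hx|exact BR]]. }
(* Telescoping: the two powers at x + h are replaced in turn by their linear approximations [a] and
   [b], and the last summand is what [a] and [b] leave. *)
apply op_norm_eq_compat with (plus (plus
   (bl_comp (minus F' a) (bl_comp (shift_op (x + h)) G'))
   (bl_comp a (bl_comp (shift_op (x + h)) (minus G' b))))
   (scal (RtoC (h * h) : C_AbsRing) (bl_comp F (bl_comp Y G)))).
- assert (EK : forall y, shift_op (x + h) y = plus (shift_op x y) (scal (RtoC h : C_AbsRing) (R0 y))).
  { intros y; unfold shift_op; bl_push; rewrite RtoC_plus; module_ring V. }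
  apply bl_ext; intros y; unfold weighted_product, a, b, Y; fold F F' G G'; bl_push.
  rewrite !EK; bl_push.
  rewrite !(proj1 (Rk _ Hx)), !(proj2 (Rk _ Hx)).
  rewrite ?RtoC_mult, ?RtoC_minus; module_ring V.
- apply Rle_trans with (C1 * (h * h) * (nK * nG) + (nF + nF * M) * (nK * (C2 * (h * h))) + h * h * (nF * (nY * nG)));
    [|right; ring].
  apply op_norm_plus_compat; [apply op_norm_plus_compat|].
  + apply op_norm_comp_compat; [exact E1|apply op_norm_comp_compat; [exact BK|apply BG, Hxh]].
  + apply op_norm_comp_compat; [exact Ba|apply op_norm_comp_compat; [exact BK|exact E2]].
  + apply op_norm_scal_compat; [rewrite Rabs_pos_eq; nra|].
    apply op_norm_comp_compat; [apply BF, Hx|apply op_norm_comp_compat; [exact BY|apply BG, Hx]].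
Qed.

Lemma weighted_product_constant S : 0 <= S -> weighted_product S = weighted_product 0.
Proof.
intros HS; destruct (weighted_product_increment S HS) as [C [HC H]].
exact (quadratic_increments_constant (V := BV) weighted_product S C HS HC H).
Qed.

(** A^-1 times the constant product is (A^-1 Phi_alpha) Phi_beta + s (A^-1 Phi_alpha)(A^-1 Phi_beta)
    at every s. The first summand tends to 0, and s s^(-alpha) s^(-beta) = 1 leaves A^-2 from the
    second; then A^-1 is cancelled. *)
Lemma complementary_powers x : Phi alpha 0 (Phi beta 0 x) = R0 x.
Proof.
assert (H1 : 1 <= M) by apply hM; assert (Hr := std_r_pos A M hM).
destruct (Phi_bounded cV A M hM beta) as [nG [HnG BG]]; [lra|].
destruct (Phi_asymptotics cV A M hM alpha) as [C1 [HC1 I1]]; [lra|].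
destruct (Phi_asymptotics cV A M hM beta) as [C2 [HC2 I2]]; [lra|].
assert (BR0 := Rs_bound A M hM 0 (Rle_refl _)).
assert (E : bl_comp R0 (weighted_product 0) = bl_comp R0 R0).
{ apply (norm_minus_arbitrarily_small (V := BV)); intros eps He.
  (* Every error term is of order s^(-alpha), s^(-beta) or 1/s, hence at most a constant times
     s^(-gam) for s >= 1. *)
  set (gam := Rmin alpha beta).
  assert (Hg1 := Rmin_l alpha beta); assert (Hg2 := Rmin_r alpha beta); fold gam in Hg1, Hg2.
  assert (Hg : 0 < gam) by (apply Rmin_pos; lra).
  set (K := M * nG + C1 * nG + M * C2 + M * C1 + C1 * C2).
  assert (HK : 0 <= K) by (unfold K; repeat apply Rplus_le_le_0_compat; apply Rmult_le_pos; lra).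
  destruct (Rpower_neg_small gam K eps Hg HK He) as [B [HB1 HB]].
  set (s := Rmax B (2 * std_r M)).
  assert (Hs1 : B <= s) by apply Rmax_l; assert (Hs2 : 2 * std_r M <= s) by apply Rmax_r.
  assert (Hs : 1 <= s) by lra.
  assert (P : forall a, gam <= a -> 0 <= Rpower s (- a) <= Rpower s (- gam)).
  { intros a Ha; split; [apply Rlt_le, exp_pos|apply Rle_Rpower; lra]. }
  assert (Pa := P alpha Hg1); assert (Pb := P beta Hg2); assert (P1 := P 1 ltac:(lra)).
  replace (Rpower s (- (1))) with (/ s) in P1 by (rewrite Rpower_Ropp, Rpower_1; lra).
  set (sa := Rpower s (- alpha)) in *; set (sb := Rpower s (- beta)) in *; set (sg := Rpower s (- gam)) in *.
  assert (Eab : s * (sa * sb) = 1).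
  { unfold sa, sb; rewrite <- Rpower_plus; replace (- alpha + - beta) with (- (1)) by ring.
    rewrite Rpower_Ropp, Rpower_1 by lra; field; lra. }
  assert (Esa : s * sb = / sa).
  { apply Rmult_eq_reg_r with sa; [rewrite Rinv_l by (apply Rgt_not_eq, exp_pos); lra|apply Rgt_not_eq, exp_pos]. }
  assert (J1 := I1 s Hs2); assert (J2 := I2 s Hs2).
  fold sa in J1; fold sb in J2.
  set (F := Phi alpha s) in *; set (G := Phi beta s) in *.
  set (E1 := minus (bl_comp R0 F) (scal (RtoC sa : C_AbsRing) R0)) in *.
  set (E2 := minus (bl_comp R0 G) (scal (RtoC sb : C_AbsRing) R0)) in *.
  assert (BGs := BG s ltac:(lra)); fold G in BGs.
  rewrite <- (weighted_product_constant s) by lra.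
  apply Rle_trans with (sa * (M * nG) + C1 / s * nG + s * sa * (M * (C2 / s)) + s * sb * (C1 / s * M) + s * (C1 / s * (C2 / s))).
  - apply op_norm_eq_compat with (plus (plus (plus (plus
       (scal (RtoC sa : C_AbsRing) (bl_comp R0 G)) (bl_comp E1 G))
       (scal (RtoC (s * sa) : C_AbsRing) (bl_comp R0 E2)))
       (scal (RtoC (s * sb) : C_AbsRing) (bl_comp E1 R0)))
       (scal (RtoC s : C_AbsRing) (bl_comp E1 E2))).
    + apply bl_ext; intros y; unfold weighted_product, shift_op, E1, E2; fold F G; bl_push.
      assert (Eab' : Cmult (RtoC s) (Cmult (RtoC sa) (RtoC sb)) = RtoC 1) by (rewrite <- !RtoC_mult, Eab; reflexivity).
      module_coefs V; rewrite ?RtoC_mult; try ring.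
      transitivity (Copp (Cmult (RtoC s) (Cmult (RtoC sa) (RtoC sb)))); [rewrite Eab'|]; ring.
    + repeat apply op_norm_plus_compat.
      * apply op_norm_scal_compat; [rewrite Rabs_pos_eq; lra|apply op_norm_comp_compat; assumption].
      * apply op_norm_comp_compat; assumption.
      * apply op_norm_scal_compat; [rewrite Rabs_pos_eq; nra|apply op_norm_comp_compat; assumption].
      * apply op_norm_scal_compat; [rewrite Rabs_pos_eq; nra|apply op_norm_comp_compat; assumption].
      * apply op_norm_scal_compat; [rewrite Rabs_pos_eq; nra|apply op_norm_comp_compat; assumption].
  - apply Rle_trans with (K * sg); [|apply Rlt_le, HB, Hs1].
    replace (sa * (M * nG) + C1 / s * nG + s * sa * (M * (C2 / s)) + s * sb * (C1 / s * M) + s * (C1 / s * (C2 / s)))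
      with (M * nG * sa + C1 * nG * / s + M * C2 * sa + M * C1 * sb + C1 * C2 * / s) by (field; lra).
    unfold K; rewrite !Rmult_plus_distr_r.
    repeat apply Rplus_le_compat; (apply Rmult_le_compat_l; [apply Rmult_le_pos; lra|lra]). }
apply R0_injective.
assert (Ex := f_equal (fun U => bl_fun U x) E); simpl in Ex.
transitivity (R0 (Phi alpha 0 (shift_op 0 (Phi beta 0 x)))); [|exact Ex].
do 2 f_equal; unfold shift_op; bl_push; module_ring V.
Qed.

End Identities.

(** * Identities between negative powers of A *)

Section PowerIdentities.

Context {V : NormedModule C_AbsRing}.
Variable cV : CompleteSpace.mixin_of V.
Variable A : operator V.
Variable M : R.
Hypothesis hM : positivity_constant A M.

Local Notation BV := (BL_NormedModule V).
Local Notation R0 := (resolvent (op_opp A) (RtoC 0)).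

Lemma neg_power_complementary alpha x : 0 < alpha < 1 ->
  neg_power A alpha (neg_power A (1 - alpha) x) = R0 x.
Proof.
intros Ha.
rewrite <- (Phi_0 cV A M hM alpha), <- (Phi_0 cV A M hM (1 - alpha)) by lra.
apply complementary_powers; assumption.
Qed.

(** With R(l) = A^-1 - l R(l) A^-1, the integrand (-l)^(-alpha-1) R(l) equals (-l)^(-alpha) R(l)
    A^-1 + (-l)^(-alpha-1) A^-1, and the last term integrates to zero. *)
Lemma neg_power_succ alpha : 0 < alpha ->
  neg_power A (alpha + 1) = bl_comp (neg_power A alpha) R0.
Proof.
intros Ha; apply (neg_power_eq cV A M); [exact hM|lra|].
apply is_contour_integral_frac.
assert (J1 := is_RInt_gen_linear (V := BV) (W := BV) _ (bl_comp_linear_r R0) _ _ _ _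
  (neg_power_std_integral cV A M alpha hM Ha)).
assert (J2 := power_integral cV A M hM alpha R0 _ _ _ _ Ha (std_psi_bounds A M hM) (std_r_bounds A M hM) (std_is_contour A M hM)).
refine (is_RInt_gen_std_eq _ _ _ _ (is_RInt_gen_std_plus _ _ _ _ J1 J2) _ _).
- intros t; rewrite !shifted_frac_0.
  set (l := std_g M t).
  assert (Hl : slit (Copp l)) by apply (std_g_cut A M hM t).
  assert (Rl := Rl_set cV A M hM 0 t (Rle_refl _)); rewrite Cplus_0_r in Rl; fold l in Rl.
  assert (E := resolvent_identity (op_opp A) _ _ Rl (Rs_set A M hM 0 (Rle_refl _))).
  replace (- alpha) with (- (alpha + 1 - 1)) by ring.
  rewrite (Crpower_opp_pred l (alpha + 1) Hl).
  set (w := Crpower (Copp l) (- (alpha + 1))); set (T := resolvent (op_opp A) l) in *.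
  apply bl_ext; intros x; bl_push.
  assert (E1 : T x = plus (R0 x) (scal (Cminus (RtoC 0) l : C_AbsRing) (T (R0 x)))).
  { assert (E1 := f_equal (fun U => bl_fun U x) E); cbv beta in E1.
    transitivity (plus (R0 x) (minus T R0 x)); [bl_push; module_ring V|rewrite E1; bl_push; reflexivity]. }
  rewrite E1; module_ring V.
- apply bl_ext; intros x; bl_push; module_ring V.
Qed.

End PowerIdentities.

(** * The block operator *)

Section BlockOperators.

Context {V : NormedModule C_AbsRing}.

Lemma norm_pair_le {U W : NormedModule C_AbsRing} (x : U) (y : W) :
  norm ((x, y) : prod_NormedModule C_AbsRing U W) <= norm x + norm y.
Proof.
change (sqrt (norm x ^ 2 + norm y ^ 2) <= norm x + norm y).
assert (Hx := norm_ge_0 x); assert (Hy := norm_ge_0 y).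
rewrite <- (sqrt_Rsqr (norm x + norm y)) by lra.
apply sqrt_le_1_alt; unfold Rsqr; nra.
Qed.

Lemma norm_pair_ge {U W : NormedModule C_AbsRing} (x : U) (y : W) :
  norm x <= norm ((x, y) : prod_NormedModule C_AbsRing U W) /\
  norm y <= norm ((x, y) : prod_NormedModule C_AbsRing U W).
Proof.
change (norm x <= sqrt (norm x ^ 2 + norm y ^ 2) /\ norm y <= sqrt (norm x ^ 2 + norm y ^ 2)).
assert (Hx := norm_ge_0 x); assert (Hy := norm_ge_0 y); split.
- rewrite <- (sqrt_Rsqr (norm x)) at 1 by lra; apply sqrt_le_1_alt; unfold Rsqr; nra.
- rewrite <- (sqrt_Rsqr (norm y)) at 1 by lra; apply sqrt_le_1_alt; unfold Rsqr; nra.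
Qed.

Lemma norm_cube_le (x1 x2 x3 : V) : norm ((x1, x2, x3) : cube V) <= norm x1 + norm x2 + norm x3.
Proof.
assert (H1 := norm_pair_le (U := prod_NormedModule C_AbsRing V V) (x1, x2) x3).
assert (H2 := norm_pair_le x1 x2).
apply Rle_trans with (1 := H1); apply Rplus_le_compat_r; exact H2.
Qed.

Lemma norm_cube_ge (x1 x2 x3 : V) :
  norm x1 <= norm ((x1, x2, x3) : cube V) /\ norm x2 <= norm ((x1, x2, x3) : cube V) /\
  norm x3 <= norm ((x1, x2, x3) : cube V).
Proof.
destruct (norm_pair_ge (U := prod_NormedModule C_AbsRing V V) (x1, x2) x3) as [H1 H2].
destruct (norm_pair_ge x1 x2) as [H3 H4].
split; [exact (Rle_trans _ _ _ H3 H1)|split; [exact (Rle_trans _ _ _ H4 H1)|exact H2]].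
Qed.

Definition diag_fun (S : BL V) (x : cube V) : cube V :=
  let '(x1, x2, x3) := (x : V * V * V) in (S x1, S x2, S x3).

Definition low_fun (T : BL V) (x : cube V) : cube V :=
  let '(x1, x2, x3) := (x : V * V * V) in (zero, zero, T x1).

Lemma diag_bound S x : norm (diag_fun S x) <= 3 * op_norm S * norm x.
Proof.
destruct x as [[x1 x2] x3]; apply Rle_trans with (1 := norm_cube_le _ _ _).
destruct (norm_cube_ge x1 x2 x3) as [H1 [H2 H3]].
assert (N := op_norm_ge_0 S).
assert (B1 := op_norm_apply S x1); assert (B2 := op_norm_apply S x2); assert (B3 := op_norm_apply S x3).
assert (C1 := Rmult_le_compat_l _ _ _ N H1); assert (C2 := Rmult_le_compat_l _ _ _ N H2).
assert (C3 := Rmult_le_compat_l _ _ _ N H3).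
set (n := norm ((x1, x2, x3) : cube V)) in *.
change (norm (S x1) + norm (S x2) + norm (S x3) <= 3 * op_norm S * n); lra.
Qed.

Lemma low_bound T x : norm (low_fun T x) <= op_norm T * norm x.
Proof.
destruct x as [[x1 x2] x3]; apply Rle_trans with (1 := norm_cube_le _ _ _).
destruct (norm_cube_ge x1 x2 x3) as [H1 _].
assert (N := op_norm_ge_0 T); assert (B1 := op_norm_apply T x1).
assert (C1 := Rmult_le_compat_l _ _ _ N H1).
assert (Z : norm (zero : V) = 0) by exact norm_zero.
rewrite !Z; set (n := norm ((x1, x2, x3) : cube V)) in *.
change (0 + 0 + norm (T x1) <= op_norm T * n); lra.
Qed.

Lemma diag_linear S : is_linear (diag_fun S).
Proof.
split.
- intros [[x1 x2] x3] [[y1 y2] y3].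
  exact (f_equal2 pair (f_equal2 pair (bl_linear_plus S x1 y1) (bl_linear_plus S x2 y2))
    (bl_linear_plus S x3 y3)).
- intros k [[x1 x2] x3].
  exact (f_equal2 pair (f_equal2 pair (bl_linear_scal S k x1) (bl_linear_scal S k x2))
    (bl_linear_scal S k x3)).
- exists (3 * op_norm S + 1); assert (N := op_norm_ge_0 S); split; [lra|]; intros x.
  apply Rle_trans with (1 := diag_bound S x); assert (P := norm_ge_0 x); nra.
Qed.

Lemma low_linear T : is_linear (low_fun T).
Proof.
split.
- intros [[x1 x2] x3] [[y1 y2] y3].
  assert (Z : (zero : V) = plus zero zero) by module_ring V.
  exact (f_equal2 pair (f_equal2 pair Z Z) (bl_linear_plus T x1 y1)).
- intros k [[x1 x2] x3].
  assert (Z : (zero : V) = scal k zero) by module_ring V.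
  exact (f_equal2 pair (f_equal2 pair Z Z) (bl_linear_scal T k x1)).
- exists (op_norm T + 1); assert (N := op_norm_ge_0 T); split; [lra|]; intros x.
  apply Rle_trans with (1 := low_bound T x); assert (P := norm_ge_0 x); nra.
Qed.

Definition diag_op (S : BL V) : BL (cube V) := mkBL (cube V) _ (diag_linear S).
Definition low_op (T : BL V) : BL (cube V) := mkBL (cube V) _ (low_linear T).

Lemma op_norm_diag S : op_norm (diag_op S) <= 3 * op_norm S.
Proof. apply op_norm_le; [assert (N := op_norm_ge_0 S); lra|apply diag_bound]. Qed.

Lemma op_norm_low T : op_norm (low_op T) <= op_norm T.
Proof. apply op_norm_le; [apply op_norm_ge_0|apply low_bound]. Qed.

Lemma diag_op_linear : is_linear (U := BL_NormedModule V) (V := BL_NormedModule (cube V)) diag_op.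
Proof.
split.
- intros S T; apply bl_ext; intros [[x1 x2] x3]; reflexivity.
- intros k S; apply bl_ext; intros [[x1 x2] x3]; reflexivity.
- exists 3; split; [lra|]; exact op_norm_diag.
Qed.

Lemma low_op_linear : is_linear (U := BL_NormedModule V) (V := BL_NormedModule (cube V)) low_op.
Proof.
split.
- intros S T; apply bl_ext; intros [[x1 x2] x3].
  change (low_fun (plus S T) (x1, x2, x3) = plus (low_fun S (x1, x2, x3)) (low_fun T (x1, x2, x3))).
  assert (Z : (zero : V) = plus zero zero) by module_ring V.
  exact (f_equal2 pair (f_equal2 pair Z Z) eq_refl).
- intros k S; apply bl_ext; intros [[x1 x2] x3].
  change (low_fun (scal (k : C_AbsRing) S) (x1, x2, x3) = scal (k : C_AbsRing) (low_fun S (x1, x2, x3))).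
  assert (Z : (zero : V) = scal k zero) by module_ring V.
  exact (f_equal2 pair (f_equal2 pair Z Z) eq_refl).
- exists 1; split; [lra|]; intros T; rewrite Rmult_1_l; exact (op_norm_low T).
Qed.

(** A sum of images under two bounded linear embeddings of operator spaces, so that integrals of the
    entries become integrals of the matrix. *)
Definition block (S : BL V) (c : C) (T : BL V) : BL (cube V) :=
  plus (diag_op S) (scal (c : C_AbsRing) (low_op T)).

Lemma block_app S c T (x1 x2 x3 : V) :
  block S c T ((x1, x2, x3) : cube V) =
  (S x1, S x2, plus (scal (c : C_AbsRing) (T x1)) (S x3)) :> V * V * V.
Proof.
change (plus (diag_fun S (x1, x2, x3)) (scal (c : C_AbsRing) (low_fun T (x1, x2, x3))) =
  (S x1, S x2, plus (scal (c : C_AbsRing) (T x1)) (S x3)) :> V * V * V).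
refine (f_equal2 pair (f_equal2 pair _ _) _).
- change (plus (S x1) (scal (c : C_AbsRing) zero) = S x1); module_ring V.
- change (plus (S x2) (scal (c : C_AbsRing) zero) = S x2); module_ring V.
- change (plus (S x3) (scal (c : C_AbsRing) (T x1)) = plus (scal (c : C_AbsRing) (T x1)) (S x3)); module_ring V.
Qed.

End BlockOperators.

(** With T = (z + B)^-1, the graph of [B] is the zero set of the continuous map (x, y) |-> T (z x +
    y) - x. *)
Lemma closed_operator_of_resolvent {V : NormedModule C_AbsRing} (B : operator V) z :
  resolvent_set (op_opp B) z -> closed_operator B.
Proof.
intros [T [H1 H2]] [p1 p2] Hp.
set (d := fun x y : V => minus (T (plus (scal (z : C_AbsRing) x) y)) x : V).
assert (Hiff : forall x y : V, d x y = zero -> dom B x /\ B x = y).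
{ intros x y E; unfold d in E; apply minus_eq_zero_eq in E.
  destruct (H1 (plus (scal (z : C_AbsRing) x) y)) as [D1 E1].
  change (dom B (T (plus (scal (z : C_AbsRing) x) y))) in D1.
  change (minus (scal (z : C_AbsRing) (T (plus (scal (z : C_AbsRing) x) y))) (opp (B (T (plus (scal (z : C_AbsRing) x) y))))
     = plus (scal (z : C_AbsRing) x) y) in E1.
  rewrite E in D1, E1; split; [exact D1|].
  transitivity (minus (minus (scal (z : C_AbsRing) x) (opp (B x))) (scal (z : C_AbsRing) x)); [module_ring V|].
  rewrite E1; module_ring V. }
assert (Hzero : forall x y : V, dom B x -> B x = y -> d x y = zero).
{ intros x y D E; unfold d; rewrite <- E.
  assert (E1 := H2 x D : T (minus (scal (z : C_AbsRing) x) (opp (B x))) = x).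
  transitivity (minus (T (minus (scal (z : C_AbsRing) x) (opp (B x)))) x).
  - do 2 f_equal; module_ring V.
  - rewrite E1; module_ring V. }
apply Hiff, NNPP; intros Hn; apply Hp.
assert (Hd : 0 < norm (d p1 p2)).
{ destruct (norm_ge_0 (d p1 p2)) as [|E]; [assumption|].
  exfalso; apply Hn, norm_eq_zero; symmetry; exact E. }
assert (NT := op_norm_ge_0 T); assert (Nz := Cmod_ge_0 z).
set (K := op_norm T * (Cmod z + 1) + 1).
assert (HK : 1 <= K) by (unfold K; nra).
assert (Hf := norm_factor_gt_0 (V := V)).
destruct (small_factor (norm (d p1 p2) / 2) (2 * K * @norm_factor _ V)) as [e [He1 He2]]; [lra|nra|].
exists (mkposreal e He1); intros [q1 q2] [B1 B2] [D E]; simpl in D, E.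
assert (N1 := norm_compat2 _ _ _ B1); assert (N2 := norm_compat2 _ _ _ B2); simpl in N1, N2.
assert (Bd : norm (minus (d q1 q2) (d p1 p2)) <= norm (d p1 p2) / 2).
{ apply (norm_le_eq (minus (T (plus (scal (z : C_AbsRing) (minus q1 p1)) (minus q2 p2)))
    (minus q1 p1))); [unfold d; bl_push; module_ring V|].
  set (f := @norm_factor _ V) in *.
  apply Rle_trans with (op_norm T * (Cmod z * (f * e) + f * e) + f * e).
  - apply norm_minus_compat; [|apply Rlt_le, N1].
    apply Rle_trans with (1 := op_norm_apply _ _).
    apply Rmult_le_compat_l; [exact NT|].
    apply norm_plus_compat; [|apply Rlt_le, N2].
    apply norm_scal_compat; [apply Rle_refl|apply Rlt_le, N1].
  - apply Rle_trans with (2 := He2); unfold K.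
    assert (0 <= f * e) by nra.
    replace (op_norm T * (Cmod z * (f * e) + f * e) + f * e) with (f * e * (op_norm T * (Cmod z + 1) + 1)) by ring.
    fold K; nra. }
rewrite (Hzero q1 q2 D E), norm_minus_sym in Bd.
assert (norm (d p1 p2) <= norm (d p1 p2) / 2); [|lra].
apply (norm_le_eq (minus (d p1 p2) zero)); [module_ring V|exact Bd].
Qed.

Section Lambda.

Context {V : NormedModule C_AbsRing}.
Variable cV : CompleteSpace.mixin_of V.
Variable A : operator V.
Hypothesis Alin : linear_operator A.

Local Notation res := (resolvent (op_opp A)).
Local Notation res_set := (resolvent_set (op_opp A)).

Lemma Lambda1_app (x1 x2 x3 : V) :
  Lambda1 A ((x1, x2, x3) : cube V) = (A x1, A x2, plus x1 (A x3)) :> V * V * V.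
Proof.
refine (f_equal2 pair (f_equal2 pair _ _) _).
- change (plus (plus (A x1) zero) zero = A x1); module_ring V.
- change (plus (plus zero (A x2)) zero = A x2); module_ring V.
- change (plus (plus x1 zero) (A x3) = plus x1 (A x3)); module_ring V.
Qed.

Lemma Lambda1_dom (x1 x2 x3 : V) :
  dom (Lambda1 A) ((x1, x2, x3) : cube V) <-> dom A x1 /\ dom A x2 /\ dom A x3.
Proof. unfold Lambda1, op_matrix; simpl; tauto. Qed.

(** Solved row by row: the third equation is (z + A) y3 = x3 - y1, where y1 = R x1 comes from the
    first. *)
Lemma Lambda1_resolvent z : res_set z ->
  is_resolvent (op_opp (Lambda1 A)) z (block (res z) (Copp (RtoC 1)) (bl_comp (res z) (res z))).
Proof.
intros Hz; destruct (resolvent_spec _ _ Hz) as [H1 H2].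
destruct Alin as [_ [Ap As]].
set (S := res z) in *.
split.
- intros [[x1 x2] x3].
  assert (K : forall y : cube V,
    y = ((S x1, S x2, plus (scal (Copp (RtoC 1) : C_AbsRing) (bl_comp S S x1)) (S x3)) : cube V) ->
    dom (op_opp (Lambda1 A)) y /\
    minus (scal (z : C_AbsRing) y) (op_opp (Lambda1 A) y) = ((x1, x2, x3) : cube V));
    [|exact (K _ (block_app _ _ _ _ _ _))].
  intros y ->.
  destruct (H1 x1) as [D1 E1], (H1 x2) as [D2 E2], (H1 x3) as [D3 E3], (H1 (S x1)) as [D4 E4].
  change (dom A (S x1)) in D1; change (dom A (S x2)) in D2; change (dom A (S x3)) in D3.
  change (dom A (S (S x1))) in D4.
  destruct (As (Copp (RtoC 1)) _ D4) as [D5 E5].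
  destruct (Ap _ _ D5 D3) as [D6 E6].
  split; [apply Lambda1_dom; auto|].
  change (minus (scal (z : C_AbsRing) ((S x1, S x2, plus (scal (Copp (RtoC 1) : C_AbsRing) (bl_comp S S x1)) (S x3)) : cube V))
    (opp (Lambda1 A ((S x1, S x2, plus (scal (Copp (RtoC 1) : C_AbsRing) (bl_comp S S x1)) (S x3)) : cube V))) = (x1, x2, x3)).
  rewrite (Lambda1_app (S x1) (S x2) _), bl_comp_app.
  change (minus (scal (z : C_AbsRing) (S x1)) (opp (A (S x1))) = x1) in E1.
  change (minus (scal (z : C_AbsRing) (S x2)) (opp (A (S x2))) = x2) in E2.
  change (minus (scal (z : C_AbsRing) (S x3)) (opp (A (S x3))) = x3) in E3.
  change (minus (scal (z : C_AbsRing) (S (S x1))) (opp (A (S (S x1)))) = S x1) in E4.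
  refine (f_equal2 pair (f_equal2 pair _ _) _).
  + exact E1.
  + exact E2.
  + change (minus (scal (z : C_AbsRing) (plus (scal (Copp (RtoC 1) : C_AbsRing) (S (S x1))) (S x3)))
      (opp (plus (S x1) (A (plus (scal (Copp (RtoC 1) : C_AbsRing) (S (S x1))) (S x3))))) = x3).
    change (A (scal (Copp (RtoC 1) : C_AbsRing) (S (S x1))) = scal (Copp (RtoC 1) : C_AbsRing) (A (S (S x1)))) in E5.
    etransitivity; [|exact E3].
    rewrite <- E4 at 2.
    transitivity (minus (scal (z : C_AbsRing) (plus (scal (Copp (RtoC 1) : C_AbsRing) (S (S x1))) (S x3)))
      (opp (plus (minus (scal (z : C_AbsRing) (S (S x1))) (opp (A (S (S x1)))))
         (plus (scal (Copp (RtoC 1) : C_AbsRing) (A (S (S x1)))) (A (S x3)))))).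
    * do 3 f_equal. rewrite <- E5; exact E6.
    * module_ring V.
- intros [[x1 x2] x3] HD; apply Lambda1_dom in HD; destruct HD as [D1 [D2 D3]].
  assert (E1 := H2 _ D1); assert (E2 := H2 _ D2); assert (E3 := H2 _ D3).
  change (S (minus (scal (z : C_AbsRing) x1) (opp (A x1))) = x1) in E1.
  change (S (minus (scal (z : C_AbsRing) x2) (opp (A x2))) = x2) in E2.
  change (S (minus (scal (z : C_AbsRing) x3) (opp (A x3))) = x3) in E3.
  transitivity (block S (Copp (RtoC 1)) (bl_comp S S)
    ((minus (scal (z : C_AbsRing) x1) (opp (A x1)), minus (scal (z : C_AbsRing) x2) (opp (A x2)),
      minus (scal (z : C_AbsRing) x3) (opp (plus x1 (A x3)))) : cube V)).
  + f_equal.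
    change (minus (scal (z : C_AbsRing) ((x1, x2, x3) : cube V)) (opp (Lambda1 A ((x1, x2, x3) : cube V))) =
      (minus (scal (z : C_AbsRing) x1) (opp (A x1)), minus (scal (z : C_AbsRing) x2) (opp (A x2)),
      minus (scal (z : C_AbsRing) x3) (opp (plus x1 (A x3))))).
    rewrite Lambda1_app; reflexivity.
  + etransitivity; [exact (block_app _ _ _ _ _ _)|].
    rewrite bl_comp_app, E1, E2.
    refine (f_equal2 pair eq_refl _).
    transitivity (plus (scal (Copp (RtoC 1) : C_AbsRing) (S x1))
       (plus (S (minus (scal (z : C_AbsRing) x3) (opp (A x3)))) (S x1))).
    * f_equal; bl_push; module_ring V.
    * rewrite E3; module_ring V.
Qed.

(** On vectors (0, x, 0) the block resolvent acts through its middle diagonal entry alone. *)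
Lemma op_norm_resolvent_Lambda1 z : res_set z ->
  op_norm (res z) <= op_norm (resolvent (op_opp (Lambda1 A)) z).
Proof.
intros Hz; rewrite (resolvent_eq _ _ _ (Lambda1_resolvent z Hz)).
set (S := block (res z) (Copp (RtoC 1)) (bl_comp (res z) (res z))).
apply op_norm_le; [apply op_norm_ge_0|]; intros x.
assert (B := op_norm_apply S ((zero, x, zero) : cube V)).
assert (E : S ((zero, x, zero) : cube V) = ((zero, res z x, zero) : cube V)).
{ etransitivity; [exact (block_app _ _ _ _ _ _)|].
  refine (f_equal2 pair (f_equal2 pair _ eq_refl) _); bl_push; module_ring V. }
rewrite E in B.
destruct (norm_cube_ge zero (res z x) zero) as [_ [B1 _]].
assert (B2 := norm_cube_le zero x zero : norm ((zero, x, zero) : cube V) <= _).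
assert (Z : norm (zero : V) = 0) by exact norm_zero.
rewrite !Z in B2.
apply Rle_trans with (1 := B1), Rle_trans with (1 := B), Rmult_le_compat_l; [apply op_norm_ge_0|].
apply Rle_trans with (1 := B2); right; ring.
Qed.

(** Makes every contour admissible for [Lambda1 A] admissible for [A] with the same constant. *)
Lemma positivity_constant_of_Lambda1 M M' :
  positivity_constant A M -> positivity_constant (Lambda1 A) M' -> positivity_constant A M'.
Proof.
intros hM [H1 [H2 H3]]; split; [exact H1|split; [apply hM|]].
intros s Hs; apply Rle_trans with (2 := H3 s Hs), Rmult_le_compat_l; [lra|].
apply op_norm_resolvent_Lambda1, hM; lra.
Qed.

(** The diagonal contributes 3 M, and the corner entry R(s)^2 contributes (1 + s) |R(s)| |R(s)| <= M
    * M. *)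
Lemma positivity_constant_Lambda1 M :
  positivity_constant A M -> positivity_constant (Lambda1 A) (3 * M + M * M).
Proof.
intros [H1 [H2 H3]]; split; [nra|split].
- intros s Hs; eexists; apply Lambda1_resolvent, H2, Hs.
- intros s Hs; assert (Hz := H2 s (Rlt_le _ _ Hs)).
  rewrite (resolvent_eq _ _ _ (Lambda1_resolvent _ Hz)).
  assert (B := H3 s Hs); set (S := res (RtoC s)) in *; assert (N := op_norm_ge_0 S).
  assert (NB : op_norm (block S (Copp (RtoC 1)) (bl_comp S S)) <= 3 * op_norm S + 1 * (op_norm S * op_norm S)).
  { apply op_norm_plus_compat; [apply op_norm_diag|].
    apply (norm_scal_compat (V := BL_NormedModule (cube V))).
    - rewrite Cmod_opp, Cmod_1; apply Rle_refl.
    - apply Rle_trans with (1 := op_norm_low _), op_norm_comp. }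
  assert (op_norm S <= M) by nra.
  apply Rle_trans with ((1 + s) * (3 * op_norm S + 1 * (op_norm S * op_norm S))); [apply Rmult_le_compat_l; lra|].
  replace ((1 + s) * (3 * op_norm S + 1 * (op_norm S * op_norm S)))
    with (3 * ((1 + s) * op_norm S) + (1 + s) * op_norm S * op_norm S) by ring.
  apply Rplus_le_compat; [lra|apply Rmult_le_compat; nra].
Qed.

Lemma linear_operator_Lambda1 : linear_operator (Lambda1 A).
Proof.
destruct Alin as [A0 [Ap As]]; split; [|split].
- apply (Lambda1_dom zero zero zero); auto.
- intros [[x1 x2] x3] [[y1 y2] y3] Hx Hy; apply Lambda1_dom in Hx; apply Lambda1_dom in Hy.
  destruct Hx as [X1 [X2 X3]], Hy as [Y1 [Y2 Y3]].
  destruct (Ap _ _ X1 Y1) as [D1 E1], (Ap _ _ X2 Y2) as [D2 E2], (Ap _ _ X3 Y3) as [D3 E3].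
  split; [apply (Lambda1_dom (plus x1 y1) (plus x2 y2) (plus x3 y3)); auto|].
  etransitivity; [exact (Lambda1_app (plus x1 y1) (plus x2 y2) (plus x3 y3))|].
  etransitivity; [|symmetry; exact (f_equal2 (fun u v : cube V => plus u v) (Lambda1_app x1 x2 x3) (Lambda1_app y1 y2 y3))].
  refine (f_equal2 pair (f_equal2 pair E1 E2) _).
  rewrite E3; change (plus (plus x1 y1) (plus (A x3) (A y3)) = plus (plus x1 (A x3)) (plus y1 (A y3))); module_ring V.
- intros k [[x1 x2] x3] Hx; apply Lambda1_dom in Hx; destruct Hx as [X1 [X2 X3]].
  destruct (As k _ X1) as [D1 E1], (As k _ X2) as [D2 E2], (As k _ X3) as [D3 E3].
  split; [apply (Lambda1_dom (scal k x1) (scal k x2) (scal k x3)); auto|].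
  etransitivity; [exact (Lambda1_app (scal k x1) (scal k x2) (scal k x3))|].
  etransitivity; [|symmetry; exact (f_equal (fun u : cube V => scal k u) (Lambda1_app x1 x2 x3))].
  refine (f_equal2 pair (f_equal2 pair E1 E2) _).
  rewrite E3; change (plus (scal k x1) (scal k (A x3)) = scal k (plus x1 (A x3))); module_ring V.
Qed.

Lemma densely_defined_Lambda1 : densely_defined A -> densely_defined (Lambda1 A).
Proof.
intros HD [[x1 x2] x3] eps.
destruct (HD x1 eps) as [y1 [D1 B1]], (HD x2 eps) as [y2 [D2 B2]], (HD x3 eps) as [y3 [D3 B3]].
exists ((y1, y2, y3) : cube V); split; [apply Lambda1_dom; auto|].
exact (conj (conj B1 B2) B3).
Qed.

End Lambda.

(** * Fractional powers of the block operator *)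

Section LambdaPowers.

Context {V : NormedModule C_AbsRing}.
Variable cV : CompleteSpace.mixin_of V.
Variable A : operator V.
Hypothesis HA : positive_operator A.

Local Notation res := (resolvent (op_opp A)).

Lemma positive_operator_Lambda1 : positive_operator (Lambda1 A).
Proof.
destruct HA as [H1 [H2 [H3 [M hM]]]].
assert (hM' := positivity_constant_Lambda1 A H1 M hM).
split; [apply linear_operator_Lambda1, H1|split; [|split; [apply densely_defined_Lambda1, H3|eauto]]].
apply closed_operator_of_resolvent with (RtoC 0), hM', Rle_refl.
Qed.

Lemma is_neg_power_Lambda1 alpha : 0 < alpha ->
  is_neg_power (Lambda1 A) alpha (block (neg_power A alpha) (RtoC (- alpha)) (neg_power A (alpha + 1))).
Proof.
intros Ha; destruct HA as [Alin [_ [_ [M0 hM0]]]].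
intros M psi r0 g dg hL Hpsi Hr0 Hc.
assert (hM := positivity_constant_of_Lambda1 A Alin M0 M hM0 hL).
set (S := neg_power A alpha); set (T := neg_power A (alpha + 1)).
assert (I1 : is_contour_integral V A alpha g dg S)
  by (apply (neg_power_spec cV A M alpha hM Ha M psi r0); assumption).
assert (I2 : is_contour_integral V A (alpha + 1) g dg T)
  by (apply (neg_power_spec cV A M (alpha + 1) hM ltac:(lra) M psi r0); assumption).
apply is_contour_integral_frac in I1; apply is_contour_integral_frac in I2.
assert (I3 := sqr_resolvent_integral cV A M hM 0 alpha psi r0 g dg (Rle_refl _) ltac:(lra) Hpsi Hr0 Hc).
apply is_contour_integral_frac.
(* The vanishing integral of alpha (-z)^(-alpha-1) R - (-z)^(-alpha) R^2, placed in the corner, is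
   added to -alpha times that of (-z)^(-alpha-1) R: only -(-z)^(-alpha) R^2, the corner of the block
   integrand, is left. *)
refine (is_RInt_gen_std_eq _ _ _ _ (is_RInt_gen_std_plus _ _ _ _ (is_RInt_gen_std_plus _ _ _ _
   (is_RInt_gen_linear (V := BL_NormedModule V) (W := BL_NormedModule (cube V)) _ diag_op_linear _ _ _ _ I1)
   (is_RInt_gen_linear (V := BL_NormedModule V) (W := BL_NormedModule (cube V)) _ low_op_linear _ _ _ _ I3))
   (is_RInt_gen_std_scal (RtoC (- alpha)) _ _
   (is_RInt_gen_linear (V := BL_NormedModule V) (W := BL_NormedModule (cube V)) _ low_op_linear _ _ _ _ I2))) _ _).
- intros t.
  assert (Hz : resolvent_set (op_opp A) (g t)).
  { assert (Hcut := contour_region_cut M (proj1 hM) psi r0 (g t) Hpsi Hr0 (proj1 (proj2 Hc) t)).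
    rewrite <- (Cplus_0_r (g t)); apply (Omega_resolvent cV A M hM (g t) 0 (proj1 Hcut) (Rle_refl _)). }
  rewrite !shifted_frac_0, (resolvent_eq _ _ _ (Lambda1_resolvent A Alin _ Hz)).
  unfold shifted_resolvent; rewrite Cplus_0_r.
  set (R := res (g t)); set (w := Crpower (Copp (g t)) (- alpha)).
  set (w' := Crpower (Copp (g t)) (- (alpha + 1))).
  apply bl_ext; intros [[x1 x2] x3].
  transitivity ((scal (dg t : C_AbsRing) (scal (w : C_AbsRing) (R x1)), scal (dg t : C_AbsRing) (scal (w : C_AbsRing) (R x2)),
     scal (dg t : C_AbsRing) (scal (w : C_AbsRing) (plus (scal (Copp (RtoC 1) : C_AbsRing) (R (R x1))) (R x3)))) : cube V).
  + refine (f_equal2 pair (f_equal2 pair _ _) _).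
    * change (plus (plus (scal (dg t : C_AbsRing) (scal (w : C_AbsRing) (R x1))) zero) (scal (RtoC (- alpha) : C_AbsRing) zero) =
        scal (dg t : C_AbsRing) (scal (w : C_AbsRing) (R x1))); module_ring V.
    * change (plus (plus (scal (dg t : C_AbsRing) (scal (w : C_AbsRing) (R x2))) zero) (scal (RtoC (- alpha) : C_AbsRing) zero) =
        scal (dg t : C_AbsRing) (scal (w : C_AbsRing) (R x2))); module_ring V.
    * change (plus (plus (scal (dg t : C_AbsRing) (scal (w : C_AbsRing) (R x3)))
          ((scal (dg t : C_AbsRing) (minus (scal (RtoC alpha : C_AbsRing) (scal (w' : C_AbsRing) R))
              (scal (w : C_AbsRing) (bl_comp R R))) : BL V) x1))
          (scal (RtoC (- alpha) : C_AbsRing) (scal (dg t : C_AbsRing) (scal (w' : C_AbsRing) (R x1)))) =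
        scal (dg t : C_AbsRing) (scal (w : C_AbsRing) (plus (scal (Copp (RtoC 1) : C_AbsRing) (R (R x1))) (R x3)))).
      bl_push; rewrite RtoC_opp; module_ring V.
  + symmetry.
    exact (f_equal (fun u : cube V => scal (dg t : C_AbsRing) (scal (w : C_AbsRing) u)) (block_app R (Copp (RtoC 1)) (bl_comp R R) x1 x2 x3)).
- apply bl_ext; intros [[x1 x2] x3].
  etransitivity; [|symmetry; exact (f_equal (fun u : cube V => scal (Ctwopii : C_AbsRing) u) (block_app S (RtoC (- alpha)) T x1 x2 x3))].
  refine (f_equal2 pair (f_equal2 pair _ _) _).
  + change (plus (plus (scal (Ctwopii : C_AbsRing) (S x1)) zero) (scal (RtoC (- alpha) : C_AbsRing) zero) = scal (Ctwopii : C_AbsRing) (S x1)); module_ring V.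
  + change (plus (plus (scal (Ctwopii : C_AbsRing) (S x2)) zero) (scal (RtoC (- alpha) : C_AbsRing) zero) = scal (Ctwopii : C_AbsRing) (S x2)); module_ring V.
  + change (plus (plus (scal (Ctwopii : C_AbsRing) (S x3)) zero) (scal (RtoC (- alpha) : C_AbsRing) (scal (Ctwopii : C_AbsRing) (T x1))) =
      scal (Ctwopii : C_AbsRing) (plus (scal (RtoC (- alpha) : C_AbsRing) (T x1)) (S x3))); module_ring V.
Qed.

(** The block operator shows that some operator satisfies [is_neg_power], so the [epsilon] choice
    does too; along one admissible contour both are values of the same integral. *)
Lemma neg_power_Lambda1 alpha : 0 < alpha ->
  is_neg_power (Lambda1 A) alpha (neg_power (Lambda1 A) alpha) /\
  neg_power (Lambda1 A) alpha = block (neg_power A alpha) (RtoC (- alpha)) (neg_power A (alpha + 1)).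
Proof.
intros Ha; assert (H := is_neg_power_Lambda1 alpha Ha).
assert (H' : is_neg_power (Lambda1 A) alpha (neg_power (Lambda1 A) alpha)).
{ exact (epsilon_spec _ _ (ex_intro _ _ H)). }
split; [exact H'|].
destruct positive_operator_Lambda1 as [_ [_ [_ [M hM]]]].
apply (contour_integral_unique (Lambda1 A) alpha (std_g M) (std_dg M)).
- apply (H' M (std_psi M) (10 * std_r M)); [exact hM|apply (std_psi_bounds _ _ hM)|apply (std_r_bounds _ _ hM)|apply (std_is_contour _ _ hM)].
- apply (H M (std_psi M) (10 * std_r M)); [exact hM|apply (std_psi_bounds _ _ hM)|apply (std_r_bounds _ _ hM)|apply (std_is_contour _ _ hM)].
Qed.

End LambdaPowers.

(** [op_inv] takes some preimage chosen by [epsilon]; injectivity makes it the preimage at hand. *)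
Lemma op_inv_injective {V : NormedModule C_AbsRing} (T : BL V) (y : V) :
  (forall u v, T u = T v -> u = v) -> op_inv T (T y) = y.
Proof.
intros H; apply H.
exact (epsilon_spec (inhabits zero) (fun u => T u = T y) (ex_intro _ y eq_refl)).
Qed.

Theorem theorem3p5 (X : CompleteNormedModule C_AbsRing) (A : operator X)
    (hA : positive_operator A) (alpha : R) (halpha : 0 < alpha < 1) :
  (positive_operator (Lambda1 A) /\
   is_neg_power (Lambda1 A) alpha (neg_power (Lambda1 A) alpha)) /\
  op_eq (op_of_bl (neg_power (Lambda1 A) alpha))
    (op_matrix
       (op_of_bl (neg_power A alpha)) op_zero op_zero
       op_zero (op_of_bl (neg_power A alpha)) op_zero
       (op_scal (RtoC (- alpha)) (op_of_bl (neg_power A (alpha + 1))))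
         op_zero (op_of_bl (neg_power A alpha))) /\
  op_eq (pos_power (Lambda1 A) alpha)
    (op_matrix
       (pos_power A alpha) op_zero op_zero
       op_zero (pos_power A alpha) op_zero
       (op_scal (RtoC alpha) (op_of_bl (neg_power A (1 - alpha))))
         op_zero (pos_power A alpha)) /\
  (forall x1 x2 x3 : X,
     dom (pos_power (Lambda1 A) alpha) (x1, x2, x3) <->
     dom (pos_power A alpha) x1 /\ dom (pos_power A alpha) x2 /\
     dom (pos_power A alpha) x3).
Proof.
set (V := CompleteNormedModule.NormedModule C_AbsRing X : NormedModule C_AbsRing).
change (operator V) in A; change (@positive_operator V A) in hA.
assert (cV : CompleteSpace.mixin_of V)
  by exact (CompleteNormedModule.mixin C_AbsRing X (CompleteNormedModule.class C_AbsRing X)).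
destruct (neg_power_Lambda1 cV A hA alpha (proj1 halpha)) as [HL EL].
assert (HP := positive_operator_Lambda1 A hA).
destruct hA as [_ [_ [_ [M hM]]]].
set (B := neg_power A alpha) in *.
set (N := neg_power (Lambda1 A) alpha) in *.
set (R0 := resolvent (op_opp A) (RtoC 0)).
assert (EC : neg_power A (alpha + 1) = bl_comp B R0).
{ exact (neg_power_succ cV A M hM alpha (proj1 halpha)). }
(* The complementary identity for 1 - alpha, with the factors in the order that gives both the
   injectivity of [B] and the value of A^(alpha-1) on the range of [B]. *)
assert (EB : forall x, neg_power A (1 - alpha) (B x) = R0 x).
{ intros x; assert (E := neg_power_complementary cV A M hM (1 - alpha) x ltac:(lra)).
  replace (1 - (1 - alpha)) with alpha in E by ring; exact E. }
(* Since A^(-alpha-1) = A^(-alpha) A^-1, [N] is the shear y3 |-> y3 - alpha A^-1 y1 followed by [B]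
   in each coordinate. This shows at once its injectivity, its range and its inverse. *)
assert (EN : forall y1 y2 y3 : V, N ((y1, y2, y3) : cube V) =
   ((B y1, B y2, B (plus (scal (RtoC (- alpha) : C_AbsRing) (R0 y1)) y3)) : cube V)).
{ intros y1 y2 y3; rewrite EL; etransitivity; [exact (block_app _ _ _ _ _ _)|].
  refine (f_equal2 pair eq_refl _); rewrite EC; bl_push; reflexivity. }
assert (HB : forall u v, B u = B v -> u = v).
{ intros u v E; apply (R0_injective A M hM); fold R0; rewrite <- !EB, E; reflexivity. }
assert (HN : forall u v, N u = N v -> u = v).
{ intros [[u1 u2] u3] [[v1 v2] v3] E; rewrite !EN in E; injection E as E1 E2 E3.
  apply HB in E1; apply HB in E2; apply HB in E3; subst v1 v2; do 1 f_equal.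
  transitivity (minus (plus (scal (RtoC (- alpha) : C_AbsRing) (R0 u1)) u3) (scal (RtoC (- alpha) : C_AbsRing) (R0 u1)));
    [module_ring V|rewrite E3; module_ring V]. }
assert (HD : forall x1 x2 x3 : V,
  dom (pos_power (Lambda1 A) alpha) ((x1, x2, x3) : cube V) <->
  dom (pos_power A alpha) x1 /\ dom (pos_power A alpha) x2 /\ dom (pos_power A alpha) x3).
{ intros x1 x2 x3; split.
  - intros [[[y1 y2] y3] E]; fold N in E; rewrite EN in E; injection E as E1 E2 E3.
    split; [exists y1; exact E1|split; [exists y2; exact E2|eexists; exact E3]].
  - intros [[y1 E1] [[y2 E2] [y3 E3]]]; fold B in E1, E2, E3.
    (* The inverse shear is applied to the coordinatewise preimages. *)
    exists ((y1, y2, plus (scal (RtoC alpha : C_AbsRing) (R0 y1)) y3) : cube V); fold N.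
    rewrite EN; refine (f_equal2 pair (f_equal2 pair E1 E2) _).
    rewrite <- E3; f_equal; rewrite RtoC_opp; module_ring V. }
split; [split; [exact HP|exact HL]|split; [|split; [|exact HD]]].
- split; [intros [[x1 x2] x3]; simpl; tauto|].
  intros [[x1 x2] x3] _.
  etransitivity; [exact (EN x1 x2 x3)|].
  refine (f_equal2 pair (f_equal2 pair _ _) _).
  + change (B x1 = plus (plus (B x1) zero) zero); module_ring V.
  + change (B x2 = plus (plus zero (B x2)) zero); module_ring V.
  + change (B (plus (scal (RtoC (- alpha) : C_AbsRing) (R0 x1)) x3) =
      plus (plus (scal (RtoC (- alpha) : C_AbsRing) (neg_power A (alpha + 1) x1)) zero) (B x3)).
    rewrite EC; bl_push; module_ring V.
- split.
  + intros [[x1 x2] x3]; rewrite (HD x1 x2 x3).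
    change (dom (pos_power A alpha) x1 /\ dom (pos_power A alpha) x2 /\ dom (pos_power A alpha) x3 <->
      (dom (pos_power A alpha) x1 /\ True /\ True) /\ (True /\ dom (pos_power A alpha) x2 /\ True) /\
      (True /\ True /\ dom (pos_power A alpha) x3)); tauto.
  + intros [[x1 x2] x3] [[[y1 y2] y3] E]; fold N in E.
    rewrite <- E; etransitivity; [exact (op_inv_injective N _ HN)|].
    rewrite EN in E; injection E as E1 E2 E3; rewrite EN.
    set (y3' := plus (scal (RtoC (- alpha) : C_AbsRing) (R0 y1)) y3).
    refine (f_equal2 pair (f_equal2 pair _ _) _).
    * change (y1 = plus (plus (op_inv B (B y1)) zero) zero).
      rewrite (op_inv_injective B y1 HB); module_ring V.
    * change (y2 = plus (plus zero (op_inv B (B y2))) zero).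
      rewrite (op_inv_injective B y2 HB); module_ring V.
    (* On x1 = B y1 the corner entry alpha A^(alpha-1) gives alpha A^-1 y1, which cancels the shear
       contained in [y3']. *)
    * change (y3 = plus (plus (scal (RtoC alpha : C_AbsRing) (neg_power A (1 - alpha) (B y1))) zero)
        (op_inv B (B y3'))).
      rewrite (op_inv_injective B y3' HB), EB; unfold y3'; rewrite RtoC_opp; module_ring V.
Qed.
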